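(* Assume that the following (conjectural) statement holds: for every $s\in(1,\infty)$ and every $s$-concave Banach function space $Y$ over $\mathbb R^n$, if the Hardy--Littlewood maximal operator $M$ is bounded on $Y$, then $M$ is bounded on $Y'$. Let $X$ be an $r$-convex Banach function space over $\mathbb R^n$ for some $r\in(1,\infty)$. If $m_\lambda$ is bounded on $X$ and on $X'$ for some $\lambda\in(0,1)$, then $M$ is bounded on $X$.
   Context: Let $L^0(\mathbb R^n)$ be the space of measurable functions on $\mathbb R^n$. A vector space $X\subseteq L^0(\mathbb R^n)$ with a norm $\|\cdot\|_X$ is a Banach function space over $\mathbb R^n$ if: (Ideal property) if $f\in X$, $g\in L^0(\mathbb R^n)$ and $|g|\le|f|$, then $g\in X$ and $\|g\|_X\le\|f\|_X$; (Fatou property) if $0\le f_j\uparrow f$ with $f_j\in X$ and $\sup_j\|f_j\|_X<\infty$, then $f\in X$ and $\|f\|_X=\sup_j\|f_j\|_X$; (Saturation property) for every measurable $E\subset\mathbb R^n$ of positive measure there is a measurable $F\subseteq E$ of positive measure with $\chi_F\in X$. The associate space $X'$ is the space of all $f\in L^0(\mathbb R^n)$ with $\|f\|_{X'}:=\sup_{\|g\|_X\le1}\int_{\mathbb R^n}|fg|<\infty$. $X$ is $p$-convex if $\|(|f|^p+|g|^p)^{1/p}\|_X\le(\|f\|_X^p+\|g\|_X^p)^{1/p}$ for all $f,g\in X$, and $q$-concave if $(\|f\|_X^q+\|g\|_X^q)^{1/q}\le\|(|f|^q+|g|^q)^{1/q}\|_X$ for all $f,g\in X$. The Hardy--Littlewood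 maximal operator is $Mf(x):=\sup_{Q\ni x}\frac1{|Q|}\int_Q|f|$, the supremum over all cubes $Q\subset\mathbb R^n$ containing $x$. For $\lambda\in(0,1)$ the $\lambda$-median maximal operator is $$m_\lambda f(x):=\sup_{Q\ni x}(f\chi_Q)^*(\lambda|Q|),$$ the supremum over all cubes containing $x$, where $f^*$ is the non-increasing rearrangement, i.e. $(f\chi_Q)^*(\lambda|Q|)=\inf\{\alpha>0:|\{x\in Q:|f(x)|>\alpha\}|\le\lambda|Q|\}$. An operator $T$ is bounded on a space $Y$ if there is $C>0$ such that $\|Tf\|_Y\le C\|f\|_Y$ for all $f\in Y$. *)

(* Defs.v *)
From HB Require Import structures.
From mathcomp Require Import all_boot all_order all_algebra.
From mathcomp Require Import all_classical all_reals all_analysis.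

Set Implicit Arguments.
Unset Strict Implicit.
Unset Printing Implicit Defensive.

Import Order.TTheory GRing.Theory Num.Theory.
Import numFieldNormedType.Exports.

Local Open Scope classical_set_scope.
Local Open Scope ring_scope.

(* R^n is [n.-tuple R] with the product (= Borel) sigma-algebra. *)
Notation Rn R n := (n.-tuple (measurableTypeR R)).

Definition tuple_cons {R : realType} {n : nat}
  (p : measurableTypeR R * Rn R n) : Rn R n.+1 := [tuple of p.1 :: p.2].

(* R^(n+1) is identified with R * R^n by [tuple_cons]. *)
Fixpoint lebesgue_Rn {R : realType} (n : nat) : set (Rn R n) -> \bar R :=
  if n is m.+1 return set (Rn R n) -> \bar R
  then pushforward (@lebesgue_measure R \x lebesgue_Rn (n := m))%E tuple_cons
  else \d_[tuple].
Arguments lebesgue_Rn {R} n.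

Section lebesgue_Rn_measure.
Context {R : realType}.

Lemma measurable_tuple_cons n :
  measurable_fun setT (@tuple_cons R n).
Proof.
exact: (@measurable_cons _ _ _ _ fst n snd measurable_fst measurable_snd).
Qed.

Lemma measurable_tuple_split n : measurable_fun setT
  (fun t : Rn R n.+1 => (thead t, [tuple of behead t]) :
     measurableTypeR R * Rn R n).
Proof.
apply/measurable_fun_pair; last exact: measurable_behead.
exact: measurable_tnth.
Qed.

Lemma sigma_finite_lebesgue_Rn_subproof n :
  exists m : {sigma_finite_measure set (Rn R n) -> \bar R},
    (m : set _ -> \bar R) = lebesgue_Rn n.
Proof.
elim: n => [|n [m /= <-]].
  by exists (\d_([tuple] : Rn R 0)).
pose q : {measure set (Rn R n.+1) -> \bar R} :=
  measure_function_pushforward__canonical__measure_function_Measure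
    (@lebesgue_measure R \x m)%E (@measurable_tuple_cons n).
have sq : sigma_finite setT q.
  have /sigma_finiteP[F [TF ndF Fm]] := sigma_finiteT (@lebesgue_measure R).
  have /sigma_finiteP[G [TG ndG Gm]] := sigma_finiteT m.
  pose s (t : Rn R n.+1) : measurableTypeR R * Rn R n :=
    (thead t, [tuple of behead t]).
  exists (fun k => s @^-1` (F k `*` G k)).
    apply/esym/seteqP; split=> // t _ /=.
    have [i _ Fi] : (\bigcup_i F i) (s t).1 by rewrite -TF.
    have [j _ Gj] : (\bigcup_i G i) (s t).2 by rewrite -TG.
    exists (maxn i j) => //; split.
    - by move: Fi; exact/subsetPset/ndF/leq_maxl.
    - by move: Gj; exact/subsetPset/ndG/leq_maxr.
  move=> k; have [mF Fk] := Fm k; have [mG Gk] := Gm k; split.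
    by rewrite -[X in measurable X]setTI; apply: measurable_tuple_split => //;
       exact: measurableX.
  rewrite /q /= /pushforward (_ : _ @^-1` _ = F k `*` G k).
    by rewrite product_measure1E// lte_mul_pinfty// ge0_fin_numE.
  apply/seteqP; split => -[x t] /=; rewrite /s /tuple_cons /= theadE;
    rewrite (_ : [tuple of _] = t)//; exact/val_inj.
pose Q := Measure_isSigmaFinite.Build _ _ _ q sq.
pose m' : {sigma_finite_measure set (Rn R n.+1) -> \bar R} :=
  HB.pack (Measure.sort q) Q.
by exists m'.
Qed.

Variable n : nat.

Let lebesgue_Rn0 : lebesgue_Rn n set0 = 0%E :> \bar R.
Proof. by have [m <-] := sigma_finite_lebesgue_Rn_subproof n. Qed.

Let lebesgue_Rn_ge0 A : (0 <= lebesgue_Rn n A :> \bar R)%E.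
Proof. by have [m <-] := sigma_finite_lebesgue_Rn_subproof n. Qed.

Let lebesgue_Rn_sigma_additive : semi_sigma_additive (@lebesgue_Rn R n).
Proof.
have [m <-] := sigma_finite_lebesgue_Rn_subproof n.
exact: measure_semi_sigma_additive.
Qed.

HB.instance Definition _ := isMeasure.Build _ _ _ (@lebesgue_Rn R n)
  lebesgue_Rn0 lebesgue_Rn_ge0 lebesgue_Rn_sigma_additive.

Let sigma_finite_lebesgue_Rn : sigma_finite setT (@lebesgue_Rn R n).
Proof.
have [m <-] := sigma_finite_lebesgue_Rn_subproof n; exact: sigma_finiteT.
Qed.

HB.instance Definition _ := Measure_isSigmaFinite.Build _ _ _
  (@lebesgue_Rn R n) sigma_finite_lebesgue_Rn.

End lebesgue_Rn_measure.

Lemma lebesgue_Rn_box {R : realType} (n : nat) (A : 'I_n -> set R) :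
  (forall i, measurable (A i : set (measurableTypeR R))) ->
  lebesgue_Rn n [set x : Rn R n | forall i, A i (tnth x i)] =
  (\prod_(i < n) lebesgue_measure (A i))%E.
Proof.
elim: n A => [|n IHn] A mA.
  rewrite big_ord0 /= diracE mem_set// => -[].
  by [].
have mbox k (B : 'I_k -> set R) :
    (forall i, measurable (B i : set (measurableTypeR R))) ->
    measurable [set x : Rn R k | forall i, B i (tnth x i)].
  move=> mB.
  rewrite [X in measurable X](_ : _ =
      \bigcap_(i in [set: 'I_k]) ((fun x : Rn R k => tnth x i) @^-1` B i)).
    apply: fin_bigcap_measurable => // i _; rewrite -[X in measurable X]setTI.
    exact: measurable_tnth.
  by apply/seteqP; split=> x h i; [move=> _; exact: h|exact: (h i I)].
rewrite big_ord_recl -(IHn (fun i => A (lift ord0 i)))//.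
rewrite [lebesgue_Rn n.+1 _]/= /pushforward (_ : _ @^-1` _ =
  A ord0 `*` [set x : Rn R n | forall i, A (lift ord0 i) (tnth x i)]).
  by rewrite product_measure1E//; exact: (mbox _ (fun i => A (lift ord0 i))).
apply/seteqP; split => -[x t] /=.
  move=> h; split; first exact: (h ord0).
  by move=> i; have := h (lift ord0 i); rewrite tnthS.
by move=> [h0 h] i; case: (unliftP ord0 i) => [j|] ->//; rewrite tnthS; exact: h.
Qed.

Section banach_function_spaces.
Context d (T : measurableType d) {R : realType}.
Variable mu : {measure set T -> \bar R}.
Implicit Types (f g : T -> R) (p q : R).

(* A subset of L^0 together with a candidate norm.  Elements of L^0 are
   represented by measurable real-valued functions, so that pointwise relations
   between them are required a.e.; [norm] is irrelevant outside [carrier]. *)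
Record function_space := FunctionSpace {
  carrier : set (T -> R) ;
  norm : (T -> R) -> R }.
Implicit Type X : function_space.

(* The carrier is invariant under a.e. equality by the ideal property. *)
Record is_Banach_function_space X : Prop := {
  bfs_measurable : forall f, carrier X f -> measurable_fun setT f ;
  bfs_zero : carrier X (cst 0) ;
  bfs_add : forall f g, carrier X f -> carrier X g -> carrier X (f \+ g) ;
  bfs_scale : forall (c : R) f, carrier X f -> carrier X (fun x => c * f x) ;
  bfs_norm_ge0 : forall f, carrier X f -> 0 <= norm X f ;
  bfs_norm_eq0 : forall f, carrier X f -> norm X f = 0 ->
    \forall x \ae mu, f x = 0 ;
  bfs_normZ : forall (c : R) f, carrier X f ->
    norm X (fun x => c * f x) = `|c| * norm X f ;
  bfs_normD : forall f g, carrier X f -> carrier X g ->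
    norm X (f \+ g) <= norm X f + norm X g ;
  bfs_ideal : forall f g, carrier X f -> measurable_fun setT g ->
    (\forall x \ae mu, `|g x| <= `|f x|) ->
    carrier X g /\ norm X g <= norm X f ;
  bfs_Fatou : forall (f_ : nat -> T -> R) f,
    (forall j, carrier X (f_ j)) -> measurable_fun setT f ->
    (\forall x \ae mu, forall j, 0 <= f_ j x <= f_ j.+1 x) ->
    (\forall x \ae mu, f_ j x @[j --> \oo] --> f x) ->
    has_ubound (range (fun j => norm X (f_ j))) ->
    carrier X f /\ norm X f = sup (range (fun j => norm X (f_ j))) ;
  bfs_saturation : forall E, measurable E -> (0 < mu E)%E ->
    exists F, [/\ measurable F, F `<=` E, (0 < mu F)%E & carrier X \1_F] }.

Definition associate_enorm X f : \bar R :=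
  ereal_sup [set (\int[mu]_x `|f x * g x|%:E)%E |
             g in [set g | carrier X g /\ norm X g <= 1]].

Definition associate X : function_space := {|
  carrier := [set f | measurable_fun setT f /\ (associate_enorm X f < +oo)%E] ;
  norm := fun f => fine (associate_enorm X f) |}.

Definition p_convex p X := forall f g, carrier X f -> carrier X g ->
  norm X (fun x => (`|f x| `^ p + `|g x| `^ p) `^ p^-1)
    <= (norm X f `^ p + norm X g `^ p) `^ p^-1.

Definition q_concave q X := forall f g, carrier X f -> carrier X g ->
  (norm X f `^ q + norm X g `^ q) `^ q^-1
    <= norm X (fun x => (`|f x| `^ q + `|g x| `^ q) `^ q^-1).

(* [Op f] may take infinite values; boundedness includes the claim that its
   a.e. class belongs to X, in particular that it is finite a.e. *)
Definition bounded_operator (Op : (T -> R) -> T -> \bar R) X :=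
  exists2 C : R, 0 < C & forall f, carrier X f ->
    exists g, [/\ carrier X g, \forall x \ae mu, (g x)%:E = Op f x &
                  norm X g <= C * norm X f].

Definition rearrangement f (t : \bar R) : \bar R :=
  ereal_inf [set a%:E | a in
    [set a : R | 0 < a /\ (mu [set x | (a < `|f x|)%R] <= t)%E]].

End banach_function_spaces.
Arguments function_space {d} T R.

Section maximal_operators.
Context {R : realType} {n : nat}.
Implicit Types (f : Rn R n -> R) (Q : set (Rn R n)).

(* Cubes have sides parallel to the axes.  Half-open cubes are Borel and partition dyadically; taking open or closed
   cubes instead gives pointwise the same maximal operators. *)
Definition cube (a : Rn R n) (l : R) : set (Rn R n) :=
  [set x | forall i, `[tnth a i : R, (tnth a i : R) + l[%classic (tnth x i)].

Definition cubes_at (x : Rn R n) : set (set (Rn R n)) :=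
  [set Q | Q x /\ exists a (l : R), 0 < l /\ Q = cube a l].

Definition maximal f (x : Rn R n) : \bar R :=
  ereal_sup [set ((lebesgue_Rn n Q)^-1 *
                  \int[lebesgue_Rn n]_(y in Q) `|f y|%:E)%E | Q in cubes_at x].

Definition median_maximal (lambda : R) f (x : Rn R n) : \bar R :=
  ereal_sup [set rearrangement (lebesgue_Rn n) (f \* \1_Q)
                   (lambda%:E * lebesgue_Rn n Q) | Q in cubes_at x].

End maximal_operators.

(* Main.v *)
Require Import Defs.
From mathcomp Require Import all_boot all_order all_algebra.
From mathcomp Require Import all_classical all_reals all_analysis.
From mathcomp Require Import measurable_realfun ring lra.

Set Implicit Arguments.
Unset Strict Implicit.
Unset Printing Implicit Defensive.

Import Order.TTheory GRing.Theory Num.Theory.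
Import numFieldNormedType.Exports.

Local Open Scope classical_set_scope.
Local Open Scope ring_scope.

(** The maximal operator is first bounded for finite families of cubes, uniformly in
the family.  Go through the cubes by decreasing averages of [f], and keep a cube [Q]
when at most the proportion [lambda] of it is covered by the parts kept before; let
[E_Q] be the rest of it, and let [F] be the sum of [<f>_Q 1_{E_Q}] over the kept
cubes.  On each cube of the family, kept or not, [F] is at least the average of [f]
on more than the proportion [lambda] ([select_cubes]).  So the maximal function of
[f] over the family is at most the median maximal function of [F], and it remains to
bound the norm of [F] by that of [f].

This is a minimax argument ([norm_step_average_le]).  Consider the convex set of
functions between 0 and [F] that keep half of the mass of [F] on each [E_Q].  An
element of least norm in L2 shows ([convex_separation]) that this set either comes
arbitrarily close to a given ball of [X], or is separated from it by some [g] in the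
unit ball of the associate space [X'].  In the first case an element of the ball is
comparable to [F] on a fixed proportion of each [E_Q].  In the second case let [m_Q]
be a median of [g] on [E_Q]; testing with the part of [F] where [g <= m_Q] bounds
the sum of [<f>_Q m_Q |E_Q|] from below, whereas [g] dominates the sum of [m_Q] times
the indicator of the part of [E_Q] where [g >= m_Q].  Both cases conclude by spreading
values over larger sets, in two ways.

Values on a fixed proportion of disjoint subsets of cubes can be spread over these
subsets ([step_spread]), because boundedness of the median maximal operator improves
itself: if a set has density at most [lambda] in a cube, the cubes inside in which its
density exceeds [lambda] cover more than the set by a factor [g > 1]
([density_growth]), so [k] further applications of the operator lower the proportion
that it sees from [lambda] to [lambda g ^- k], at the cost of [k] further factors [A]
([median_expansion]).

Values on the sets [E_Q] can be spread, in [X'], over the whole overlapping cubes [Q]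
([step_dual]); then the sum of [m_Q 1_Q] has bounded norm in [X'], and pairing it with
[f] gives an upper bound for the sum of [m_Q <f>_Q |Q|].  Here the conjecture enters.
Duality makes [X'] concave ([associate_q_concave]), hence so is its power space [Y] of
functions [f] with [|f| ^ N] in [X'].  The average of [f] over a cube is at
most a weighted sum of the levels that [f] exceeds on the proportion [lambda g ^- k], with
weights [g ^- k]; in [Y] these levels only grow like powers of [A ^ (1 / N)], and for
[A < g ^ N] the sum converges, so the maximal operator is bounded on [Y]
([maximal_power_space]).  By the conjecture it is bounded on the associate space of
[Y], and the dual form of this bound is the spreading property.

The Fatou property, applied to an exhaustion by rational cubes, leads from finite
families to all cubes ([maximal_bounded]). *)

(** * Indicators and comparison sets *)

Section comparison_sets.
Context d (T : measurableType d) {R : realType}.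
Implicit Types f g : T -> R.

Lemma measurable_set_le f g : measurable_fun setT f -> measurable_fun setT g ->
  measurable [set x | f x <= g x].
Proof.
by move=> mf mg; rewrite -[X in measurable X]setTI; exact: measurable_fun_ler.
Qed.

Lemma measurable_set_lt f g : measurable_fun setT f -> measurable_fun setT g ->
  measurable [set x | f x < g x].
Proof.
by move=> mf mg; rewrite -[X in measurable X]setTI; exact: measurable_fun_ltr.
Qed.

Lemma indic_ge0 (A : set T) x : 0 <= \1_A x :> R.
Proof. by rewrite indicE; case: (_ \in _). Qed.

Lemma indic_sub (A B : set T) x : A `<=` B -> `|\1_A x| <= `|\1_B x| :> R.
Proof.
move=> AB; rewrite !ger0_norm ?indic_ge0// !indicE.
have [Ax|nAx] := pselect (A x); last by rewrite memNset.
by rewrite mem_set// (mem_set (AB x Ax)).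
Qed.

End comparison_sets.

(** * Limits in Banach function spaces *)

Section bfs_theory.
Context d (T : measurableType d) {R : realType}.
Variable mu : {measure set T -> \bar R}.
Variable X : function_space T R.
Hypothesis HX : is_Banach_function_space mu X.
Implicit Types f g : T -> R.

Lemma bfs_dom f g : carrier X f -> measurable_fun setT g ->
  (forall x, `|g x| <= `|f x|) -> carrier X g.
Proof. by move=> Xf mg gf; apply: (bfs_ideal HX Xf mg _).1; apply: aeW. Qed.

Lemma bfs_norm_le f g : carrier X f -> measurable_fun setT g ->
  (\forall x \ae mu, `|g x| <= `|f x|) -> norm X g <= norm X f.
Proof. by move=> Xf mg gf; exact: (bfs_ideal HX Xf mg gf).2. Qed.

Lemma bfs_abs f : carrier X f -> carrier X (fun x => `|f x|).
Proof.
move=> Xf; apply: (bfs_dom Xf) => [|x]; last by rewrite normr_id.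
by apply: measurableT_comp => //; exact: (bfs_measurable HX Xf).
Qed.

Lemma bfs_norm_abs f : carrier X f -> norm X (fun x => `|f x|) = norm X f.
Proof.
move=> Xf; apply/eqP; rewrite eq_le; apply/andP; split.
  apply: bfs_norm_le => //; first exact: (bfs_measurable HX (bfs_abs Xf)).
  by apply: aeW => x; rewrite normr_id.
apply: bfs_norm_le => //; first exact: bfs_abs.
  exact: (bfs_measurable HX Xf).
by apply: aeW => x; rewrite normr_id.
Qed.

Lemma bfs_norm0 : norm X (cst 0) = 0.
Proof.
have := bfs_normZ HX 0 (bfs_zero HX); rewrite normr0 mul0r => h.
by rewrite -[RHS]h; congr (norm X _); apply/funext => x; rewrite mul0r.
Qed.

Lemma bfs_sum (I : eqType) (s : seq I) (F : I -> T -> R) :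
  (forall i, i \in s -> carrier X (F i)) ->
  carrier X (fun x => \sum_(i <- s) F i x) /\
  norm X (fun x => \sum_(i <- s) F i x) <= \sum_(i <- s) norm X (F i).
Proof.
elim: s => [|i s IH] h.
  rewrite big_nil (_ : (fun x => _) = cst 0); last first.
    by apply/funext => x; rewrite big_nil.
  by split; [exact: (bfs_zero HX)|rewrite bfs_norm0 lexx].
have [Xs Ns] := IH (fun j js => h j (@mem_behead _ (i :: s) j js)).
have Xi := h i (mem_head _ _).
rewrite (_ : (fun x => _) = F i \+ (fun x => \sum_(j <- s) F j x)); last first.
  by apply/funext => x; rewrite big_cons.
split; first exact: (bfs_add HX).
by rewrite big_cons (le_trans (bfs_normD HX Xi Xs))// lerD2l.
Qed.

Lemma bfs_indic_norm_gt0 F : measurable F -> (0 < mu F)%E -> carrier X \1_F ->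
  0 < norm X \1_F.
Proof.
move=> mF F0 XF; rewrite lt_neqAle (bfs_norm_ge0 HX XF) andbT eq_sym.
apply/eqP => /(bfs_norm_eq0 HX XF) [N [mN N0 sN]].
move: F0; apply/negP; rewrite -leNgt -N0; apply: le_measure; rewrite ?inE//.
by move=> x Fx; apply: sN => /=; rewrite indicE mem_set// => /eqP; rewrite oner_eq0.
Qed.

(** Saturation rules out mass escaping to infinity: on a set where [G_ j] blows
up, the norms of [G_ j] would dominate arbitrarily large multiples of an
indicator. *)
Lemma bfs_monotone_limit (G_ : nat -> T -> R) (C : R) :
  (forall j, carrier X (G_ j)) ->
  (\forall x \ae mu, forall j, 0 <= G_ j x <= G_ j.+1 x) ->
  (forall j, norm X (G_ j) <= C) ->
  exists G, [/\ carrier X G, norm X G <= C &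
    \forall x \ae mu, G_ j x @[j --> \oo] --> G x].
Proof.
move=> XG ndG GC.
have mG j : measurable_fun setT (G_ j) by exact: (bfs_measurable HX (XG j)).
pose S x : \bar R := ereal_sup (range (fun j => (G_ j x)%:E)).
have mS : measurable_fun setT S.
  rewrite (_ : S = fun x => esups (fun j => (G_ j x)%:E) 0%N).
    by apply: measurable_fun_esups => j; exact/measurable_EFinP.
  apply/funext => x; rewrite /S /esups /sdrop; congr ereal_sup.
  by apply/seteqP; split => y /= [j _ <-]; exists j.
pose E := S @^-1` [set +oo%E].
have mE : measurable E by rewrite -[E]setTI; exact: mS.
have muE : mu E = 0%E.
  apply/eqP; rewrite eq_le measure_ge0 andbT leNgt; apply/negP => E0.
  have [F [mF FE F0 XF]] := bfs_saturation HX mE E0.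
  have n0 := bfs_indic_norm_gt0 mF F0 XF.
  have C0 : 0 <= C by apply: le_trans (GC 0%N); exact: (bfs_norm_ge0 HX (XG 0%N)).
  pose t := (C + 1) / norm X \1_F.
  have t0 : 0 <= t by rewrite divr_ge0 ?(ltW n0)// addr_ge0.
  pose f_ j x := Num.min (G_ j x) (t * \1_F x).
  have mtF : measurable_fun setT (fun x => t * \1_F x).
    exact: (bfs_measurable HX (bfs_scale HX t XF)).
  have mf j : measurable_fun setT (f_ j) by apply: measurable_minr.
  have tF0 x : 0 <= t * \1_F x by rewrite mulr_ge0// indicE; case: (_ \in _).
  have ff j : \forall x \ae mu, `|f_ j x| <= `|G_ j x|.
    move: ndG; apply: filterS => x /(_ j) /andP[G0 _].
    by rewrite ger0_norm ?le_min ?G0 ?tF0// ger0_norm// ge_min lexx.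
  have Xf j : carrier X (f_ j) by have := bfs_ideal HX (XG j) (mf j) (ff j) => -[].
  have Nf j : norm X (f_ j) <= C.
    exact: (le_trans (bfs_norm_le (XG j) (mf j) (ff j)) (GC j)).
  have := @bfs_Fatou _ _ _ mu X HX f_ (fun x => t * \1_F x) Xf mtF.
  case.
  - move: ndG; apply: filterS => x h j; have /andP[G0 G1] := h j.
    by rewrite /f_ le_min G0 tF0/= le_min !ge_min G1 lexx orbT.
  - move: ndG; apply: filterS => x h; rewrite /f_ indicE.
    case: (boolP (x \in F)) => /= [xF|_]; last first.
      rewrite mulr0 (_ : (fun j => _) = (fun=> 0)); first exact: cvg_cst.
      by apply/funext => j; rewrite min_r//; have /andP[] := h j.
    rewrite mulr1.
    have : S x = +oo%E by exact: (FE _ (set_mem xF)).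
    move=> Sx; have : (t%:E < S x)%E by rewrite Sx ltry.
    move=> /ereal_sup_gt[_ [j _ <-]]; rewrite lte_fin => tj.
    have ndGx : {homo (G_ ^~ x) : m n / (m <= n)%N >-> m <= n}.
      by apply/nondecreasing_seqP => n; have /andP[] := h n.
    apply: cvg_near_cst; exists j => //= m /= jm.
    by rewrite min_r// (le_trans (ltW tj))// ndGx.
  - by exists C => _ [j _ <-].
  move=> _; apply/eqP; rewrite gt_eqF//; apply: (@le_lt_trans _ _ C).
    by apply: ge_sup => [|_ [j _ <-]//]; exists (norm X (f_ 0%N)), 0%N.
  by rewrite (bfs_normZ HX t XF) ger0_norm// /t divfK ?gt_eqF// ltrDl.
pose G x := fine (S x).
have mGG : measurable_fun setT G by apply: measurableT_comp.
have aE : \forall x \ae mu, ~ E x by exists E; split => // x /= /contrapT.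
have Gcvg : \forall x \ae mu, G_ j x @[j --> \oo] --> G x.
  apply: filterS2 ndG aE => x h nE.
  have ndGx : {homo (fun j => (G_ j x)%:E) : m n / (m <= n)%N >-> (m <= n)%E}.
    apply/nondecreasing_seqP => n; rewrite lee_fin; by have /andP[] := h n.
  have := ereal_nondecreasing_cvgn ndGx; rewrite -/(S x) => cS.
  have fS : S x \is a fin_num.
    rewrite ge0_fin_numE ?ltey; first exact/eqP.
    apply: (@le_trans _ _ (G_ 0%N x)%:E); first by rewrite lee_fin; have /andP[] := h 0%N.
    by apply: ereal_sup_ubound; exists 0%N.
  by move: cS; rewrite -(fineK fS) => /fine_cvgP[].
have hb : has_ubound (range (fun j => norm X (G_ j))) by exists C => _ [j _ <-].
have [XGG NG] := bfs_Fatou HX XG mGG ndG Gcvg hb.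
exists G; split => //; rewrite NG; apply: ge_sup => [|_ [j _ <-]//].
by exists (norm X (G_ 0%N)), 0%N.
Qed.

(** The Fatou property, applied to the infima of the tails, makes the norm lower
semicontinuous for convergence almost everywhere. *)
Lemma bfs_ae_limit (b_ : nat -> T -> R) (b : T -> R) (C : R) :
  (forall j, carrier X (b_ j)) -> measurable_fun setT b ->
  (\forall x \ae mu, b_ j x @[j --> \oo] --> b x) ->
  (forall j, norm X (b_ j) <= C) -> carrier X b /\ norm X b <= C.
Proof.
move=> Xb mb bcvg NC.
pose g_ j x := infs (fun i => `|b_ i x|) j.
have lb x : has_lbound (range (fun i => `|b_ i x|)) by exists 0 => _ [i _ <-].
have mg j : measurable_fun setT (g_ j).
  apply: measurable_fun_infs => [t _|n]; first exact: lb.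
  by apply: measurableT_comp => //; exact: (bfs_measurable HX (Xb n)).
have g0 j x : 0 <= g_ j x.
  rewrite /g_ /infs /sdrop /=; apply: lb_le_inf; last by move=> _ [i _ <-].
  by exists (`|b_ j x|), j => /=.
have gb j x : `|g_ j x| <= `|b_ j x|.
  rewrite ger0_norm// /g_ /infs /sdrop; apply: ge_inf; last by exists j => /=.
  by exists 0 => _ [i _ <-].
have gnd j x : g_ j x <= g_ j.+1 x.
  exact: (nondecreasing_infs (lb x) (leqnSn j)).
have Xg j : carrier X (g_ j) := bfs_dom (Xb j) (mg j) (gb j).
have Ng j : norm X (g_ j) <= C.
  by apply: le_trans (NC j); apply: bfs_norm_le => //; apply: aeW.
have mab : measurable_fun setT (fun x => `|b x|) by apply: measurableT_comp.
have [] := @bfs_Fatou _ _ _ mu X HX g_ (fun x => `|b x|) Xg mab.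
- by apply: aeW => x j; rewrite g0 gnd.
- by move: bcvg; apply: filterS => x /cvg_norm h; exact: cvg_infs.
- by exists C => _ [j _ <-].
move=> Xab Nab; have Xb' : carrier X b.
  by apply: (bfs_dom Xab) => // x; rewrite normr_id.
split => //; rewrite -bfs_norm_abs// Nab; apply: ge_sup => [|_ [j _ <-]//].
by exists (norm X (g_ 0%N)), 0%N.
Qed.

End bfs_theory.

(** * Bounded functions on a set of finite measure *)

Section bounded_on.
Context d (T : measurableType d) {R : realType}.
Variable mu : {measure set T -> \bar R}.
Variable Om : set T.
Hypothesis mOm : measurable Om.
Hypothesis Omfin : (mu Om < +oo)%E.
Implicit Types f g : T -> R.

(** All convex sets below consist of functions bounded by a multiple of the
indicator of one set of finite measure, so that every integral is finite. *)
Definition bounded_on f :=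
  measurable_fun setT f /\ exists N, forall x, `|f x| <= N * \1_Om x.

Lemma bounded_on_le f (N : R) : measurable_fun setT f ->
  (forall x, `|f x| <= N * \1_Om x) -> bounded_on f.
Proof. by move=> mf fN; split => //; exists N. Qed.

Lemma bounded_on_between f (N : R) : measurable_fun setT f ->
  (forall x, 0 <= f x <= N * \1_Om x) -> bounded_on f.
Proof.
move=> mf fN; apply: (bounded_on_le mf) => x.
by have /andP[f0 h] := fN x; rewrite ger0_norm//; exact: h.
Qed.

Lemma bounded_on_bound f : bounded_on f ->
  exists2 N, 0 <= N & forall x, `|f x| <= N * \1_Om x.
Proof.
move=> [_ [N fN]]; exists `|N| => // x; apply: le_trans (fN x) _.
by rewrite ler_wpM2r ?indic_ge0// ler_norm.
Qed.

Lemma bounded_onD f g : bounded_on f -> bounded_on g ->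
  bounded_on (fun x => f x + g x).
Proof.
move=> [mf [N fN]] [mg [M gM]]; apply: (@bounded_on_le _ (N + M)).
  exact: measurable_funD.
by move=> x; rewrite (le_trans (ler_normD _ _))// mulrDl lerD.
Qed.

Lemma bounded_onZ (a : R) f : bounded_on f -> bounded_on (fun x => a * f x).
Proof.
move=> [mf [N fN]]; apply: (@bounded_on_le _ (`|a| * N)).
  exact: measurable_funM.
by move=> x; rewrite normrM -mulrA ler_wpM2l.
Qed.

Lemma bounded_onB f g : bounded_on f -> bounded_on g ->
  bounded_on (fun x => f x - g x).
Proof.
move=> bf bg; have := bounded_onD bf (bounded_onZ (-1) bg).
by under eq_fun do rewrite mulN1r.
Qed.

Lemma bounded_onM f g : bounded_on f -> bounded_on g ->
  bounded_on (fun x => f x * g x).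
Proof.
move=> bf bg; have [N N0 fN] := bounded_on_bound bf.
have [M M0 gM] := bounded_on_bound bg.
apply: (@bounded_on_le _ (N * M)).
  by apply: measurable_funM; [exact: bf.1|exact: bg.1].
move=> x; rewrite normrM; apply: le_trans (ler_pM _ _ (fN x) (gM x)) _ => //.
by rewrite mulrACA ler_wpM2l ?mulr_ge0// indicE; case: (_ \in _); rewrite /= ?mulr1 ?mulr0.
Qed.

Lemma bounded_on_normr f : bounded_on f -> bounded_on (fun x => `|f x|).
Proof.
move=> [mf [N fN]]; apply: (@bounded_on_le _ N); last by move=> x; rewrite normr_id.
by apply: measurableT_comp.
Qed.

Lemma bounded_on_dom f g : measurable_fun setT g -> bounded_on f ->
  (forall x, `|g x| <= `|f x|) -> bounded_on g.
Proof.
move=> mg [mf [N fN]] gf; apply: (@bounded_on_le _ N) => // x.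
exact: le_trans (gf x) (fN x).
Qed.

Lemma bounded_on_indic : bounded_on \1_Om.
Proof.
apply: (@bounded_on_le _ 1) => [|x]; first exact: measurable_indic.
by rewrite mul1r ger0_norm ?indic_ge0.
Qed.

Lemma integrable_indic_fin : mu.-integrable setT (EFin \o \1_Om).
Proof.
apply/integrableP; split; first exact/measurable_EFinP/measurable_indic.
under eq_integral do rewrite /= ger0_norm ?indic_ge0//.
by rewrite integral_indic// setIT.
Qed.

Lemma bounded_on_integrable f : bounded_on f -> mu.-integrable setT (EFin \o f).
Proof.
move=> bf; have [N N0 fN] := bounded_on_bound bf.
have iN : mu.-integrable setT (EFin \o (fun x => N * \1_Om x)).
  rewrite (_ : EFin \o _ = (fun x => N%:E * (EFin \o \1_Om) x)%E)//.
  by apply: integrableZl => //; exact: integrable_indic_fin.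
apply: le_integrable iN => //; first exact/measurable_EFinP/bf.1.
move=> x _ /=; rewrite lee_fin (le_trans (fN x))//.
by rewrite ger0_norm// mulr_ge0// indic_ge0.
Qed.

Local Notation I := (fun f => \int[mu]_x f x).

Lemma bdd_intD f g : bounded_on f -> bounded_on g ->
  \int[mu]_x (f x + g x) = I f + I g.
Proof. by move=> bf bg; rewrite RintegralD//; exact: bounded_on_integrable. Qed.

Lemma bdd_intB f g : bounded_on f -> bounded_on g ->
  \int[mu]_x (f x - g x) = I f - I g.
Proof. by move=> bf bg; rewrite RintegralB//; exact: bounded_on_integrable. Qed.

Lemma bdd_intZ (a : R) f : bounded_on f -> \int[mu]_x (a * f x) = a * I f.
Proof. by move=> bf; rewrite RintegralZl//; exact: bounded_on_integrable. Qed.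

Lemma bdd_int_le f g : bounded_on f -> bounded_on g ->
  (forall x, f x <= g x) -> I f <= I g.
Proof. by move=> bf bg fg; rewrite le_Rintegral//; exact: bounded_on_integrable. Qed.

Lemma bdd_intE f : bounded_on f -> (I f)%:E = (\int[mu]_x (f x)%:E)%E.
Proof.
move=> bf; rewrite /Rintegral fineK//; apply: integrable_fin_num => //.
exact: bounded_on_integrable.
Qed.

Lemma bdd_cvg (f_ : nat -> T -> R) (f : T -> R) (N : R) :
  (forall i, measurable_fun setT (f_ i)) ->
  (forall i x, `|f_ i x| <= N * \1_Om x) -> bounded_on f ->
  (\forall x \ae mu, f_ i x @[i --> \oo] --> f x) ->
  I (f_ i) @[i --> \oo] --> I f.
Proof.
move=> mf fN bf ff.
have bN : bounded_on (fun x => N * \1_Om x) by exact/bounded_onZ/bounded_on_indic.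
have [] := @dominated_convergence _ _ _ mu setT measurableT
   (fun i => EFin \o f_ i) (EFin \o f) (EFin \o (fun x => N * \1_Om x)).
- by move=> i; exact/measurable_EFinP.
- exact/measurable_EFinP/bf.1.
- by move: ff; apply: filterS => x h _; apply: cvg_EFin => //; exact: nearW.
- exact: bounded_on_integrable.
- by apply: aeW => x i _ /=; rewrite lee_fin.
move=> _ _; rewrite /= -bdd_intE// => /fine_cvgP[_].
by apply: cvg_trans; apply: near_eq_cvg; apply: nearW => i /=.
Qed.

End bounded_on.

(** * Elements of least norm in convex sets *)

Section least_norm.
Context d (T : measurableType d) {R : realType}.
Variable mu : {measure set T -> \bar R}.
Variable Om : set T.
Hypothesis mOm : measurable Om.
Hypothesis Omfin : (mu Om < +oo)%E.
Implicit Types f g z : T -> R.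
Local Notation I := (fun f => \int[mu]_x f x).

(** The sum of the absolute increments has a finite integral, so it is finite
almost everywhere, and there the sequence is Cauchy.  Setting the sequence to zero
elsewhere makes the limit exist, and be measurable, everywhere. *)
Lemma summable_increments_ae_cvg (z_ : nat -> T -> R) (c K : R) :
  (forall i, measurable_fun setT (z_ i)) ->
  (forall i x, 0 <= z_ i x <= c * \1_Om x) ->
  (forall i, I (fun x => `|z_ i.+1 x - z_ i x|) <= K * 2^-1 ^+ i) ->
  exists v : T -> R, [/\ measurable_fun setT v,
    (forall x, 0 <= v x <= c * \1_Om x) &
    (\forall x \ae mu, z_ i x @[i --> \oo] --> v x)].
Proof.
move=> mz zc zK.
pose w (i : nat) (x : T) : R := `|z_ i.+1 x - z_ i x|.
have bz i : bounded_on Om (z_ i) by exact: (bounded_on_between (mz i) (zc i)).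
have bw i : bounded_on Om (w i) by exact: (bounded_on_normr (bounded_onB (bz _) (bz _))).
have w0 i x : 0 <= w i x by exact: normr_ge0.
pose S x : \bar R := (\sum_(i <oo) (w i x)%:E)%E.
have mS : measurable_fun setT S.
  apply: ge0_emeasurable_sum => i; [by move=> x _ _; rewrite lee_fin w0|].
  by move=> _; exact/measurable_EFinP/(bw i).1.
have S0 x : (0 <= S x)%E by apply: nneseries_ge0 => i _ _; rewrite lee_fin w0.
have SK : (\int[mu]_x S x < +oo)%E.
  rewrite integral_nneseries//; [|by move=> i; exact/measurable_EFinP/(bw i).1|by move=> i x _; rewrite lee_fin w0].
  have K0 : 0 <= K by have := zK 0%N; rewrite expr0 mulr1; apply: le_trans; exact: Rintegral_ge0.
  apply: (@le_lt_trans _ _ (\sum_(i <oo) (K * 2^-1 ^+ i)%:E)%E).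
    apply: lee_nneseries => [i _ _|i _].
      by apply: integral_ge0 => x _; rewrite lee_fin w0.
    by rewrite -(bdd_intE mOm Omfin)// lee_fin; exact: zK.
  have /cvg_lim h : (fun n => \sum_(0 <= i < n) (K * 2^-1 ^+ i)%:E)%E @ \oo --> (K / (1 - 2^-1))%:E.
    rewrite (_ : (fun n => _) = EFin \o series (geometric K 2^-1)).
      apply: cvg_EFin; first exact: nearW.
      by apply: cvg_geometric_series; rewrite ger0_norm; lra.
    by apply/funext => n; rewrite sumEFin.
  by rewrite h// ltry.
have iS : mu.-integrable setT S.
  apply/integrableP; split => //; under eq_integral do rewrite gee0_abs//.
  exact: SK.
have Sfin := integrable_ae measurableT iS.
pose A := [set x | S x \is a fin_num].
have mA : measurable A by rewrite -[A]setTI; apply: emeasurable_fin_num.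
pose y (i : nat) (x : T) : R := z_ i x * \1_A x.
have ycvg x : cvg (y i x @[i --> \oo]).
  have [Ax|nAx] := pselect (A x); last first.
    apply/cvg_ex; exists 0; rewrite (_ : (fun i => _) = fun=> 0); first exact: cvg_cst.
    by apply/funext => i; rewrite /y indicE memNset// mulr0.
  have -> : (fun i => y i x) = (fun i => z_ i x).
    by apply/funext => i; rewrite /y indicE mem_set// mulr1.
  rewrite (_ : (fun i => _) = (fun i => z_ 0%N x + series (fun i => z_ i.+1 x - z_ i x) i)); last first.
    by apply/funext => i; rewrite /series/= telescope_sumr// addrC subrK.
  apply: is_cvgD; first exact: is_cvg_cst.
  apply: normed_cvg; apply: nondecreasing_is_cvgn.
    apply/nondecreasing_seqP => i.
    by change (series (w ^~ x) i <= series (w ^~ x) i.+1); rewrite seriesSr lerDl w0.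
  exists (fine (S x)) => _ [i _ <-]; rewrite -lee_fin fineK// /S /series/= -sumEFin.
  by apply: nneseries_lim_ge => k _ _; rewrite lee_fin w0.
pose v x := limn (fun i => y i x).
exists v; split.
- apply: (@measurable_fun_cvg _ _ _ _ y) => [i|x _]; last exact: ycvg.
  by apply: measurable_funM => //; exact: measurable_indic.
- move=> x; apply/andP; split.
    apply: limr_ge => //; apply: nearW => i.
    by rewrite mulr_ge0 ?indic_ge0//; have /andP[] := zc i x.
  apply: limr_le => //; apply: nearW => i.
  have /andP[z0 zc'] := zc i x; apply: le_trans zc'.
  by rewrite /y indicE; case: (_ \in _); rewrite /= ?mulr1 ?mulr0.
- move: Sfin; apply: filterS => x /(_ Logic.I) Sx.
  have := ycvg x; rewrite -/(v x).
  by rewrite (_ : (fun i => y i x) = (fun i => z_ i x))//; apply/funext => i;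
    rewrite /y indicE mem_set// mulr1.
Qed.

(** A minimizing sequence is Cauchy in L2 by the parallelogram identity, fast
enough to converge almost everywhere.  Truncation inside [C] keeps it between 0 and
[c], so dominated convergence carries the variational inequality to the limit [v],
which need not belong to [C]. *)
Lemma least_norm_variational (C : set (T -> R)) (c : R) :
  (forall z, C z -> bounded_on Om z) -> C !=set0 ->
  (forall z w (t : R), C z -> C w -> 0 <= t <= 1 ->
     C (fun x => (1 - t) * z x + t * w x)) ->
  (forall z, C z -> exists w, C w /\
     forall x, 0 <= w x <= c * \1_Om x /\ `|w x| <= `|z x|) ->
  exists (z_ : nat -> T -> R) (v : T -> R),
   [/\ (forall i, C (z_ i) /\ forall x, 0 <= z_ i x),
     measurable_fun setT v /\ (forall x, 0 <= v x <= c * \1_Om x),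
     (\forall x \ae mu, z_ i x @[i --> \oo] --> v x),
     I (fun x => z_ i x ^+ 2) @[i --> \oo] --> I (fun x => v x ^+ 2) &
     forall z, C z -> I (fun x => v x ^+ 2) <= I (fun x => v x * z x)].
Proof.
move=> bC [z0 Cz0] cvxC trC.
pose E := [set I (fun x => z x ^+ 2) | z in C].
have bsq z : bounded_on Om z -> bounded_on Om (fun x => z x ^+ 2).
  by move=> bz; under eq_fun do rewrite expr2; exact: bounded_onM.
have E0 : E !=set0 by exists (I (fun x => z0 x ^+ 2)), z0.
have Elb : has_lbound E.
  by exists 0 => _ [z Cz <-]; apply: Rintegral_ge0 => x _; exact: sqr_ge0.
pose D := inf E.
have D_le z : C z -> D <= I (fun x => z x ^+ 2).
  by move=> Cz; apply: ge_inf => //; exists z.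
have e0 i : 0 < 4^-1 ^+ i :> R by rewrite exprn_gt0// invr_gt0.
have /choice[z_ hz] : forall i, exists z, [/\ C z,
    (forall x, 0 <= z x <= c * \1_Om x) & I (fun x => z x ^+ 2) < D + 4^-1 ^+ i].
  move=> i; have [_ [z Cz <-] zi] := @inf_adherent _ E _ (e0 i) (conj E0 Elb).
  have [w [Cw wz]] := trC z Cz; exists w; split => //; first by move=> x; have [] := wz x.
  apply: le_lt_trans zi; apply: (bdd_int_le mOm Omfin); [exact/bsq/bC|exact/bsq/bC|].
  move=> x; have [_ h] := wz x.
  by rewrite -(real_normK (num_real (w x))) -(real_normK (num_real (z x))) lerXn2r ?nnegrE.
have Cz i : C (z_ i) by have [] := hz i.
have zc i x : 0 <= z_ i x <= c * \1_Om x by have [_ h _] := hz i.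
have zD i : I (fun x => z_ i x ^+ 2) < D + 4^-1 ^+ i by have [] := hz i.
have bz i : bounded_on Om (z_ i) by exact: bC.
(* The parallelogram identity, with the midpoint [m] in [C]. *)
have sq_incr i : I (fun x => (z_ i.+1 x - z_ i x) ^+ 2) <= 4 * 4^-1 ^+ i.
  pose m (x : T) : R := (1 - 2^-1) * z_ i.+1 x + 2^-1 * z_ i x.
  have Cm : C m by apply: cvxC => //; lra.
  have bm := bC _ Cm.
  have -> : (fun x => (z_ i.+1 x - z_ i x) ^+ 2) =
      (fun x => 2 * z_ i.+1 x ^+ 2 + 2 * z_ i x ^+ 2 - 4 * m x ^+ 2).
    by apply/funext => x; rewrite /m; field.
  rewrite (bdd_intB mOm Omfin)//; [|by apply: bounded_onD; exact/bounded_onZ/bsq|by exact/bounded_onZ/bsq].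
  rewrite (bdd_intD mOm Omfin)//; [|by exact/bounded_onZ/bsq|by exact/bounded_onZ/bsq].
  rewrite !(bdd_intZ mOm Omfin); [|exact: bsq..].
  have := zD i.+1; have := zD i; have := D_le _ Cm; have := e0 i; rewrite exprS.
  lra.
pose K := fine (mu Om) + 4.
(* [2 * w <= a + a^-1 * w ^ 2] turns the L2 bound of order [4 ^- i] into an L1 bound
   of order [2 ^- i]. *)
have zK i : I (fun x => `|z_ i.+1 x - z_ i x|) <= K * 2^-1 ^+ i.
  pose a : R := 2^-1 ^+ i; have a0 : 0 < a by rewrite exprn_gt0// invr_gt0.
  have bw : bounded_on Om (fun x => z_ i.+1 x - z_ i x) by exact: bounded_onB.
  apply: (@le_trans _ _ (I (fun x => a * \1_Om x + a^-1 * (z_ i.+1 x - z_ i x) ^+ 2))).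
    apply: (bdd_int_le mOm Omfin); first exact: bounded_on_normr.
      by apply: bounded_onD; [exact/bounded_onZ/bounded_on_indic|exact/bounded_onZ/bsq].
    move=> x; set w := _ - _.
    have w1 : `|w| = `|w| * \1_Om x.
      have [Ox|nOx] := pselect (Om x); first by rewrite indicE mem_set//= mulr1.
      have [N wN] := bw.2; have := wN x; rewrite -/w indicE memNset//= !mulr0.
      by move=> h; apply/eqP; rewrite eq_le h/=.
    rewrite w1; have -> : w ^+ 2 = `|w| ^+ 2 by rewrite real_normK ?num_real.
    have : 0 <= a * (1 - a^-1 * `|w|) ^+ 2 by rewrite mulr_ge0 ?sqr_ge0// ltW.
    have -> : a * (1 - a^-1 * `|w|) ^+ 2 = a - 2 * `|w| + a^-1 * `|w| ^+ 2.
      by field; rewrite gt_eqF.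
    have aw : 0 <= a^-1 * `|w| ^+ 2 by rewrite mulr_ge0 ?sqr_ge0// invr_ge0 ltW.
    have := normr_ge0 w.
    rewrite indicE; case: (_ \in _) => /=; rewrite ?mulr1 ?mulr0; lra.
  rewrite (bdd_intD mOm Omfin)//; [|by exact/bounded_onZ/bounded_on_indic|by exact/bounded_onZ/bsq].
  rewrite !(bdd_intZ mOm Omfin); [|exact: bsq|exact: bounded_on_indic].
  have -> : I (\1_Om) = fine (mu Om) by rewrite /Rintegral integral_indic// setIT.
  rewrite /K mulrDl mulrC lerD2l.
  have -> : 4 * 2^-1 ^+ i = a^-1 * (4 * 4^-1 ^+ i).
    have -> : 4^-1 ^+ i = a * a :> R.
      by rewrite -exprMn; congr (_ ^+ _); field.
    by rewrite -/a; field; rewrite gt_eqF.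
  by rewrite ler_wpM2l ?sq_incr// invr_ge0 ltW.
have [v [mv vc zv]] := summable_increments_ae_cvg (fun i => (bz i).1) zc zK.
have c0 x : 0 <= c * \1_Om x by have /andP[h1 h2] := vc x; exact: le_trans h2.
have bv : bounded_on Om v by exact: bounded_on_between vc.
have zNc i x : `|z_ i x| <= c * \1_Om x.
  by have /andP[? ?] := zc i x; rewrite ger0_norm.
have sqc i x : `|z_ i x ^+ 2| <= c ^+ 2 * \1_Om x.
  rewrite normrX; have -> : c ^+ 2 * \1_Om x = (c * \1_Om x) ^+ 2.
    by rewrite exprMn; congr (_ * _); rewrite indicE; case: (_ \in _); rewrite /= ?expr1n ?expr0n.
  by rewrite lerXn2r ?nnegrE.
have cvg_sq : I (fun x => z_ i x ^+ 2) @[i --> \oo] --> I (fun x => v x ^+ 2).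
  apply: (bdd_cvg mOm Omfin _ sqc).
  - by move=> i; exact: (bsq _ (bz i)).1.
  - exact: bsq.
  - move: zv; apply: filterS => x h; rewrite expr2.
    under eq_fun do rewrite expr2; exact: cvgM.
have IvD : I (fun x => v x ^+ 2) = D.
  apply: (cvg_unique _ cvg_sq) => //.
  apply: (@squeeze_cvgr _ _ _ _ (fun=> D) (fun i => D + 4^-1 ^+ i)).
  - by apply: nearW => i; rewrite D_le// ltW.
  - exact: cvg_cst.
  - rewrite -[X in _ --> X]addr0; apply: cvgD; first exact: cvg_cst.
    by apply: cvg_expr; rewrite ger0_norm; lra.
exists z_, v; split => //.
  by move=> i; split => // x; have /andP[] := zc i x.
move=> z Cz'; have bz' := bC _ Cz'.
have cvg_cross : I (fun x => z_ i x * z x) @[i --> \oo] --> I (fun x => v x * z x).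
  have [N N0 zN] := bounded_on_bound bz'.
  apply: (@bdd_cvg _ _ _ mu _ mOm Omfin _ _ (c * N)).
  - by move=> i; exact: (bounded_onM (bz i) bz').1.
  - move=> i x; rewrite normrM; apply: le_trans (ler_pM _ _ (zNc i x) (zN x)) _ => //.
    rewrite mulrACA; rewrite indicE; case: (_ \in _); rewrite /= ?mulr1 ?mulr0//.
  - exact: bounded_onM.
  - move: zv; apply: filterS => x h; apply: cvgM => //; exact: cvg_cst.
(* Minimality along the segment from [v] to [z], through the approximations of [v]. *)
pose J := I (fun x => z x ^+ 2).
have var (t : R) : 0 <= t <= 1 ->
    D <= (1 - t) ^+ 2 * D + 2 * t * (1 - t) * I (fun x => v x * z x) + t ^+ 2 * J.
  move=> t01.
  pose u i := (1 - t) ^+ 2 * I (fun x => z_ i x ^+ 2)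
     + 2 * t * (1 - t) * I (fun x => z_ i x * z x) + t ^+ 2 * J.
  have cu : u @ \oo --> (1 - t) ^+ 2 * D + 2 * t * (1 - t) * I (fun x => v x * z x) + t ^+ 2 * J.
    rewrite -IvD; apply: cvgD; last exact: cvg_cst.
    by apply: cvgD; apply: cvgMr.
  rewrite -(cvg_lim _ cu)//; apply: limr_ge; first by apply/cvg_ex; eexists; exact: cu.
  apply: nearW => i.
  have bzz : bounded_on Om (fun x => z_ i x * z x) by exact: bounded_onM.
  have Cm := cvxC _ _ _ (Cz i) Cz' t01.
  apply: le_trans (D_le _ Cm) _.
  have -> : (fun x => ((1 - t) * z_ i x + t * z x) ^+ 2) = (fun x =>
     ((1 - t) ^+ 2 * z_ i x ^+ 2 + 2 * t * (1 - t) * (z_ i x * z x)) + t ^+ 2 * z x ^+ 2).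
    by apply/funext => x; ring.
  rewrite (bdd_intD mOm Omfin); [|by apply: bounded_onD; apply: bounded_onZ => //; exact: bsq|exact/bounded_onZ/bsq].
  rewrite (bdd_intD mOm Omfin); [|exact/bounded_onZ/bsq|exact: bounded_onZ].
  by rewrite !(bdd_intZ mOm Omfin)//; exact: bsq.
rewrite IvD leNgt; apply/negP => lt_D.
pose e := D - I (fun x => v x * z x).
have e_gt0 : 0 < e by rewrite subr_gt0.
pose M := `|J - D| + 1.
have M0 : 0 < M by rewrite ltr_wpDl.
pose t := Num.min 2^-1 (e / (2 * M)).
have t0 : 0 < t by rewrite lt_min invr_gt0 ltr0n/= divr_gt0// mulr_gt0.
have t2 : t <= 2^-1 by rewrite ge_min lexx.
have tM : t * M <= e / 2.
  apply: (@le_trans _ _ (e / (2 * M) * M)); last by rewrite invfM mulrA divfK ?gt_eqF.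
  by rewrite ler_wpM2r ?(ltW M0)// ge_min lexx orbT.
have := var t; rewrite (_ : 0 <= t <= 1); last lra.
move=> /(_ isT); have -> : I (fun x => v x * z x) = D - e by rewrite /e; ring.
have -> : (1 - t) ^+ 2 * D + 2 * t * (1 - t) * (D - e) + t ^+ 2 * J =
  D + t * (t * (J - D) - 2 * (1 - t) * e) by ring.
rewrite lerDl pmulr_rge0// subr_ge0.
have : t * (J - D) <= t * M by rewrite ler_wpM2l ?(ltW t0)// /M; have := ler_norm (J - D); lra.
nra.
Qed.

End least_norm.

(** * Separation from the unit ball *)

Section separation.
Context d (T : measurableType d) {R : realType}.
Variable mu : {measure set T -> \bar R}.
Variable X : function_space T R.
Hypothesis HX : is_Banach_function_space mu X.
Variable Om : set T.
Hypothesis mOm : measurable Om.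
Hypothesis Omfin : (mu Om < +oo)%E.
Implicit Types f g k b : T -> R.
Local Notation I := (fun f => \int[mu]_x f x).

(** Only truncations of an unbounded [b] are available for comparison; monotone
convergence recovers the pairing with [b] itself. *)
Lemma integral_truncation_le (v b : T -> R) (S : R) :
  bounded_on Om v -> (forall x, 0 <= v x) -> measurable_fun setT b ->
  (forall N : nat, I (fun x => v x * (Num.min `|b x| N%:R * \1_Om x)) <= S) ->
  (\int[mu]_x (v x * `|b x|)%:E <= S%:E)%E.
Proof.
move=> bv v0 mb hS.
have mab : measurable_fun setT (fun x => `|b x|) by apply: measurableT_comp.
pose t_ (N : nat) (x : T) : R := Num.min `|b x| N%:R * \1_Om x.
have t0 N x : 0 <= t_ N x by rewrite mulr_ge0 ?indic_ge0// le_min normr_ge0/=.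
have bt N : bounded_on Om (t_ N).
  apply: (@bounded_on_le _ _ _ _ _ N%:R) => [|x].
    by apply: measurable_funM; [exact: measurable_minr|exact: measurable_indic].
  by rewrite ger0_norm// ler_wpM2r ?indic_ge0// ge_min lexx orbT.
have bvt N : bounded_on Om (fun x => v x * t_ N x) by exact: bounded_onM.
have mg N : measurable_fun setT (fun x => (v x * t_ N x)%:E).
  by exact/measurable_EFinP/(bvt N).1.
have g0 N x : setT x -> (0 <= (v x * t_ N x)%:E)%E by rewrite lee_fin mulr_ge0.
have ndg x : setT x -> {homo (fun N => (v x * t_ N x)%:E) : m n / (m <= n)%N >-> (m <= n)%E}.
  move=> _ m n mn; rewrite lee_fin ler_wpM2l// ler_wpM2r ?indic_ge0//.
  by rewrite le_min !ge_min lexx/= ler_nat mn orbT.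
have lim_v x : (v x * `|b x|)%:E = limn (fun N => (v x * t_ N x)%:E).
  apply/esym/cvg_lim => //; apply: cvg_EFin; first exact: nearW.
  apply: cvg_near_cst; near=> N.
  rewrite /t_/= min_l; last by near: N; exact: nbhs_infty_ger.
  have [Ox|nOx] := pselect (Om x); first by rewrite indicE mem_set// mulr1.
  have [M vM] := bv.2; have := vM x; rewrite indicE memNset//= !mulr0 normr_le0.
  by move=> /eqP ->; rewrite mul0r.
under eq_integral do rewrite lim_v.
rewrite (monotone_convergence _ _ mg)//.
apply: lime_le.
  apply: ereal_nondecreasing_is_cvgn => m n mn; apply: ge0_le_integral => //.
  - by move=> x _; exact: g0.
  - by move=> x _; exact: ndg.
by apply: nearW => N; rewrite -(bdd_intE mOm Omfin)// lee_fin; exact: hS.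
Unshelve. all: by end_near. Qed.

(** The element [v] of least norm in the L2-closure of the difference of [K] and
the unit ball of [X] decides the alternative: if it vanishes, the two sets approach
each other; otherwise a multiple of it separates them, and being bounded by one on
the unit ball puts this multiple in the unit ball of the associate space. *)
Lemma convex_separation (K : set (T -> R)) (c : R) :
  (forall k, K k -> measurable_fun setT k /\ forall x, 0 <= k x <= c * \1_Om x) ->
  K !=set0 ->
  (forall k l (t : R), K k -> K l -> 0 <= t <= 1 ->
     K (fun x => (1 - t) * k x + t * l x)) ->
  (exists g, [/\ bounded_on Om g, forall x, 0 <= g x,
     (associate_enorm mu X g <= 1)%E & forall k, K k -> 1 <= I (fun x => g x * k x)])
  \/
  (exists k_ b_ : nat -> T -> R,
     [/\ forall i, K (k_ i), forall i, carrier X (b_ i) /\ norm X (b_ i) <= 1,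
      forall i x, 0 <= b_ i x <= k_ i x,
      \forall x \ae mu, k_ i x - b_ i x @[i --> \oo] --> (0 : R) &
      I (fun x => (k_ i x - b_ i x) ^+ 2) @[i --> \oo] --> (0 : R)]).
Proof.
move=> Kb [k0 Kk0] Kcvx.
have bK k : K k -> bounded_on Om k.
  by move=> /Kb[mk kc]; exact: bounded_on_between kc.
pose B := [set b | [/\ carrier X b, bounded_on Om b, forall x, 0 <= b x & norm X b <= 1]].
pose C := [set z | exists k b, [/\ K k, B b & z = fun x => k x - b x]].
have B0 : B (cst 0).
  split => //; [exact: (bfs_zero HX)| |by rewrite (bfs_norm0 HX)].
  by apply: (@bounded_on_le _ _ _ _ _ 0) => // x; rewrite normr0 mul0r.
have [] := @least_norm_variational _ T R mu Om mOm Omfin C c.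
- by move=> _ [k [b [Kk [_ bb _ _] ->]]]; apply: bounded_onB => //; exact: bK.
- by exists (fun x => k0 x - cst 0 x), k0, (cst 0).
- move=> _ _ t [k [b [Kk [Xb bb b0 Nb] ->]]] [l [a [Kl [Xa ba a0 Na] ->]]] t01.
  exists (fun x => (1 - t) * k x + t * l x), (fun x => (1 - t) * b x + t * a x).
  have Xtb := bfs_scale HX (1 - t) Xb; have Xta := bfs_scale HX t Xa.
  split; [exact: Kcvx| |by apply/funext => x; ring].
  split; [exact: (bfs_add HX Xtb Xta)| | |].
  + by apply: bounded_onD; exact: bounded_onZ.
  + by move=> x; rewrite addr_ge0// mulr_ge0//; lra.
  + apply: le_trans (bfs_normD HX Xtb Xta) _.
    rewrite !(bfs_normZ HX)// !ger0_norm; [|lra..].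
    have : (1 - t) * norm X b <= 1 - t by rewrite ler_piMr//; lra.
    have : t * norm X a <= t by rewrite ler_piMr//; lra.
    lra.
- move=> _ [k [b [Kk [Xb bb b0 Nb] ->]]]; have [mk kc] := Kb k Kk.
  pose a x : R := Num.min (b x) (k x).
  have a0 x : 0 <= a x by rewrite le_min b0; have /andP[] := kc x.
  have ma : measurable_fun setT a by apply: measurable_minr => //; exact: bb.1.
  have ab x : `|a x| <= `|b x| by rewrite !ger0_norm// ge_min lexx.
  exists (fun x => k x - a x); split.
    exists k, a; split => //; split => //.
    - exact: (bfs_dom HX Xb).
    - exact: bounded_on_dom bb ab.
    - apply: le_trans Nb; apply: (bfs_norm_le HX) => //; exact: aeW.
  move=> x; have /andP[kx0 kxc] := kc x; have ak : a x <= k x by rewrite ge_min lexx orbT.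
  split; first by rewrite subr_ge0 ak/=; apply: le_trans kxc; rewrite gerBl.
  rewrite ger0_norm ?subr_ge0// /a; case: (leP (b x) (k x)) => bk.
    by rewrite ler_norm.
  by rewrite subrr.
move=> z_ [v [hz [mv vc] zv Iz var]].
have v0 x : 0 <= v x by have /andP[] := vc x.
have bv : bounded_on Om v by exact: bounded_on_between vc.
set e := I (fun x => v x ^+ 2) in Iz var *.
have e0 : 0 <= e by apply: Rintegral_ge0 => x _; exact: sqr_ge0.
have [e_eq0|e_neq0] := eqVneq e 0.
  right; have [kb hkb] := choice (fun i => (hz i).1).
  have [b_ hb] := choice hkb; exists kb, b_.
  have zE i : z_ i = fun x => kb i x - b_ i x by have [] := hb i.
  split.
  - by move=> i; have [] := hb i.
  - by move=> i; have [_ [? _ _ ?]] := hb i.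
  - move=> i x; have [_ [_ _ b0 _] _] := hb i; rewrite b0/=.
    by have := (hz i).2 x; rewrite zE subr_ge0.
  - have vE : \forall x \ae mu, v x = 0.
      have mv2 : measurable_fun setT (fun x => (v x ^+ 2)%:E).
        by apply/measurable_EFinP; apply: measurable_funX.
      have := (ae_eq_integral_abs mu measurableT mv2).1.
      case.
        under eq_integral do rewrite gee0_abs ?lee_fin ?sqr_ge0//.
        rewrite -(bdd_intE mOm Omfin) -/e ?e_eq0//.
        by under eq_fun do rewrite expr2; exact: bounded_onM.
      move=> N [mN N0 sN]; exists N; split => // x /= vx; apply: sN => /= /(_ Logic.I).
      by move=> [] /eqP; rewrite sqrf_eq0 => /eqP.
    by apply: filterS2 vE zv => x -> ; under eq_fun do rewrite zE.
  - rewrite -e_eq0; move: Iz; apply: cvg_trans; apply: near_eq_cvg.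
    by apply: nearW => i; rewrite zE.
have e_gt0 : 0 < e by rewrite lt_neqAle eq_sym e_neq0.
left.
pose E := [set I (fun x => v x * b x) | b in B].
have key k b : K k -> B b -> I (fun x => v x * b x) + e <= I (fun x => v x * k x).
  move=> Kk Bb; have [_ bb _ _] := Bb.
  have := var (fun x => k x - b x) (ex_intro _ k (ex_intro _ b (And3 Kk Bb erefl))).
  have -> : (fun x => v x * (k x - b x)) = (fun x => v x * k x - v x * b x).
    by apply/funext => x; rewrite mulrBr.
  rewrite (bdd_intB mOm Omfin); [lra|by apply: bounded_onM => //; exact: bK|exact: bounded_onM].
have Eub : has_ubound E.
  by exists (I (fun x => v x * k0 x)) => _ [b Bb <-]; have := key _ _ Kk0 Bb; lra.
pose S := sup E.
have S_ge b : B b -> I (fun x => v x * b x) <= S.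
  by move=> Bb; apply: ub_le_sup => //; exists b.
have S0 : 0 <= S by apply: le_trans (S_ge _ B0); apply: Rintegral_ge0 => x _; rewrite mulr0.
have S_key k : K k -> S + e <= I (fun x => v x * k x).
  move=> Kk; rewrite -lerBrDr; apply: ge_sup.
    by exists (I (fun x => v x * cst 0 x)), (cst 0).
  by move=> _ [b Bb <-]; have := key _ _ Kk Bb; lra.
have Se : 0 < S + e by rewrite ltr_wpDl.
exists (fun x => (S + e)^-1 * v x); split.
- exact: bounded_onZ.
- by move=> x; rewrite mulr_ge0// invr_ge0 ltW.
- apply: ge_ereal_sup => _ [b [Xb Nb] <-].
  have mb := bfs_measurable HX Xb.
  have -> : (\int[mu]_x `|(S + e)^-1 * v x * b x|%:E)%E =
     ((S + e)^-1%:E * \int[mu]_x (v x * `|b x|)%:E)%E.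
    rewrite -ge0_integralZl//.
    + apply: eq_integral => x _; rewrite -EFinM !normrM (ger0_norm (v0 x)) gtr0_norm ?invr_gt0//.
      by rewrite mulrA.
    + by apply/measurable_EFinP/measurable_funM => //; apply: measurableT_comp.
    + by move=> x _; rewrite lee_fin mulr_ge0.
    + by rewrite lee_fin invr_ge0 ltW.
  have : (\int[mu]_x (v x * `|b x|)%:E <= S%:E)%E.
    apply: integral_truncation_le => // N; apply: S_ge.
    have mt : measurable_fun setT (fun x => Num.min `|b x| N%:R * \1_Om x).
      apply: measurable_funM; last exact: measurable_indic.
      by apply: measurable_minr => //; apply: measurableT_comp.
    have t0 x : 0 <= Num.min `|b x| N%:R * \1_Om x.
      by rewrite mulr_ge0 ?indic_ge0// le_min normr_ge0/=.
    have tb x : `|Num.min `|b x| N%:R * \1_Om x| <= `|b x|.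
      rewrite ger0_norm// indicE; case: (_ \in _); rewrite /= ?mulr1 ?mulr0//.
      by rewrite ge_min lexx.
    split => //.
    - exact: (bfs_dom HX Xb).
    - apply: (@bounded_on_le _ _ _ _ _ N%:R) => // x; rewrite ger0_norm//.
      by rewrite ler_wpM2r ?indic_ge0// ge_min lexx orbT.
    - by apply: le_trans Nb; apply: (bfs_norm_le HX) => //; exact: aeW.
  move=> hS; apply: (@le_trans _ _ ((S + e)^-1%:E * S%:E)%E).
    by rewrite lee_wpmul2l// lee_fin invr_ge0 ltW.
  by rewrite -EFinM lee_fin mulrC ler_pdivrMr// mul1r lerDl.
- move=> k Kk; have -> : (fun x => (S + e)^-1 * v x * k x) = (fun x => (S + e)^-1 * (v x * k x)).
    by apply/funext => x; rewrite mulrA.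
  rewrite (bdd_intZ mOm Omfin); last by apply: bounded_onM => //; exact: bK.
  by rewrite mulrC ler_pdivlMr// mul1r S_key.
Qed.

(** Lorentz-Luxemburg duality for bounded functions: the unit ball of [X] is closed
under limits almost everywhere, so a function outside it is separated from it. *)
Lemma associate_norming k (c t : R) : carrier X k ->
  (forall x, 0 <= k x <= c * \1_Om x) -> 0 < t -> t < norm X k ->
  exists g, [/\ bounded_on Om g, forall x, 0 <= g x,
     (associate_enorm mu X g <= 1)%E & t <= I (fun x => g x * k x)].
Proof.
move=> Xk kc t0 tk.
pose k' x : R := t^-1 * k x.
have Xk' : carrier X k' by exact: (bfs_scale HX).
have mk' := bfs_measurable HX Xk'.
have bk : bounded_on Om k by exact: (bounded_on_between (bfs_measurable HX Xk) kc).
have [] := @convex_separation [set k'] (t^-1 * c).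
- move=> _ ->; split => // x; have /andP[kx0 kxc] := kc x.
  by rewrite mulr_ge0/= ?invr_ge0 ?(ltW t0)// -mulrA ler_wpM2l// invr_ge0 ltW.
- by exists k'.
- by move=> _ _ s -> -> _; apply/funext => x; ring.
- move=> [g [bg g0 g1 /(_ k' erefl) hk]]; exists g; split => //.
  move: hk; have -> : (fun x => g x * k' x) = (fun x => t^-1 * (g x * k x)).
    by apply/funext => x; rewrite /k'; ring.
  rewrite (bdd_intZ mOm Omfin); last exact: bounded_onM.
  by rewrite mulrC ler_pdivlMr// mul1r.
move=> [k_ [b_ [Kk hb bk' cvgb _]]]; exfalso.
have [] := @bfs_ae_limit _ _ _ _ _ HX b_ k' 1 _ mk'.
- by move=> i; have [] := hb i.
- move: cvgb; apply: filterS => x h.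
  have : k' x - (k_ i x - b_ i x) @[i --> \oo] --> k' x - 0.
    by apply: cvgB => //; exact: cvg_cst.
  rewrite subr0; apply: cvg_trans; apply: near_eq_cvg; apply: nearW => i /=.
  by rewrite (Kk i) opprB addrC subrK.
- by move=> i; have [] := hb i.
move=> _; rewrite /k' (bfs_normZ HX)// gtr0_norm ?invr_gt0// mulrC ler_pdivrMr// mul1r.
by rewrite leNgt tk.
Qed.

End separation.

(** * The associate space *)

Section power_sums.
Context {R : realType}.
Implicit Types x y s : R.

Lemma powR_superadd s x y : 1 <= s -> 0 <= x -> 0 <= y ->
  x `^ s + y `^ s <= (x + y) `^ s.
Proof.
move=> s1 x0 y0; have s0 : 0 < s by lra.
rewrite -(mulr_powRB1 x0 s0) -(mulr_powRB1 y0 s0) -(mulr_powRB1 (addr_ge0 x0 y0) s0).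
have s10 : 0 <= s - 1 by lra.
by rewrite mulrDl lerD// ler_wpM2l// ge0_ler_powR ?nnegrE ?lerDl ?lerDr ?(addr_ge0 x0 y0)//.
Qed.

Lemma powR_root_sum_le s x y : 1 <= s -> 0 <= x -> 0 <= y ->
  (x `^ s + y `^ s) `^ s^-1 <= x + y.
Proof.
move=> s1 x0 y0; have s0 : 0 < s by lra.
have xy : 0 <= x + y by rewrite addr_ge0.
rewrite -[leRHS]powRr1// -(@mulfV _ s) ?gt_eqF// powRrM.
rewrite ge0_ler_powR ?nnegrE ?invr_ge0 ?addr_ge0 ?powR_ge0//; first exact: ltW.
exact: powR_superadd.
Qed.

End power_sums.

Section associate_theory.
Context d (T : measurableType d) {R : realType}.
Variable mu : {sigma_finite_measure set T -> \bar R}.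
Variable X : function_space T R.
Hypothesis HX : is_Banach_function_space mu X.
Implicit Types f g : T -> R.
Local Notation X' := (associate mu X).

Lemma ae_fatou (f_ : nat -> T -> \bar R) (f : T -> \bar R) (S : \bar R) :
  (forall j, measurable_fun setT (f_ j)) -> measurable_fun setT f ->
  (forall j x, 0 <= f_ j x)%E -> (forall x, 0 <= f x)%E ->
  (\forall x \ae mu, f_ j x @[j --> \oo] --> f x) ->
  (forall j, \int[mu]_x f_ j x <= S)%E -> (\int[mu]_x f x <= S)%E.
Proof.
move=> mf_ mf f_0 f0 ff fS.
have lim0 x : (0 <= limn_einf (f_ ^~ x))%E.
  rewrite limn_einf_lim; apply: lime_ge; first exact: is_cvg_einfs.
  by apply: nearW => j; apply: le_ereal_inf_tmp => _ [i _ <-].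
apply: (@le_trans _ _ (\int[mu]_x limn_einf (f_ ^~ x))%E).
  apply: ae_ge0_le_integral => //.
    rewrite (_ : (fun x => _) = (fun x => - limn_esup ((fun j => - f_ j x)%E))%E).
      apply: measurableT_comp => //.
      apply: (@measurable_fun_limn_esup _ _ _ _ (fun j x => - f_ j x)%E) => j.
      exact: measurableT_comp.
    apply/funext => x; rewrite -limn_einfN; congr limn_einf.
    by apply/funext => j /=; rewrite oppeK.
  by move: ff; apply: filterS => x /cvg_limn_einf_sup[-> _] _.
apply: le_trans (fatou mu measurableT mf_ (fun j x _ => f_0 j x)) _.
rewrite limn_einf_lim; apply: lime_le; first exact: is_cvg_einfs.
apply: nearW => j; apply: le_trans (fS j).
by apply: ereal_inf_lbound; exists j => /=.
Qed.

Lemma associate_enorm_ge0 f : (0 <= associate_enorm mu X f)%E.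
Proof.
apply: ereal_sup_ge; exists (\int[mu]_x `|f x * (cst 0 : T -> R) x|%:E)%E.
  by exists (cst 0) => //; split; [exact: (bfs_zero HX)|rewrite (bfs_norm0 HX)].
by apply: integral_ge0 => x _; rewrite lee_fin.
Qed.

Lemma associate_fin f : carrier X' f -> associate_enorm mu X f = (norm X' f)%:E.
Proof.
by move=> [_ fin]; rewrite /= fineK// ge0_fin_numE// associate_enorm_ge0.
Qed.

Lemma associate_norm_ge0 f : 0 <= norm X' f.
Proof. by rewrite /= fine_ge0// associate_enorm_ge0. Qed.

Lemma associate_dual f (g : T -> R) : carrier X' f -> carrier X g -> norm X g <= 1 ->
  (\int[mu]_x `|f x * g x|%:E <= (norm X' f)%:E)%E.
Proof.
by move=> Xf Xg Ng; rewrite -associate_fin//; apply: ereal_sup_ubound; exists g.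
Qed.

Lemma associate_bound f (C : R) : measurable_fun setT f ->
  (forall g, carrier X g -> norm X g <= 1 ->
    (\int[mu]_x `|f x * g x|%:E <= C%:E)%E) ->
  carrier X' f /\ norm X' f <= C.
Proof.
move=> mf fC.
have h : (associate_enorm mu X f <= C%:E)%E.
  by apply: ge_ereal_sup => _ [g [Xg Ng] <-]; exact: fC.
have X'f : carrier X' f by split => //; apply: le_lt_trans h _; rewrite ltry.
by split => //; rewrite -lee_fin -associate_fin.
Qed.

Lemma measurable_abs_prod f g : measurable_fun setT f -> measurable_fun setT g ->
  measurable_fun setT (fun x => `|f x * g x|%:E).
Proof.
move=> mf mg; apply/measurable_EFinP.
by apply: measurableT_comp => //; exact: measurable_funM.
Qed.

Lemma int_prodZ (a b : R) f g : measurable_fun setT f -> measurable_fun setT g ->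
  (\int[mu]_x `|(a * f x) * (b * g x)|%:E =
   `|a * b|%:E * \int[mu]_x `|f x * g x|%:E)%E.
Proof.
move=> mf mg; rewrite -ge0_integralZl//; last exact: measurable_abs_prod.
by apply: eq_integral => x _; rewrite -EFinM -normrM mulrACA.
Qed.

Lemma bfs_associate_hoelder f g : carrier X g -> carrier X' f ->
  (\int[mu]_x `|f x * g x|%:E <= (norm X' f * norm X g)%:E)%E.
Proof.
move=> Xg Xf; have mf := Xf.1; have mg := bfs_measurable HX Xg.
have := bfs_norm_ge0 HX Xg; rewrite le_eqVlt => /predU1P[g0|g0].
  have h0 := bfs_norm_eq0 HX Xg (esym g0).
  rewrite -g0 mulr0 (@ae_eq_integral _ _ _ _ _ (cst 0%E)) ?integral0//.
    exact: measurable_abs_prod.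
  by move: h0; apply: filterS => x -> _; rewrite mulr0 normr0.
have Xg' := bfs_scale HX (norm X g)^-1 Xg.
have Ng' : norm X (fun x => (norm X g)^-1 * g x) <= 1.
  by rewrite (bfs_normZ HX)// gtr0_norm ?invr_gt0// mulVf ?gt_eqF.
have := associate_dual Xf Xg' Ng'.
under eq_integral do rewrite -[f _]mul1r.
rewrite int_prodZ// mul1r gtr0_norm ?invr_gt0// => h.
have -> : (\int[mu]_x `|f x * g x|%:E =
   (norm X g)%:E * ((norm X g)^-1%:E * \int[mu]_x `|f x * g x|%:E))%E.
  by rewrite muleA -EFinM mulfV ?gt_eqF// mul1e.
by rewrite mulrC EFinM lee_wpmul2l// lee_fin ltW.
Qed.

Lemma associate_ideal f g : carrier X' f -> measurable_fun setT g ->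
  (\forall x \ae mu, `|g x| <= `|f x|) -> carrier X' g /\ norm X' g <= norm X' f.
Proof.
move=> Xf mg gf; apply: associate_bound => // h Xh Nh.
apply: le_trans (associate_dual Xf Xh Nh); have mh := bfs_measurable HX Xh.
apply: ae_ge0_le_integral => //; [exact: measurable_abs_prod| |].
  by apply: measurable_abs_prod => //; exact: Xf.1.
by move: gf; apply: filterS => x gfx _; rewrite lee_fin !normrM ler_wpM2r.
Qed.

(** Saturation is where duality enters: a function in the associate space that
norms an indicator is positive on part of the set, and dominates there a multiple of
an indicator.  The Fatou property is Fatou's lemma for each pairing. *)
Lemma associate_bfs : is_Banach_function_space mu X'.
Proof.
have cD f g : carrier X' f -> carrier X' g ->
    carrier X' (f \+ g) /\ norm X' (f \+ g) <= norm X' f + norm X' g.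
  move=> Xf Xg; have [mf _] := Xf; have [mg _] := Xg.
  apply: associate_bound => [|h Xh Nh]; first exact: measurable_funD.
  have mh := bfs_measurable HX Xh.
  rewrite EFinD; apply: le_trans (leeD (associate_dual Xf Xh Nh) (associate_dual Xg Xh Nh)).
  rewrite -ge0_integralD//; try exact: measurable_abs_prod.
  apply: ge0_le_integral => //.
  - by apply: measurable_abs_prod => //; exact: measurable_funD.
  - by apply: emeasurable_funD; exact: measurable_abs_prod.
  - by move=> x _; rewrite -EFinD lee_fin mulrDl ler_normD.
have cZ (c : R) f : carrier X' f -> carrier X' (fun x => c * f x) /\
    norm X' (fun x => c * f x) <= `|c| * norm X' f.
  move=> Xf; have [mf _] := Xf.
  apply: associate_bound => [|h Xh Nh]; first exact: measurable_funM.
  have mh := bfs_measurable HX Xh.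
  under eq_integral do rewrite -[h _]mul1r.
  rewrite int_prodZ// mulr1 EFinM lee_wpmul2l ?lee_fin//.
  exact: associate_dual.
split.
- by move=> f [].
- apply: (@associate_bound (cst 0) 0 _ _).1 => // g _ _.
  rewrite (_ : (fun x => _) = cst 0%E) ?integral0//.
  by apply/funext => x; rewrite mul0r normr0.
- by move=> f g Xf Xg; have [] := cD f g Xf Xg.
- by move=> c f Xf; have [] := cZ c f Xf.
- by move=> f _; exact: associate_norm_ge0.
- move=> f Xf f0; have [mf _] := Xf.
  pose E := [set x | f x != 0].
  have mE : measurable E.
    rewrite (_ : E = ~` (f @^-1` [set 0])).
      by apply: measurableC; rewrite -[X in measurable X]setTI; exact: mf.
    by apply/seteqP; split => x /= /eqP.
  have muE : mu E = 0%E.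
    apply/eqP; rewrite eq_le measure_ge0 andbT leNgt; apply/negP => E0.
    have [F [mF FE F0 XF]] := bfs_saturation HX mE E0.
    have := bfs_associate_hoelder XF Xf; rewrite f0 mul0r => h.
    have mfF : measurable_fun setT (fun x => (f x * \1_F x)%:E).
      by apply/measurable_EFinP/measurable_funM => //; exact: measurable_indic.
    have [] := (ae_eq_integral_abs mu measurableT mfF).1.
      by apply/eqP; rewrite eq_le h/=; exact: integral_ge0.
    move=> N [mN N0 sN]; move: F0; apply/negP; rewrite -leNgt -N0.
    apply: le_measure; rewrite ?inE// => x Fx; apply: sN => /= /(_ Logic.I)[].
    by rewrite indicE mem_set// mulr1; apply/eqP; exact: FE.
  by exists E; split => // x /= /eqP.
- move=> c f Xf; apply/eqP; rewrite eq_le (cZ c f Xf).2/=.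
  have [->|c0] := eqVneq c 0; first by rewrite normr0 mul0r associate_norm_ge0.
  have [XcF _] := cZ c f Xf.
  have := (cZ c^-1 _ XcF).2; rewrite (_ : (fun x => _) = f); last first.
    by apply/funext => x; rewrite mulrA mulVf// mul1r.
  by rewrite normfV -ler_pdivrMl ?invr_gt0 ?normr_gt0// invrK.
- by move=> f g Xf Xg; have [] := cD f g Xf Xg.
- exact: associate_ideal.
- move=> f_ f Xf mf ndf cvgf ubf.
  set S := sup _.
  have fS j : norm X' (f_ j) <= S by apply: ub_le_sup => //; exists j.
  have [Xf' NS] : carrier X' f /\ norm X' f <= S.
    apply: associate_bound => // h Xh Nh; have mh := bfs_measurable HX Xh.
    apply: (@ae_fatou (fun j x => `|f_ j x * h x|%:E)).
    + by move=> j; apply: measurable_abs_prod => //; exact: (Xf j).1.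
    + exact: measurable_abs_prod.
    + by move=> j x; rewrite lee_fin.
    + by move=> x; rewrite lee_fin.
    + move: cvgf; apply: filterS => x fx; apply: cvg_EFin; first exact: nearW.
      by apply: cvg_norm; apply: cvgM => //; exact: cvg_cst.
    + by move=> j; apply: le_trans (associate_dual (Xf j) Xh Nh) _; rewrite lee_fin.
  split => //; apply/eqP; rewrite eq_le NS/=; apply: ge_sup.
    by exists (norm X' (f_ 0%N)), 0%N.
  move=> _ [j _ <-]; apply: (associate_ideal Xf' (Xf j).1 _).2.
  apply: filterS2 ndf cvgf => x ndx cx.
  have nd : {homo (f_ ^~ x) : m n / (m <= n)%N >-> m <= n}.
    by apply/nondecreasing_seqP => n; have /andP[] := ndx n.
  have fj : f_ j x <= f x.
    by rewrite -(cvg_lim _ cx)//; apply: nondecreasing_cvgn_le => //; apply/cvg_ex; exists (f x).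
  have f0 : 0 <= f_ j x by have /andP[] := ndx j.
  by rewrite !ger0_norm// (le_trans f0).
- move=> E mE E0.
  have [F0 [mF0 F0E F0_gt0 XF0]] := bfs_saturation HX mE E0.
  have /sigma_finiteP[G [TG ndG Gm]] := sigma_finiteT mu.
  have [i Fi] : exists i, (0 < mu (F0 `&` G i))%E.
    apply: contrapT => /forallNP h.
    have : (mu F0 <= \sum_(i <oo) mu (F0 `&` G i))%E.
      apply: measure_sigma_subadditive => // [i|].
        by apply: measurableI => //; have [] := Gm i.
      by rewrite -setI_bigcupr -TG setIT.
    rewrite eseries0 ?leNgt ?F0_gt0//.
    move=> i _ _; apply/eqP; rewrite eq_le measure_ge0 andbT leNgt.
    exact/negP/h.
  set F := F0 `&` G i in Fi.
  have mG : measurable (G i) by have [] := Gm i.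
  have mF : measurable F by exact: measurableI.
  have Ffin : (mu F < +oo)%E.
    by apply: le_lt_trans (Gm i).2; apply: le_measure; rewrite ?inE//; exact: subIsetr.
  have FE : F `<=` E by move=> x [/F0E].
  have XF : carrier X \1_F.
    apply: (bfs_dom HX XF0) => [|x]; first exact: measurable_indic.
    by apply: indic_sub => y [].
  have n0 := bfs_indic_norm_gt0 HX mF Fi XF.
  have [|||g [bg g0 g1 hg]] := @associate_norming _ _ _ _ _ HX F mF Ffin \1_F 1 (norm X \1_F / 2) XF.
  - by move=> x; rewrite indic_ge0 mul1r lexx.
  - by rewrite divr_gt0.
  - by rewrite ltr_pdivrMr// ltr_pMr// ltr1n.
  have mg := bg.1.
  pose A m := F `&` [set x | m.+1%:R^-1 <= g x].
  have mA m : measurable (A m).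
    by apply: measurableI => //; exact: measurable_set_le.
  have [m Am] : exists m, (0 < mu (A m))%E.
    apply: contrapT => /forallNP h.
    have : \forall x \ae mu, (g x * \1_F x)%:E = 0%E.
      exists (\bigcup_m A m); split; first exact: bigcup_measurable.
        apply/eqP; rewrite eq_le measure_ge0 andbT.
        have : (mu (\bigcup_m A m) <= \sum_(i <oo) mu (A i))%E.
          by apply: measure_sigma_subadditive => //; exact: bigcup_measurable.
        rewrite eseries0 => [//|k _ _]; apply/eqP; rewrite eq_le measure_ge0 andbT leNgt.
        exact/negP/h.
      move=> x /= gF; have [Fx|nFx] := pselect (F x); last first.
        by exfalso; apply: gF; rewrite indicE memNset// mulr0.
      have gx : 0 < g x.
        rewrite lt_neqAle g0 andbT eq_sym; apply/eqP => gx0; apply: gF.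
        by rewrite gx0 mul0r.
      exists (Num.truncn (g x)^-1) => //; split => //=.
      rewrite -[leRHS]invrK lef_pV2 ?posrE ?invr_gt0// ltW//.
      by apply: truncnS_gt; rewrite invr_ge0 ltW.
    move=> hae; move: hg; rewrite /Rintegral (@ae_eq_integral _ _ _ _ _ (cst 0%E)) ?integral0//=.
    + by rewrite leNgt divr_gt0.
    + by apply/measurable_EFinP/measurable_funM => //; exact: measurable_indic.
    + by move: hae; apply: filterS => x h' _.
  exists (A m); split => //; first by move=> x [/FE].
  have Xg : carrier X' g by split => //; apply: le_lt_trans g1 _; rewrite ltry.
  have Xmg := (cZ m.+1%:R _ Xg).1.
  apply: (associate_ideal Xmg _ _).1; first exact: measurable_indic.
  apply: aeW => x; rewrite !ger0_norm ?indic_ge0 ?mulr_ge0//.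
  rewrite indicE; have [Ax|nAx] := pselect (A m x); last first.
    by rewrite memNset//= mulr_ge0.
  by rewrite mem_set//= mulrC -ler_pdivrMr// mul1r; exact: Ax.2.
Qed.

End associate_theory.

(** * Duality of convexity and concavity *)

Section extremal_weights.
Context {R : realType}.

(** Equality in Hoelder's inequality holds for the weights [(a / M) `^ (s - 1)] and
[(b / M) `^ (s - 1)], where [M] is the right-hand side. *)
Lemma hoelder2_extremal (r s a b : R) : 1 < r -> 1 < s -> r^-1 + s^-1 = 1 ->
  0 <= a -> 0 <= b -> exists al be : R, [/\ 0 <= al, 0 <= be,
    al `^ r + be `^ r <= 1 & al * a + be * b = (a `^ s + b `^ s) `^ s^-1].
Proof.
move=> r1 s1 rs a0 b0.
have r0 : 0 < r by lra.
have s0 : 0 < s by lra.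
pose M := (a `^ s + b `^ s) `^ s^-1; rewrite -/M.
have M0 : 0 <= M by exact: powR_ge0.
have Ms : M `^ s = a `^ s + b `^ s.
  by rewrite -powRrM mulVf ?gt_eqF// powRr1// addr_ge0 ?powR_ge0.
have [M_eq0|Mneq0] := eqVneq M 0.
  have := Ms; rewrite M_eq0 powR0 ?gt_eqF// => /esym/eqP.
  rewrite paddr_eq0 ?powR_ge0// => /andP[/eqP/powR_eq0_eq0 -> /eqP/powR_eq0_eq0 ->].
  by exists 0, 0; split => //; rewrite ?powR0 ?gt_eqF// ?mulr0 addr0 ?ler01.
have M_gt0 : 0 < M by rewrite lt_neqAle eq_sym Mneq0.
have sr : (s - 1) * r = s.
  have : s + r = r * s.
    have : (r^-1 + s^-1) * (r * s) = r * s by rewrite rs mul1r.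
    by move=> <-; field; rewrite !gt_eqF.
  by move=> e; rewrite mulrBl mul1r mulrC -e addrK.
clearbody M.
have pr (c : R) : (c `^ (s - 1)) `^ r = c `^ s by rewrite -powRrM sr.
have pM (c : R) : 0 <= c / M -> (c / M) `^ (s - 1) * c = (c / M) `^ s * M.
  move=> c0; rewrite -(mulr_powRB1 c0 s0) mulrC; set p := _ `^ _.
  by rewrite mulrAC divfK.
have sumM : (a / M) `^ s + (b / M) `^ s = 1.
  rewrite !powRM ?invr_ge0// -mulrDl -Ms -powRM ?invr_ge0//.
  by rewrite mulfV ?gt_eqF// powR1.
exists ((a / M) `^ (s - 1)), ((b / M) `^ (s - 1)); split.
- exact: powR_ge0.
- exact: powR_ge0.
- by rewrite !pr sumM.
- by rewrite !pM ?divr_ge0// -mulrDl sumM mul1r.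
Qed.

End extremal_weights.

Section associate_concavity.
Context d (T : measurableType d) {R : realType}.
Variable mu : {sigma_finite_measure set T -> \bar R}.
Variable X : function_space T R.
Hypothesis HX : is_Banach_function_space mu X.
Implicit Types f g : T -> R.
Local Notation X' := (associate mu X).

Lemma bfs_norm_le_dual Om k (c C : R) : measurable Om -> (mu Om < +oo)%E ->
  carrier X k -> (forall x, 0 <= k x <= c * \1_Om x) -> 0 <= C ->
  (forall g, (forall x, 0 <= g x) -> carrier X' g -> norm X' g <= 1 ->
     (\int[mu]_x (g x * k x)%:E <= C%:E)%E) ->
  norm X k <= C.
Proof.
move=> mOm Omfin Xk kc C0 h; rewrite leNgt; apply/negP => CN.
pose t := (C + norm X k) / 2.
have Ct : C < t by rewrite /t; lra.
have tN : t < norm X k by rewrite /t; lra.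
have [g [bg g0 g1 tg]] := associate_norming HX mOm Omfin Xk kc (le_lt_trans C0 Ct) tN.
have X'g : carrier X' g by split; [exact: bg.1|apply: le_lt_trans g1 _; rewrite ltry].
have bk : bounded_on Om k by exact: (bounded_on_between (bfs_measurable HX Xk) kc).
have N1 : norm X' g <= 1 by rewrite -lee_fin -(associate_fin HX).
have := h g g0 X'g N1; rewrite -(bdd_intE mOm Omfin) ?lee_fin; last exact: bounded_onM.
by move=> gC; have := le_lt_trans (le_trans tg gC) Ct; rewrite ltxx.
Qed.

Lemma associate_near_norming f (e : R) : carrier X' f -> 0 < e ->
  exists g, [/\ carrier X g, norm X g <= 1 &
    ((norm X' f - e)%:E <= \int[mu]_x `|f x * g x|%:E)%E].
Proof.
move=> Xf e0.
have : ((norm X' f - e)%:E < associate_enorm mu X f)%E.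
  by rewrite (associate_fin HX)// lte_fin ltrBlDr ltrDl.
by move=> /ereal_sup_gt[_ [g [Xg Ng] <-]] /ltW h; exists g.
Qed.

(** Functions [u] and [v] that nearly norm [f] and [g] are combined into one function
with the weights extremal in Hoelder's inequality.  Convexity keeps the combination
in the unit ball, and Hoelder's inequality, pointwise, compares the pairings. *)
Lemma associate_q_concave (r s : R) : 1 < r -> 1 < s -> r^-1 + s^-1 = 1 ->
  p_convex r X -> q_concave s X'.
Proof.
move=> r1 s1 rs Xr f g Xf Xg.
have r0 : 0 < r by lra.
have s0 : 0 < s by lra.
have HX' := associate_bfs HX.
have [mf _] := Xf; have [mg _] := Xg.
pose h x : R := (`|f x| `^ s + `|g x| `^ s) `^ s^-1.
have mpow (p : R) (u : T -> R) : measurable_fun setT u -> measurable_fun setT (fun x => u x `^ p).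
  by move=> mu_; apply: (measurableT_comp (measurable_powR p)).
have mabs (u : T -> R) : measurable_fun setT u -> measurable_fun setT (fun x => `|u x|).
  by move=> mu_; exact: measurableT_comp.
have mh : measurable_fun setT h.
  by apply/mpow/measurable_funD; apply/mpow/mabs.
have h0 x : 0 <= h x by exact: powR_ge0.
have Xfg : carrier X' (fun x => `|f x| + `|g x|).
  exact: (bfs_add HX' (bfs_abs HX' Xf) (bfs_abs HX' Xg)).
have Xh : carrier X' h.
  apply: (bfs_dom HX' Xfg) => // x; rewrite (ger0_norm (h0 x)) ger0_norm ?addr_ge0//.
  by apply: (powR_root_sum_le (ltW s1)).
set a := norm X' f; set b := norm X' g; rewrite -/h.
have a0 : 0 <= a by exact: (associate_norm_ge0 HX).
have b0 : 0 <= b by exact: (associate_norm_ge0 HX).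
have [al [be [al0 be0 sum1 alM]]] := hoelder2_extremal r1 s1 rs a0 b0.
rewrite -alM.
apply/ler_addgt0Pr => e e0.
pose e' := e / (al + be + 1).
have abe : 0 < al + be + 1 by rewrite ltr_wpDl// addr_ge0.
have e'0 : 0 < e' by rewrite divr_gt0.
have [u [Xu Nu fu]] := associate_near_norming Xf e'0.
have [v [Xv Nv gv]] := associate_near_norming Xg e'0.
have mu_ := bfs_measurable HX Xu; have mv := bfs_measurable HX Xv.
have Xau := bfs_scale HX al Xu; have Xbv := bfs_scale HX be Xv.
pose w x : R := (`|al * u x| `^ r + `|be * v x| `^ r) `^ r^-1.
have w0 x : 0 <= w x by exact: powR_ge0.
have mw : measurable_fun setT w.
  by apply/mpow/measurable_funD; apply/mpow/mabs/measurable_funM.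
have Xw : carrier X w.
  apply: (bfs_dom HX (bfs_add HX (bfs_abs HX Xau) (bfs_abs HX Xbv))) => // x.
  rewrite (ger0_norm (w0 x)) ger0_norm ?addr_ge0//.
  exact: (powR_root_sum_le (ltW r1)).
have Nw : norm X w <= 1.
  apply: le_trans (Xr _ _ Xau Xbv) _.
  rewrite !(bfs_normZ HX)// (ger0_norm al0) (ger0_norm be0).
  have Nu0 := bfs_norm_ge0 HX Xu; have Nv0 := bfs_norm_ge0 HX Xv.
  have one : 1 `^ r^-1 = 1 :> R by rewrite powR1.
  rewrite -[leRHS]one ge0_ler_powR ?nnegrE ?invr_ge0 ?(ltW r0) ?addr_ge0 ?powR_ge0//.
  apply: le_trans sum1; rewrite lerD// ge0_ler_powR ?nnegrE ?mulr_ge0 ?(ltW r0)//.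
  - by rewrite ler_piMr.
  - by rewrite ler_piMr.
have pw x : al * `|f x * u x| + be * `|g x * v x| <= `|h x * w x|.
  rewrite (ger0_norm (mulr_ge0 (h0 x) (w0 x))).
  have -> : al * `|f x * u x| = `|f x| * `|al * u x|.
    by rewrite !normrM (ger0_norm al0); ring.
  have -> : be * `|g x * v x| = `|g x| * `|be * v x|.
    by rewrite !normrM (ger0_norm be0); ring.
  by apply: hoelder2; rewrite ?normr_ge0// addrC.
have int_pw : (al%:E * \int[mu]_x `|f x * u x|%:E + be%:E * \int[mu]_x `|g x * v x|%:E
   <= (norm X' h)%:E)%E.
  apply: le_trans (associate_dual HX Xh Xw Nw).
  rewrite -!ge0_integralZl//; try exact: measurable_abs_prod.
  rewrite -ge0_integralD//; last 4 first.
  - by move=> x _; rewrite mule_ge0.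
  - by apply: emeasurable_funM => //; exact: measurable_abs_prod.
  - by move=> x _; rewrite mule_ge0.
  - by apply: emeasurable_funM => //; exact: measurable_abs_prod.
  apply: ge0_le_integral => //.
  - by move=> x _; rewrite adde_ge0// mule_ge0.
  - by apply: emeasurable_funD; apply: emeasurable_funM => //; exact: measurable_abs_prod.
  - exact: measurable_abs_prod.
  - by move=> x _; rewrite -!EFinM -EFinD lee_fin pw.
have : (al%:E * (a - e')%:E + be%:E * (b - e')%:E <= (norm X' h)%:E)%E.
  by apply: le_trans int_pw; apply: leeD; rewrite lee_wpmul2l// lee_fin.
rewrite -!EFinM -EFinD lee_fin => H.
have abe' : (al + be) * e' <= e.
  by rewrite /e' mulrCA ler_piMr ?(ltW e0)// ler_pdivrMr// mul1r lerDl.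
have -> : al * a + be * b = (al * (a - e') + be * (b - e')) + (al + be) * e' by ring.
exact: lerD.
Qed.

End associate_concavity.

(** * Powers of a Banach function space *)

(** The [N]-convexification of [Z]. *)
Definition power_space d (T : measurableType d) (R : realType) (N : nat)
    (Z : function_space T R) : function_space T R := {|
  carrier := [set f : T -> R | measurable_fun setT f /\ carrier Z (fun x => `|f x| ^+ N)] ;
  norm := fun f => norm Z (fun x => `|f x| ^+ N) `^ N%:R^-1 |}.

Section power_space_theory.
Context d (T : measurableType d) {R : realType}.
Variable mu : {measure set T -> \bar R}.
Variable Z : function_space T R.
Hypothesis HZ : is_Banach_function_space mu Z.
Variable N : nat.
Hypothesis N0 : (0 < N)%N.
Implicit Types f g : T -> R.
Local Notation Y := (power_space N Z).

Lemma root_powK (a : R) : 0 <= a -> (a ^+ N) `^ N%:R^-1 = a.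
Proof.
by move=> a0; rewrite -powR_mulrn// -powRrM mulfV ?powRr1// pnatr_eq0 -lt0n.
Qed.

Lemma pow_rootK (a : R) : 0 <= a -> (a `^ N%:R^-1) ^+ N = a.
Proof.
move=> a0; rewrite -powR_mulrn ?powR_ge0// -powRrM mulVf ?powRr1//.
by rewrite pnatr_eq0 -lt0n.
Qed.

Lemma measurable_abs_pow f : measurable_fun setT f ->
  measurable_fun setT (fun x => `|f x| ^+ N).
Proof. by move=> mf; apply: measurable_funX; exact: measurableT_comp. Qed.

Lemma power_space_norm_pow f : carrier Y f ->
  norm Y f ^+ N = norm Z (fun x => `|f x| ^+ N).
Proof. by move=> [mf Zf]; rewrite /= pow_rootK// (bfs_norm_ge0 HZ). Qed.

Lemma power_space_norm_le f (C : R) : carrier Y f -> 0 <= C ->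
  norm Z (fun x => `|f x| ^+ N) <= C ^+ N -> norm Y f <= C.
Proof.
move=> Yf C0; by rewrite -power_space_norm_pow// ler_pXn2r// ?nnegrE ?powR_ge0.
Qed.

(** Convexity of the power function in homogeneous form. *)
Lemma powerD_le (n : nat) (u v a b : R) : 0 <= u -> 0 <= v -> 0 < a -> 0 < b ->
  (a * u + b * v) ^+ n.+1 <= (a + b) ^+ n * (a * u ^+ n.+1 + b * v ^+ n.+1).
Proof.
move=> u0 v0 a0 b0; elim: n => [|n IH]; first by rewrite !expr1 expr0 mul1r.
have auv : 0 <= a * u + b * v by rewrite addr_ge0// mulr_ge0// ltW.
have ab : 0 < a + b by rewrite addr_gt0.
rewrite exprS; apply: le_trans (ler_wpM2l auv IH) _.
rewrite mulrCA [(a + b) ^+ n.+1]exprSr -[leRHS]mulrA ler_wpM2l ?exprn_ge0 ?(ltW ab)//.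
(* Chebyshev's sum inequality: u - v and its powers have the same sign. *)
have cheb : 0 <= (u - v) * (u ^+ n.+1 - v ^+ n.+1).
  have [uv|vu] := leP u v.
    by rewrite mulr_le0 ?subr_le0// lerXn2r.
  by rewrite mulr_ge0 ?subr_ge0 ?(ltW vu)// lerXn2r ?nnegrE// ltW.
rewrite -subr_ge0 (_ : _ - _ = a * b * ((u - v) * (u ^+ n.+1 - v ^+ n.+1))).
  by rewrite mulr_ge0// mulr_ge0// ltW.
by rewrite !(exprS _ n.+1); ring.
Qed.

(** Minkowski's inequality from convexity of the power, with the bounds [a] and [b]
for the two norms as weights. *)
Lemma power_space_normD_le f g (a b : R) : carrier Y f -> carrier Y g ->
  0 < a -> 0 < b -> norm Y f <= a -> norm Y g <= b ->
  carrier Y (f \+ g) /\ norm Y (f \+ g) <= a + b.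
Proof.
move=> Yf Yg a0 b0 fa gb; have [mf Zf] := Yf; have [mg Zg] := Yg.
have ab : 0 < a + b by rewrite addr_gt0.
pose ca := (a + b) ^+ N.-1 / a ^+ N.-1; pose cb := (a + b) ^+ N.-1 / b ^+ N.-1.
have ca0 : 0 <= ca by rewrite divr_ge0 ?exprn_ge0// ltW.
have cb0 : 0 <= cb by rewrite divr_ge0 ?exprn_ge0// ltW.
have Zaf := bfs_scale HZ ca Zf; have Zbg := bfs_scale HZ cb Zg.
have Zs := bfs_add HZ Zaf Zbg.
have mfg : measurable_fun setT (f \+ g) by exact: measurable_funD.
have le x : `| `|(f \+ g) x| ^+ N| <= `|ca * `|f x| ^+ N + cb * `|g x| ^+ N|.
  have rhs0 : 0 <= ca * `|f x| ^+ N + cb * `|g x| ^+ N.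
    by rewrite addr_ge0// mulr_ge0// exprn_ge0.
  rewrite (ger0_norm rhs0) (ger0_norm (exprn_ge0 N (normr_ge0 _))).
  apply: (@le_trans _ _ ((`|f x| + `|g x|) ^+ N)).
    by rewrite lerXn2r ?nnegrE ?addr_ge0//= ler_normD.
  have fa0 : 0 <= `|f x| / a by rewrite divr_ge0// ltW.
  have gb0 : 0 <= `|g x| / b by rewrite divr_ge0// ltW.
  have := @powerD_le N.-1 _ _ _ _ fa0 gb0 a0 b0.
  rewrite prednK// !mulrA ![_ * _ / _]mulrAC !divff ?gt_eqF// !mul1r => /le_trans; apply.
  rewrite le_eqVlt; apply/orP; left; apply/eqP; rewrite /ca /cb.
  have eN (c x' : R) : c != 0 -> c * (x' / c) ^+ N = x' ^+ N / c ^+ N.-1.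
    move=> c0; rewrite expr_div_n -[in c ^+ N](prednK N0) exprS; field.
    by rewrite c0 expf_neq0.
  by rewrite !eN ?gt_eqF//; ring.
have Yfg : carrier Y (f \+ g).
  by split => //; apply: (bfs_dom HZ Zs) => //; exact: measurable_abs_pow.
split => //; apply: power_space_norm_le => //; first exact: ltW.
apply: (@le_trans _ _ (ca * a ^+ N + cb * b ^+ N)).
  have := bfs_norm_le HZ Zs (measurable_abs_pow mfg) (aeW _ le).
  move=> /le_trans; apply; apply: le_trans (bfs_normD HZ Zaf Zbg) _.
  rewrite !(bfs_normZ HZ)// (ger0_norm ca0) (ger0_norm cb0).
  rewrite -!power_space_norm_pow// lerD// ler_wpM2l// lerXn2r// ?nnegrE ?powR_ge0//; exact: ltW.
have eN (c : R) : c != 0 -> (a + b) ^+ N.-1 / c ^+ N.-1 * c ^+ N = (a + b) ^+ N.-1 * c.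
  by move=> c0; rewrite -[in c ^+ N](prednK N0) exprSr; field; rewrite expf_neq0.
by rewrite /ca /cb !eN ?gt_eqF// -mulrDr -exprSr prednK.
Qed.

Lemma power_space_bfs : is_Banach_function_space mu Y.
Proof.
have Y0 : carrier Y (cst 0).
  split => //; rewrite (_ : (fun x => _) = cst 0); first exact: (bfs_zero HZ).
  by apply/funext => x; rewrite normr0 expr0n gtn_eqF.
have Nge0 f : 0 <= norm Y f by exact: powR_ge0.
have Yadd f g : carrier Y f -> carrier Y g ->
    carrier Y (f \+ g) /\ norm Y (f \+ g) <= norm Y f + norm Y g.
  move=> Yf Yg.
  have h (e : R) : 0 < e -> carrier Y (f \+ g) /\ norm Y (f \+ g) <= norm Y f + norm Y g + e.
    move=> e0; have e2 : 0 < e / 2 by rewrite divr_gt0.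
    have [||||? H] := @power_space_normD_le f g (norm Y f + e / 2) (norm Y g + e / 2) Yf Yg.
    - by rewrite ltr_wpDl.
    - by rewrite ltr_wpDl.
    - by rewrite lerDl ltW.
    - by rewrite lerDl ltW.
    by split => //; apply: le_trans H _; lra.
  split; first exact: (h 1 ltr01).1.
  by apply/ler_addgt0Pr => e e0; exact: (h e e0).2.
have YZ (c : R) f : carrier Y f -> carrier Y (fun x => c * f x) /\
    norm Y (fun x => c * f x) = `|c| * norm Y f.
  move=> [mf Zf]; have cE : (fun x => `|c * f x| ^+ N) = (fun x => `|c| ^+ N * `|f x| ^+ N).
    by apply/funext => x; rewrite normrM exprMn.
  split.
    split; first exact: measurable_funM.
    by rewrite cE; exact: (bfs_scale HZ).
  rewrite /= cE (bfs_normZ HZ)// ger0_norm ?exprn_ge0// powRM ?exprn_ge0//.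
    by rewrite root_powK.
  exact: (bfs_norm_ge0 HZ).
have Yideal (f g : T -> R) : carrier Y f -> measurable_fun setT g ->
    (\forall x \ae mu, `|g x| <= `|f x|) -> carrier Y g /\ norm Y g <= norm Y f.
  move=> Yf mg gf; have [mf Zf] := Yf.
  have le : \forall x \ae mu, `| `|g x| ^+ N| <= `| `|f x| ^+ N|.
    move: gf; apply: filterS => x h.
    by rewrite !(ger0_norm (exprn_ge0 N (normr_ge0 _))) lerXn2r ?nnegrE.
  have [Zg Ng] := bfs_ideal HZ Zf (measurable_abs_pow mg) le.
  split; first by [].
  by apply: power_space_norm_le => //; rewrite power_space_norm_pow.
split => //.
- by move=> f [].
- by move=> f g Yf Yg; exact: (Yadd f g Yf Yg).1.
- by move=> c f Yf; exact: (YZ c f Yf).1.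
- move=> f Yf f0; have [mf Zf] := Yf.
  have := power_space_norm_pow Yf; rewrite f0 expr0n gtn_eqF//= => /esym h.
  have := bfs_norm_eq0 HZ Zf h; apply: filterS => x /eqP.
  by rewrite expf_eq0 N0/= normr_eq0 => /eqP.
- by move=> c f Yf; exact: (YZ c f Yf).2.
- by move=> f g Yf Yg; exact: (Yadd f g Yf Yg).2.
- move=> f_ f Yf mf ndf cvgf ubf.
  set S := sup _.
  have fS j : norm Y (f_ j) <= S by apply: ub_le_sup => //; exists j.
  have S0 : 0 <= S by apply: le_trans (fS 0%N).
  have Zf j : carrier Z (fun x => `|f_ j x| ^+ N) by have [] := Yf j.
  have fSN j : norm Z (fun x => `|f_ j x| ^+ N) <= S ^+ N.
    by rewrite -power_space_norm_pow// lerXn2r ?nnegrE.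
  have [] := bfs_Fatou HZ Zf (measurable_abs_pow mf).
  + move: ndf; apply: filterS => x h j; have /andP[h0 h1] := h j.
    by rewrite exprn_ge0//= lerXn2r ?nnegrE// !ger0_norm// (le_trans h0).
  + move: cvgf; apply: filterS => x /cvg_norm h.
    elim: N => [|m IH]; first by rewrite expr0; exact: cvg_cst.
    by rewrite exprS; under eq_fun do rewrite exprS; exact: cvgM.
  + by exists (S ^+ N) => _ [j _ <-].
  move=> Zf' NZ; have Yf' : carrier Y f by [].
  split => //; apply/eqP; rewrite eq_le; apply/andP; split.
    apply: power_space_norm_le => //; rewrite NZ; apply: ge_sup => [|_ [j _ <-]//].
    by exists (norm Z (fun x => `|f_ 0%N x| ^+ N)), 0%N.
  apply: ge_sup; first by exists (norm Y (f_ 0%N)), 0%N.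
  move=> _ [j _ <-]; apply: power_space_norm_le; [exact: Yf|exact: Nge0|].
  rewrite power_space_norm_pow// NZ; apply: ub_le_sup; last by exists j.
  by exists (S ^+ N) => _ [i _ <-].
- move=> E mE E0; have [F [mF FE F0 ZF]] := bfs_saturation HZ mE E0.
  exists F; split => //; split; first exact: measurable_indic.
  rewrite (_ : (fun x => _) = \1_F)//; apply/funext => x.
  by rewrite indicE; case: (_ \in _); rewrite /= ?normr1 ?expr1n// normr0 expr0n gtn_eqF.
Qed.

Lemma power_space_q_concave (s : R) : 0 < s -> q_concave s Z ->
  q_concave (N%:R * s) Y.
Proof.
move=> s0 Zs f g [mf Zf] [mg Zg].
have n0 : 0 < N%:R :> R by rewrite ltr0n.
have pw (u : T -> R) : norm Y u `^ (N%:R * s) = norm Z (fun x => `|u x| ^+ N) `^ s.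
  by rewrite /= -powRrM mulrA mulVf ?gt_eqF// mul1r.
rewrite !pw invfM mulrC powRrM.
pose w x := (`| `|f x| ^+ N| `^ s + `| `|g x| ^+ N| `^ s) `^ s^-1.
have h : (norm Z (fun x => `|f x| ^+ N) `^ s + norm Z (fun x => `|g x| ^+ N) `^ s)
    `^ s^-1 <= norm Z w := Zs _ _ Zf Zg.
have -> : norm Y (fun x => (`|f x| `^ (N%:R * s) + `|g x| `^ (N%:R * s)) `^ (s^-1 * N%:R^-1)) =
   norm Z w `^ N%:R^-1.
  rewrite /=; congr (norm Z _ `^ _); apply/funext => x; rewrite /w.
  have pN (y : R) : `|y| `^ (N%:R * s) = `| `|y| ^+ N| `^ s.
    by rewrite powRrM powR_mulrn// (ger0_norm (exprn_ge0 N (normr_ge0 y))).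
  by rewrite !pN powRrM (ger0_norm (powR_ge0 _ _)) pow_rootK// powR_ge0.
apply: ge0_ler_powR; rewrite ?nnegrE ?invr_ge0 ?(ltW n0)//.
  exact: powR_ge0.
by apply: le_trans h; exact: powR_ge0.
Qed.

End power_space_theory.

(** * Finite unions *)

Section bigcup_measure.
Context d (T : measurableType d) {R : realType}.
Variable mu : {measure set T -> \bar R}.

Lemma bigcup_seq_cons (I : eqType) (i : I) (s : seq I) (F : I -> set T) :
  [set x | exists2 j, j \in i :: s & F j x] =
  F i `|` [set x | exists2 j, j \in s & F j x].
Proof.
apply/seteqP; split => x /=.
  by move=> [j]; rewrite in_cons => /predU1P[->|js] Fx; [left|right; exists j].
by move=> [Fx|[j js Fx]]; [exists i; rewrite ?mem_head|exists j; rewrite ?in_cons ?js ?orbT].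
Qed.

Lemma bigcup_seq_nil (I : eqType) (F : I -> set T) :
  [set x | exists2 j, j \in [::] & F j x] = set0.
Proof. by apply/seteqP; split => // x []. Qed.

Lemma measurable_bigcup_seq (I : eqType) (s : seq I) (F : I -> set T) :
  (forall i, i \in s -> measurable (F i)) ->
  measurable [set x | exists2 i, i \in s & F i x].
Proof.
elim: s => [|i s IH] mF; first by rewrite bigcup_seq_nil.
rewrite bigcup_seq_cons; apply: measurableU; first by apply: mF; rewrite mem_head.
by apply: IH => j js; apply: mF; rewrite in_cons js orbT.
Qed.

Lemma measure_bigcup_seq_le (I : eqType) (s : seq I) (F : I -> set T) :
  (forall i, i \in s -> measurable (F i)) ->
  (mu [set x | exists2 i, i \in s & F i x] <= \sum_(i <- s) mu (F i))%E.
Proof.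
elim: s => [|i s IH] mF; first by rewrite big_nil bigcup_seq_nil measure0.
have mFi : measurable (F i) by apply: mF; rewrite mem_head.
have mFs j : j \in s -> measurable (F j) by move=> js; apply: mF; rewrite in_cons js orbT.
rewrite bigcup_seq_cons big_cons; apply: le_trans (measureU2 _ _ _) _ => //.
  exact: measurable_bigcup_seq.
by apply: leeD => //; exact: IH.
Qed.

Lemma measure_bigcup_seq (I : eqType) (s : seq I) (F : I -> set T) :
  uniq s -> (forall i, i \in s -> measurable (F i)) ->
  (forall i j, i \in s -> j \in s -> F i `&` F j !=set0 -> i = j) ->
  mu [set x | exists2 i, i \in s & F i x] = (\sum_(i <- s) mu (F i))%E.
Proof.
elim: s => [|i s IH] /= us mF dF; first by rewrite big_nil bigcup_seq_nil measure0.
have /andP[nis us'] := us.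
have mFi : measurable (F i) by apply: mF; rewrite mem_head.
have sub j : j \in s -> j \in i :: s by rewrite in_cons => ->; rewrite orbT.
have mFs j : j \in s -> measurable (F j) by move=> /sub; exact: mF.
rewrite bigcup_seq_cons big_cons measureU//; last 2 first.
- exact: measurable_bigcup_seq.
- apply/seteqP; split => // x [Fi [j js Fj]].
  move: nis; rewrite (dF i j) ?js ?mem_head//; [exact: sub|by exists x].
congr (_ + _)%E; apply: IH => // j k js ks.
by apply: dF; exact: sub.
Qed.

End bigcup_measure.

(** * Cubes and their dyadic subdivisions *)

Section cubes.
Context {R : realType} {n : nat}.
Local Notation mu := (@lebesgue_Rn R n).
Implicit Types (a x y : Rn R n) (l : R).

Lemma cubeP a l x :
  cube a l x <-> forall i, (tnth a i : R) <= tnth x i < (tnth a i : R) + l.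
Proof. by split => h i; have := h i; rewrite /= in_itv. Qed.

Lemma measurable_cube a l : measurable (cube a l).
Proof.
rewrite (_ : cube a l = \bigcap_(i in [set: 'I_n])
   ((fun x : Rn R n => tnth x i) @^-1` `[tnth a i : R, (tnth a i : R) + l[%classic)).
  apply: fin_bigcap_measurable => // i _; rewrite -[X in measurable X]setTI.
  by apply: measurable_tnth => //; exact: measurable_itv.
by apply/seteqP; split => x h i; [move=> _; exact: h|exact: (h i Logic.I)].
Qed.

Lemma lebesgue_cube a l : 0 <= l -> mu (cube a l) = (l ^+ n)%:E.
Proof.
move=> l0; rewrite /cube (lebesgue_Rn_box (A := fun i => `[tnth a i : R, (tnth a i : R) + l[%classic)).
  rewrite (eq_bigr (fun=> l%:E)).
    by rewrite prodEFin; congr EFin; rewrite big_const_ord iter_mulr_1.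
  move=> i _; rewrite lebesgue_measure_itv/= lte_fin ltrDl.
  by move: l0; rewrite le_eqVlt => /predU1P[<-|->]; [rewrite ltxx|rewrite -EFinD addrC addKr].
by move=> i; exact: measurable_itv.
Qed.

Lemma lebesgue_cube_gt0 a l : 0 < l -> (0 < mu (cube a l))%E.
Proof. by move=> l0; rewrite lebesgue_cube ?(ltW l0)// lte_fin exprn_gt0. Qed.

Lemma lebesgue_cube_fin a l : (mu (cube a l) < +oo)%E.
Proof.
have [l0|l0] := leP 0 l; first by rewrite lebesgue_cube// ltry.
have [->|/set0P[x xc]] := eqVneq (cube a l) set0; first by rewrite measure0 ltry.
apply: (@le_lt_trans _ _ (mu (cube a 1))); last by rewrite lebesgue_cube// ltry.
apply: le_measure; rewrite ?inE; [exact: measurable_cube..|].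
move=> y /cubeP h; apply/cubeP => i; have /andP[h1 h2] := h i.
by rewrite h1/= (lt_trans h2)// ltrD2l (lt_trans l0).
Qed.

End cubes.

Section grid.
Context {R : realType} {n : nat}.
Local Notation mu := (@lebesgue_Rn R n).
Variables (a : Rn R n) (l : R).
Hypothesis l0 : 0 < l.
Local Notation Q := (cube a l).
Implicit Types (x y : Rn R n) (A V : set (Rn R n)).

(** The subdivision of [Q] at level [k] consists of [2 ^ (k * n)] congruent cubes. *)
Definition grid_index (k : nat) x (i : 'I_n) : nat :=
  Num.truncn (2 ^+ k * ((tnth x i : R) - tnth a i) / l).

Definition grid_cell (k : nat) (m : 'I_n -> nat) : set (Rn R n) :=
  cube [tuple (tnth a i : R) + l * (m i)%:R / 2 ^+ k | i < n] (l / 2 ^+ k).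

Lemma grid_coord_ge0 k x i : Q x -> 0 <= 2 ^+ k * ((tnth x i : R) - tnth a i) / l.
Proof.
move=> /cubeP/(_ i)/andP[ax _]; rewrite divr_ge0 ?(ltW l0)// mulr_ge0 ?exprn_ge0//.
by rewrite subr_ge0.
Qed.

Lemma grid_index_lt k x i : Q x -> (grid_index k x i < 2 ^ k)%N.
Proof.
move=> Qx; have /cubeP/(_ i)/andP[_ xa] := Qx.
rewrite -(ltr_nat R); have /andP[h _] := truncn_itv (grid_coord_ge0 k i Qx).
apply: le_lt_trans h _; rewrite natrX -mulrA gtr_pMr ?exprn_gt0//.
by rewrite ltr_pdivrMr// mul1r ltrBlDl.
Qed.

Lemma grid_cellP k m x : Q x -> grid_cell k m x <-> forall i, grid_index k x i = m i.
Proof.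
move=> Qx; have e0 : 0 < 2 ^+ k :> R by rewrite exprn_gt0.
have eq i : (grid_index k x i = m i) <->
   ((tnth a i : R) + l * (m i)%:R / 2 ^+ k <= tnth x i <
     (tnth a i : R) + l * (m i)%:R / 2 ^+ k + l / 2 ^+ k).
  rewrite /grid_index; set t := 2 ^+ k * _ / l.
  have xE : (tnth x i : R) = tnth a i + l * t / 2 ^+ k.
    by rewrite /t; field; rewrite !gt_eqF.
  have -> : ((tnth a i : R) + l * (m i)%:R / 2 ^+ k <= tnth x i <
     (tnth a i : R) + l * (m i)%:R / 2 ^+ k + l / 2 ^+ k) = ((m i)%:R <= t < (m i).+1%:R).
    rewrite xE lerD2l -addrA ltrD2l -mulrDl -[X in _ + X]mulr1 -mulrDr natr1.
    by rewrite ler_pM2r ?invr_gt0// ltr_pM2r ?invr_gt0// ler_pM2l// ltr_pM2l.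
  have t0 : 0 <= t by exact: grid_coord_ge0.
  by rewrite -(truncn_eq _ t0); split => [/eqP|/eqP].
split.
  by move=> /cubeP h i; apply/eq; have := h i; rewrite tnth_mktuple.
by move=> h; apply/cubeP => i; rewrite tnth_mktuple; exact/eq.
Qed.

Lemma grid_cell_sub k m : (forall i, (m i < 2 ^ k)%N) -> grid_cell k m `<=` Q.
Proof.
move=> mk x /cubeP h; apply/cubeP => i; have := h i; rewrite tnth_mktuple.
have e0 : 0 < 2 ^+ k :> R by rewrite exprn_gt0.
have mi : (m i).+1%:R <= 2 ^+ k :> R by rewrite -natrX ler_nat.
have h1 : 0 <= l * (m i)%:R / 2 ^+ k by rewrite divr_ge0 ?mulr_ge0 ?(ltW l0) ?(ltW e0).
have h2 : l * (m i)%:R / 2 ^+ k + l / 2 ^+ k <= l.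
  by rewrite -mulrDl -[X in _ + X]mulr1 -mulrDr natr1 ler_pdivrMr// ler_pM2l.
by move=> /andP[x1 x2]; apply/andP; split; lra.
Qed.

Lemma grid_index_refine k j x y i : (k <= j)%N -> Q x -> Q y ->
  grid_index j x i = grid_index j y i -> grid_index k x i = grid_index k y i.
Proof.
move=> /subnK <-; elim: (j - k)%N => // m IH Qx Qy h; apply: IH => //.
move: h; rewrite addSn /grid_index exprS.
have := grid_coord_ge0 (m + k) i Qx; have := grid_coord_ge0 (m + k) i Qy.
set s := (2 ^+ (m + k) * (tnth x i - _) / l); set t := (2 ^+ (m + k) * (tnth y i - _) / l).
have -> : 2 * 2 ^+ (m + k) * ((tnth x i : R) - tnth a i) / l = 2 * s by rewrite /s; ring.
have -> : 2 * 2 ^+ (m + k) * ((tnth y i : R) - tnth a i) / l = 2 * t by rewrite /t; ring.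
move=> t0 s0.
have s20 : 0 <= 2 * s by rewrite mulr_ge0.
have t20 : 0 <= 2 * t by rewrite mulr_ge0.
clearbody s t.
wlog st : s t t0 s0 t20 s20 / (Num.truncn s < Num.truncn t)%N.
  move=> H h; have [//|/eqP ne] := eqVneq (Num.truncn s) (Num.truncn t).
  have [lt|lt|//] := ltngtP (Num.truncn s) (Num.truncn t).
    exact: (H s t).
  exact/esym/(H t s).
move=> h; exfalso.
have /andP[_ hs] := truncn_itv s0; have /andP[ht _] := truncn_itv t0.
have /andP[hs2 _] := truncn_itv s20; have /andP[_ ht2] := truncn_itv t20.
have : (Num.truncn (2 * t))%:R < ((Num.truncn t).*2)%:R :> R.
  rewrite -h; apply: le_lt_trans hs2 _; rewrite -muln2 natrM mulrC ltr_pM2r//.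
  by apply: lt_le_trans hs _; rewrite ler_nat.
rewrite ltr_nat -(ltr_nat R) => h3.
have : ((Num.truncn (2 * t)).+1%:R : R) <= ((Num.truncn t).*2)%:R by rewrite ler_nat -(ltr_nat R).
rewrite -muln2 natrM; lra.
Qed.

(** Unions of cells are encoded as sets invariant under change of point within a
cell, which makes refinement and Boolean operations immediate. *)
Definition grid_set (k : nat) V := V `<=` Q /\ forall x y, Q x -> Q y ->
  (forall i, grid_index k x i = grid_index k y i) -> V x -> V y.

Lemma grid_set_refine k j V : (k <= j)%N -> grid_set k V -> grid_set j V.
Proof.
move=> kj [VQ hV]; split => // x y Qx Qy h; apply: hV => // i.
exact: (grid_index_refine kj).
Qed.

Definition cells_of (k : nat) V : seq {ffun 'I_n -> 'I_(2 ^ k)} :=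
  [seq m : {ffun 'I_n -> 'I_(2 ^ k)} <- enum {: {ffun 'I_n -> 'I_(2 ^ k)}} |
     `[< grid_cell k (fun i => m i) `&` V !=set0 >]].

Lemma grid_setE k V : grid_set k V ->
  V = [set x | exists2 m, m \in cells_of k V & grid_cell k (fun i => m i) x].
Proof.
move=> [VQ hV]; apply/seteqP; split => x.
  move=> Vx; have Qx := VQ _ Vx.
  pose m : {ffun 'I_n -> 'I_(2 ^ k)} := [ffun i => Ordinal (grid_index_lt k i Qx)].
  have mx : grid_cell k (fun i => m i) x.
    by apply/(grid_cellP _ _ Qx) => i; rewrite ffunE.
  by exists m => //; rewrite mem_filter mem_enum andbT; apply/asboolP; exists x.
move=> [m]; rewrite mem_filter => /andP[/asboolP[y [my Vy]] _] mx.
have Qx : Q x by apply: (grid_cell_sub _ mx) => i; exact: ltn_ord.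
have Qy := VQ _ Vy; apply: (hV y) => // i.
by move: my mx => /(grid_cellP _ _ Qy) -> /(grid_cellP _ _ Qx) ->.
Qed.

Lemma measurable_grid_set k V : grid_set k V -> measurable V.
Proof.
move=> hV; rewrite (grid_setE hV); apply: measurable_bigcup_seq => m _.
exact: measurable_cube.
Qed.

Lemma grid_cell_inj k (m p : {ffun 'I_n -> 'I_(2 ^ k)}) :
  grid_cell k (fun i => m i) `&` grid_cell k (fun i => p i) !=set0 -> m = p.
Proof.
move=> [x [mx px]]; apply/ffunP => i; apply: val_inj.
have Qx : Q x by apply: (grid_cell_sub _ mx) => j; exact: ltn_ord.
by move: mx px => /(grid_cellP _ _ Qx)/(_ i)/= hm /(grid_cellP _ _ Qx)/(_ i)/= hp; rewrite -hm.
Qed.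

Definition grid_approx A := forall e : R, 0 < e -> exists k V,
  [/\ grid_set k V, (mu ((Q `&` A) `\` V) <= e%:E)%E & (mu (V `\` A) <= e%:E)%E].

Let mQ : measurable Q := measurable_cube a l.

Lemma grid_approxC A : grid_approx A -> grid_approx (~` A).
Proof.
move=> hA e e0; have [k [V [hV h1 h2]]] := hA e e0.
have [VQ hV'] := hV.
exists k, (Q `\` V); split.
- split=> [x []//|x y Qx Qy h [_ nVx]]; split => // Vy; apply: nVx.
  by apply: (hV' y) => // i; rewrite h.
- apply: le_trans h2; rewrite (_ : _ `\` _ = V `\` A)//.
  apply/seteqP; split => x /= [].
    by move=> [Qx nAx] /not_andP[//|/contrapT].
  by move=> Vx nAx; split; [split => //; exact: VQ|case].
- apply: le_trans h1; rewrite (_ : _ `\` _ = (Q `&` A) `\` V)//.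
  apply/seteqP; split => x /= [].
    by move=> [Qx nVx] /contrapT.
  by move=> [Qx Ax] nVx; split.
Qed.

Lemma grid_approxU A B : measurable A -> measurable B ->
  grid_approx A -> grid_approx B -> grid_approx (A `|` B).
Proof.
move=> mA mB hA hB e e0; have e2 : 0 < e / 2 by rewrite divr_gt0.
have [k [V [hV h1 h2]]] := hA _ e2; have [j [W [hW g1 g2]]] := hB _ e2.
have mV := measurable_grid_set hV; have mW := measurable_grid_set hW.
have eE : e%:E = ((e / 2)%:E + (e / 2)%:E)%E by rewrite -EFinD -splitr.
exists (maxn k j), (V `|` W); split.
- have [VQ hV'] := grid_set_refine (leq_maxl k j) hV.
  have [WQ hW'] := grid_set_refine (leq_maxr k j) hW.
  split=> [x [/VQ|/WQ]//|x y Qx Qy h [Vx|Wx]]; first by left; exact: (hV' x).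
  by right; exact: (hW' x).
- rewrite eE; apply: le_trans (leeD h1 g1).
  apply: le_trans (measureU2 _ _ _); [|by do ?[apply: measurableD|apply: measurableI]..].
  apply: le_measure; rewrite ?inE; [by do ?[apply: measurableD|apply: measurableI|apply: measurableU]..|].
  move=> x [[Qx ABx] nVW].
  case: ABx => [Ax|Bx]; [left|right]; (split; [by split|]) => hx; apply: nVW; by [left|right].
- rewrite eE; apply: le_trans (leeD h2 g2).
  apply: le_trans (measureU2 _ _ _); [|by do ?[apply: measurableD|apply: measurableI]..].
  apply: le_measure; rewrite ?inE; [by do ?[apply: measurableD|apply: measurableI|apply: measurableU]..|].
  by move=> x [[Vx|Wx] nAB]; [left|right]; split => // hx; apply: nAB; [left|right].
Qed.

(** By continuity of the measure on [Q], some [B j] already misses little of [A]. *)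
Lemma grid_approx_exhaust A (B : nat -> set (Rn R n)) : measurable A ->
  (forall j, measurable (B j)) -> (forall j, B j `<=` A) ->
  {homo B : i j / (i <= j)%N >-> i `<=` j} -> Q `&` A `<=` \bigcup_j B j ->
  (forall j, grid_approx (B j)) -> grid_approx A.
Proof.
move=> mA mB BA ndB AB hB e e0; have e2 : 0 < e / 2 by rewrite divr_gt0.
have eE : e%:E = ((e / 2)%:E + (e / 2)%:E)%E by rewrite -EFinD -splitr.
pose D j := (Q `&` A) `\` B j.
have mD j : measurable (D j) by apply: measurableD => //; exact: measurableI.
have [J DJ] : exists J, (mu (D J) <= (e / 2)%:E)%E.
  have cD : (mu \o D) x @[x --> \oo] --> mu (\bigcap_j D j).
    apply: nonincreasing_cvg_mu => //.
    - apply: (@le_lt_trans _ _ (mu Q)); last exact: lebesgue_cube_fin.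
      by apply: le_measure; rewrite ?inE// => x [[]].
    - exact: bigcap_measurableType.
    - move=> i j ij; apply/subsetPset => x [QA nB]; split => // Bx; apply: nB.
      exact: (ndB _ _ ij).
  have D0 : \bigcap_j D j = set0.
    apply/seteqP; split => // x h; have [QA _] := h 0%N Logic.I.
    by have [j _ Bx] := AB x QA; have [_] := h j Logic.I.
  apply: contrapT => /forallNP h.
  have : ((e / 2)%:E <= limn (mu \o D))%E.
    apply: lime_ge; first by apply/cvg_ex; eexists; exact: cD.
    by apply: nearW => j; rewrite ltW// ltNge; exact/negP/h.
  by rewrite (cvg_lim _ cD)// D0 measure0 lee_fin leNgt e2.
have [k [V [hV h1 h2]]] := hB J _ e2; have mV := measurable_grid_set hV.
exists k, V; split => //.
- rewrite eE; apply: le_trans (leeD DJ h1).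
  apply: le_trans (measureU2 _ _ _); [|by do ?[apply: measurableD|apply: measurableI]..].
  apply: le_measure; rewrite ?inE; [by do ?[apply: measurableD|apply: measurableI|apply: measurableU]..|].
  move=> x [[Qx Ax] nVx]; have [Bx|nBx] := pselect (B J x); [right|left]; split => //.
- apply: (@le_trans _ _ (mu (V `\` B J))).
    apply: le_measure; rewrite ?inE; [by do ?[apply: measurableD|apply: measurableI|apply: measurableU]..|].
    by move=> x [Vx nAx]; split => // /BA.
  by apply: le_trans h2 _; rewrite lee_fin; lra.
Qed.

(** The cells contained in the half-space exhaust it as the mesh tends to zero. *)
Lemma grid_approx_ray (i : 'I_n) (c : R) : grid_approx [set x : Rn R n | (tnth x i : R) < c].
Proof.
have mray : measurable [set x : Rn R n | (tnth x i : R) < c].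
  rewrite (_ : [set x | _] = (fun x : Rn R n => tnth x i) @^-1` (`]-oo, c[%classic : set R)).
    by rewrite -[X in measurable X]setTI; apply: measurable_tnth.
  by apply/seteqP; split => x /=; rewrite in_itv.
pose B k := [set x | Q x /\ forall y, Q y ->
   (forall j, grid_index k x j = grid_index k y j) -> (tnth y i : R) < c].
have gB k : grid_set k (B k).
  split=> [x []//|x y Qx Qy h [_ hx]]; split => // z Qz hz; apply: hx => // j.
  by rewrite h hz.
apply: (@grid_approx_exhaust _ B) => //.
- by move=> k; exact: measurable_grid_set (gB k).
- by move=> k x [Qx]; exact.
- move=> k j kj x [Qx hx]; split => // y Qy hy; apply: hx => // p.
  exact: (grid_index_refine kj).
- move=> x [Qx xc]; have xc0 : 0 < c - (tnth x i : R) by rewrite subr_gt0.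
  have [k kx] : exists k : nat, l / (c - (tnth x i : R)) < 2 ^+ k.
    exists (Num.truncn (l / (c - (tnth x i : R)))).+1.
    have lc0 : 0 <= l / (c - (tnth x i : R)) by rewrite divr_ge0 ?ltW.
    have /andP[_ h] := truncn_itv lc0; apply: lt_trans h _.
    by rewrite -natrX ltr_nat ltn_expl.
  exists k => //; split => // y Qy /(_ i) h.
  have /andP[_ hx1] := truncn_itv (grid_coord_ge0 k i Qx).
  have /andP[hx _] := truncn_itv (grid_coord_ge0 k i Qx).
  have /andP[_ hy] := truncn_itv (grid_coord_ge0 k i Qy).
  have e0 : 0 < 2 ^+ k :> R by rewrite exprn_gt0.
  rewrite -/(grid_index k x i) in hx; rewrite -/(grid_index k y i) -h in hy.
  have : 2 ^+ k * ((tnth y i : R) - tnth a i) / l - 2 ^+ k * ((tnth x i : R) - tnth a i) / l < 1.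
    by move: hx hy; rewrite -natr1; lra.
  have -> : 2 ^+ k * ((tnth y i : R) - tnth a i) / l - 2 ^+ k * ((tnth x i : R) - tnth a i) / l
     = 2 ^+ k * ((tnth y i : R) - tnth x i) / l by ring.
  rewrite ltr_pdivrMr// mul1r mulrC -ltr_pdivlMr// => yx.
  have : l / 2 ^+ k < c - (tnth x i : R).
    by rewrite ltr_pdivrMr// mulrC -ltr_pdivrMr.
  lra.
- move=> k e e0; exists k, (B k); split; [exact: gB| |].
    by rewrite (_ : _ `\` _ = set0) ?measure0 ?lee_fin ?ltW//; apply/seteqP; split => // x [[_]].
  by rewrite setDv measure0 lee_fin ltW.
Qed.

(** Approximable measurable sets form a sigma-algebra, and half-spaces bounded by
coordinate hyperplanes generate the Borel sets. *)
Lemma measurable_grid_approx A : measurable A -> grid_approx A.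
Proof.
pose G := [set A | measurable A /\ grid_approx A].
have sG : sigma_algebra setT G.
  have GC A' : G A' -> G (~` A').
    by move=> [mA hA]; split; [exact: measurableC|exact: grid_approxC].
  have G0 : G set0.
    split => // e e0; exists 0%N, set0; split.
    - by split.
    - by rewrite setI0 set0D measure0 lee_fin ltW.
    - by rewrite set0D measure0 lee_fin ltW.
  split => //.
  - by move=> A' GA; rewrite setTD; exact: GC.
  - move=> F GF; have mF : measurable (\bigcup_k F k).
      by apply: bigcupT_measurable => k; exact: (GF k).1.
    split => //; pose B j := \big[setU/set0]_(k < j) F k.
    have GB j : G (B j).
      elim: j => [|j IH]; rewrite /B; first by rewrite big_ord0.
      rewrite big_ord_recr/=; split.
        by apply: measurableU; [exact: IH.1|exact: (GF j).1].
      by apply: grid_approxU; [exact: IH.1|exact: (GF j).1|exact: IH.2|exact: (GF j).2].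
    apply: (@grid_approx_exhaust _ B) => //.
    + by move=> j; exact: (GB j).1.
    + by move=> j x; rewrite /B -bigcup_mkord => -[k _ Fx]; exists k.
    + move=> i j ij x; rewrite /B -!bigcup_mkord => -[k /= ki Fx]; exists k => //=.
      exact: leq_trans ki ij.
    + move=> x [_ [k _ Fx]]; exists k.+1 => //; rewrite /B -bigcup_mkord.
      by exists k => /=.
    + by move=> j; exact: (GB j).2.
move=> mA; suff : G A by case.
move: A mA; apply: smallest_sub => //.
rewrite -bigcup_seq => Y [i _ [S mS <-]]; rewrite setTI.
pose H := [set S : set R | G ((fun x : Rn R n => tnth x i) @^-1` S)].
suff sub : (ocitv (R:=R)).-sigma.-measurable `<=` H by exact: (sub S mS).
rewrite RGenInftyO.measurableE.
apply: smallest_sub.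
  have [G0 GC GU] := sG; split.
  - by rewrite /H/= preimage_set0.
  - by move=> S' HS; rewrite /H/= setTD preimage_setC -setTD; exact: GC.
  - by move=> F HF; rewrite /H/= preimage_bigcup; exact: GU.
move=> _ [c ->]; rewrite /H /=.
rewrite (_ : _ @^-1` _ = [set x : Rn R n | (tnth x i : R) < c]).
  split; last exact: grid_approx_ray.
  rewrite (_ : [set x | _] = (fun x : Rn R n => tnth x i) @^-1` (`]-oo, c[%classic : set R)).
    by rewrite -[X in measurable X]setTI; apply: measurable_tnth.
  by apply/seteqP; split => x /=; rewrite in_itv.
by apply/seteqP; split => x /=; rewrite in_itv.
Qed.

End grid.

(** * Covering by cubes *)

Section volume.
Context {R : realType} {n : nat}.
Local Notation mu := (@lebesgue_Rn R n).
Implicit Types (A B : set (Rn R n)).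

Definition vol A : R := fine (mu A).

Lemma volE A : (mu A < +oo)%E -> mu A = (vol A)%:E.
Proof. by move=> fA; rewrite /vol fineK// ge0_fin_numE. Qed.

Lemma vol_ge0 A : 0 <= vol A.
Proof. exact: fine_ge0. Qed.

Lemma mu_fin_sub A B : measurable A -> measurable B -> A `<=` B ->
  (mu B < +oo)%E -> (mu A < +oo)%E.
Proof. by move=> mA mB AB; apply: le_lt_trans; apply: le_measure; rewrite ?inE. Qed.

Lemma mu_finD A B : measurable A -> measurable B -> (mu A < +oo)%E ->
  (mu (A `\` B) < +oo)%E.
Proof. by move=> mA mB; apply: mu_fin_sub => //; exact: measurableD. Qed.

Lemma vol_le A B : measurable A -> measurable B -> A `<=` B ->
  (mu B < +oo)%E -> vol A <= vol B.
Proof.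
move=> mA mB AB fB; have fA := mu_fin_sub mA mB AB fB.
by rewrite -lee_fin -!volE//; apply: le_measure; rewrite ?inE.
Qed.

Lemma vol_split A B : measurable A -> measurable B -> (mu A < +oo)%E ->
  vol A = vol (A `&` B) + vol (A `\` B).
Proof.
move=> mA mB fA.
have mI := measurableI _ _ mA mB; have mD := measurableD mA mB.
have fI : (mu (A `&` B) < +oo)%E by apply: mu_fin_sub fA => // x [].
have fD : (mu (A `\` B) < +oo)%E by apply: mu_fin_sub fA => // x [].
apply: EFin_inj; rewrite EFinD -!volE// -measureU//.
  by rewrite setUIDK.
by apply/seteqP; split => // x [[_ Bx] [_]].
Qed.

Lemma vol_cube (a : Rn R n) (l : R) : 0 <= l -> vol (cube a l) = l ^+ n.
Proof. by move=> l0; rewrite /vol lebesgue_cube. Qed.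

(** A cube is coded by its lowest corner and its side. *)
Definition cb (c : Rn R n * R) : set (Rn R n) := cube c.1 c.2.

Definition cubes_union (s : seq (Rn R n * R)) : set (Rn R n) :=
  [set x | exists2 c, c \in s & cb c x].

Definition inside (c q : Rn R n * R) := forall i : 'I_n,
  (tnth q.1 i : R) <= tnth c.1 i /\ (tnth c.1 i : R) + c.2 <= (tnth q.1 i : R) + q.2.

Lemma vol_cb_gt0 c : 0 < c.2 -> 0 < vol (cb c).
Proof. by move=> c0; rewrite vol_cube ?exprn_gt0// ltW. Qed.

Lemma measurable_cb c : measurable (cb c).
Proof. exact: measurable_cube. Qed.

Lemma cb_fin c : (mu (cb c) < +oo)%E.
Proof. exact: lebesgue_cube_fin. Qed.

Lemma measurable_cubes_union s : measurable (cubes_union s).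
Proof. by apply: measurable_bigcup_seq => c _; exact: measurable_cb. Qed.

Lemma cubes_union_fin s : (mu (cubes_union s) < +oo)%E.
Proof.
apply: le_lt_trans (measure_bigcup_seq_le _ _) _; first by move=> c _; exact: measurable_cb.
by apply: lte_sum_pinfty => c _; exact: cb_fin.
Qed.

Lemma inside_sub c q : inside c q -> cb c `<=` cb q.
Proof.
move=> cq x /cubeP h; apply/cubeP => i; have [h1 h2] := cq i; have /andP[h3 h4] := h i.
by rewrite (le_trans h1)//= (lt_le_trans h4).
Qed.

Lemma cb_fin_sub A c : measurable A -> A `<=` cb c -> (mu A < +oo)%E.
Proof. by move=> mA Ac; exact: mu_fin_sub mA (measurable_cb c) Ac (cb_fin c). Qed.

(** Vitali's covering argument for finitely many cubes: repeatedly select the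
largest remaining cube and discard the cubes that meet it. *)
Lemma vitali_cubes (s : seq (Rn R n * R)) : (forall c, c \in s -> 0 < c.2) ->
  exists t, [/\ uniq t, {subset t <= s},
    forall c c', c \in t -> c' \in t -> cb c `&` cb c' !=set0 -> c = c' &
    vol (cubes_union s) <= 3 ^+ n * \sum_(c <- t) vol (cb c)].
Proof.
have [m] := ubnP (size s); elim: m s => // m IH s sm spos.
have [s0|[c0 c0s c0max]] : s = [::] \/ exists2 c0, c0 \in s & forall c, c \in s -> c.2 <= c0.2.
  case: s {sm spos IH} => [|c s]; [by left|right].
  elim: s c => [|c' s IH] c; first by exists c => [|d]; rewrite ?mem_head// inE => /eqP ->.
  have [d ds dmax] := IH c'; have [cd|dc] := leP c.2 d.2.
    exists d; first by rewrite in_cons ds orbT.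
    by move=> e; rewrite in_cons => /predU1P[->//|]; exact: dmax.
  exists c; first by rewrite mem_head.
  move=> e; rewrite in_cons => /predU1P[->//|/dmax h].
  by rewrite (le_trans h)// ltW.
  exists [::]; split => //; rewrite s0 big_nil mulr0.
  rewrite (_ : cubes_union _ = set0) ?/vol ?measure0//.
  by apply/seteqP; split => // x [].
have c0pos := spos _ c0s.
have c0self : cb c0 c0.1 by apply/cubeP => i; rewrite lexx/= ltrDl.
pose s' := [seq c <- s | ~~ `[< cb c `&` cb c0 !=set0 >]].
have s's : {subset s' <= s} by move=> c; rewrite mem_filter => /andP[].
have s'm : (size s' < m)%N.
  rewrite ltnS in sm; apply: leq_trans sm; rewrite size_filter -(count_predC (fun c => `[< cb c `&` cb c0 !=set0 >]) s).
  rewrite -addn1 addnC leq_add2r -has_count; apply/hasP; exists c0 => //.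
  by apply/asboolP; exists c0.1.
have [t [ut ts dt tv]] := IH s' s'm (fun c cs => spos c (s's c cs)).
have dis c : c \in t -> ~ (cb c `&` cb c0 !=set0).
  by move=> /ts; rewrite mem_filter => /andP[/asboolPn].
have c0t : c0 \notin t.
  by apply/negP => /dis; apply; exists c0.1.
exists (c0 :: t); split.
- by rewrite /= c0t.
- by move=> c; rewrite in_cons => /predU1P[->//|/ts/s's].
- move=> c c'; rewrite !in_cons => /predU1P[->|ct] /predU1P[->|c't]//.
  + by rewrite setIC => /(dis _ c't).
  + by move=> /(dis _ ct).
  + exact: dt.
pose b3 : Rn R n * R := ([tuple (tnth c0.1 i : R) - c0.2 | i < n], 3 * c0.2).
have sub : cubes_union s `<=` cb b3 `|` cubes_union s'.
  move=> x [c cs cx]; have [h|h] := pselect (cb c `&` cb c0 !=set0); last first.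
    by right; exists c => //; rewrite mem_filter cs andbT; exact/asboolPn.
  left; have [z [/cubeP zc /cubeP z0]] := h.
  apply/cubeP => i; rewrite tnth_mktuple.
  have /cubeP/(_ i)/andP[x1 x2] := cx; have /andP[z1 z2] := zc i; have /andP[z3 z4] := z0 i.
  have := c0max _ cs => /= cc0; apply/andP; split; lra.
have mb3 := measurable_cb b3; have ms' := measurable_cubes_union s'.
have fb3 := cb_fin b3; have fs' := cubes_union_fin s'.
have volU : vol (cubes_union s) <= vol (cb b3) + vol (cubes_union s').
  rewrite -lee_fin EFinD -!volE//; last exact: cubes_union_fin.
  apply: le_trans (measureU2 _ mb3 ms').
  apply: le_measure; rewrite ?inE//; first exact: measurable_cubes_union.
  exact: measurableU.
apply: le_trans volU _; rewrite big_cons mulrDr lerD//.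
by rewrite !vol_cube/= ?exprMn// ?ltW// mulr_gt0.
Qed.

End volume.

(** * Growth of density *)

Section growth.
Context {R : realType} {n : nat}.
Hypothesis n_gt0 : (0 < n)%N.
Local Notation mu := (@lebesgue_Rn R n).
Implicit Types (E : set (Rn R n)) (c q : Rn R n * R).

(** Approximate [E] by a union of cells.  The cells of low density lie largely
outside [E], so their total volume is controlled by the measure of the part of the
approximation outside [E]. *)
Lemma dense_cells E q (eta : R) : 0 < q.2 -> measurable E -> E `<=` cb q ->
  0 < vol E -> 0 < eta < 1 ->
  exists s : seq (Rn R n * R),
   (forall c, c \in s -> [/\ 0 < c.2, c.2 <= q.2, inside c q &
      (1 - eta) * vol (cb c) <= vol (E `&` cb c)]) /\
   (1 - eta) * vol E <= vol (E `&` cubes_union s).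
Proof.
case: q => a l /= l0 mE EQ E0 /andP[eta0 eta1].
pose e := eta * vol E / (1 + eta^-1).
have ei0 : 0 < 1 + eta^-1 by rewrite addr_gt0// invr_gt0.
have e0 : 0 < e by rewrite divr_gt0// mulr_gt0.
have [k [V [gV h1 h2]]] := measurable_grid_approx a l0 mE e0.
have [VQ _] := gV; have mV := measurable_grid_set l0 gV.
pose U (m : {ffun 'I_n -> 'I_(2 ^ k)}) := grid_cell a l k (fun i => m i).
have mU m : measurable (U m) by exact: measurable_cube.
have UQ m : U m `<=` cb (a, l).
  by apply: (grid_cell_sub l0) => i; exact: ltn_ord.
have fU m : (mu (U m) < +oo)%E by exact: cb_fin_sub (UQ m).
pose bad := [seq m <- cells_of a l k V | vol (E `&` U m) < (1 - eta) * vol (U m)].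
pose good := [seq m <- cells_of a l k V | (1 - eta) * vol (U m) <= vol (E `&` U m)].
pose code (m : {ffun 'I_n -> 'I_(2 ^ k)}) : Rn R n * R :=
  ([tuple (tnth a i : R) + l * (m i)%:R / 2 ^+ k | i < n], l / 2 ^+ k).
have ek : 0 < 2 ^+ k :> R by rewrite exprn_gt0.
have fE : (mu E < +oo)%E by exact: cb_fin_sub mE EQ.
exists [seq code m | m <- good]; split.
  move=> _ /mapP[m + ->]; rewrite mem_filter => /andP[mgood _]; split => //=.
  - by rewrite divr_gt0.
  - by rewrite ler_pdivrMr// ler_peMr ?(ltW l0)// exprn_ege1// ler1n.
  - move=> i /=; rewrite tnth_mktuple.
    have mi : (m i).+1%:R <= 2 ^+ k :> R by rewrite -natrX ler_nat ltn_ord.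
    have g1 : 0 <= l * (m i)%:R / 2 ^+ k by rewrite divr_ge0 ?mulr_ge0 ?(ltW l0) ?(ltW ek).
    have g2 : l * (m i)%:R / 2 ^+ k + l / 2 ^+ k <= l.
      by rewrite -mulrDl -[X in _ + X]mulr1 -mulrDr natr1 ler_pdivrMr// ler_pM2l.
    by split; lra.
set G := cubes_union _.
have mG : measurable G by exact: measurable_cubes_union.
have GE : G = [set x | exists2 m, m \in good & U m x].
  apply/seteqP; split => x.
    by move=> [_ /mapP[m mg ->] mx]; exists m.
  by move=> [m mg mx]; exists (code m) => //; apply/mapP; exists m.
pose B := [set x | exists2 m, m \in bad & U m x].
have mB : measurable B by apply: measurable_bigcup_seq.
have BQ : B `<=` cb (a, l) by move=> x [m _ /UQ].
have ubad : uniq bad by rewrite filter_uniq// filter_uniq// enum_uniq.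
have bad_sum : vol B <= eta^-1 * e.
  rewrite -lee_fin -volE; last exact: cb_fin_sub BQ.
  apply: le_trans (measure_bigcup_seq_le mu (fun m _ => mU m)) _.
  apply: (@le_trans _ _ (\sum_(m <- bad) (eta^-1)%:E * mu (U m `\` E))%E).
    rewrite big_seq [leRHS]big_seq; apply: lee_sum => m.
    rewrite mem_filter => /andP[mbad _].
    have fUE : (mu (U m `\` E) < +oo)%E.
      by exact: mu_finD.
    suff : ((vol (U m))%:E <= (eta^-1)%:E * (vol (U m `\` E))%:E)%E.
      by rewrite -(volE (fU m)) -(volE fUE); exact.
    rewrite -EFinM lee_fin mulrC ler_pdivlMr//.
    have := vol_split (mU m) mE (fU m); rewrite setIC; move: mbad; lra.
  rewrite -ge0_sume_distrr; last by move=> m _; exact: measure_ge0.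
  have mUE m : measurable (U m `\` E) by exact: measurableD.
  have dUE m p : m \in bad -> p \in bad -> (U m `\` E) `&` (U p `\` E) !=set0 -> m = p.
    by move=> _ _ [x [[mx _] [px _]]]; exact: (grid_cell_inj l0 (ex_intro _ x (conj mx px))).
  rewrite -(measure_bigcup_seq mu ubad (fun m _ => mUE m) dUE).
  rewrite EFinM lee_wpmul2l ?lee_fin ?invr_ge0 ?(ltW eta0)//.
  apply: le_trans h2; apply: le_measure; rewrite ?inE.
  - by apply: measurable_bigcup_seq => m _; exact: measurableD.
  - exact: measurableD.
  - move=> x [m]; rewrite mem_filter => /andP[_ mc] [mx nEx]; split => //.
    by rewrite (grid_setE l0 gV); exists m.
have EV : vol (E `\` V) <= e.
  have fEV : (mu (E `\` V) < +oo)%E.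
    by exact: mu_finD.
  rewrite -lee_fin -volE//; apply: le_trans h1; apply: le_measure; rewrite ?inE.
  - exact: measurableD.
  - by apply: measurableD => //; apply: measurableI => //; exact: measurable_cube.
  - by move=> x [Ex nV]; split => //; split => //; exact: EQ.
have EG : E `\` G `<=` (E `\` V) `|` B.
  move=> x [Ex nG]; have [Vx|nVx] := pselect (V x); last by left.
  right; move: Vx; rewrite (grid_setE l0 gV) => -[m mc mx].
  have [good_m|bad_m] := leP ((1 - eta) * vol (U m)) (vol (E `&` U m)).
    by exfalso; apply: nG; rewrite GE; exists m => //; rewrite mem_filter good_m.
  by exists m => //; rewrite mem_filter bad_m.
have mEG := measurableD mE mG; have mEV := measurableD mE mV.
have fEV : (mu (E `\` V) < +oo)%E by exact: mu_finD.
have fB : (mu B < +oo)%E by exact: cb_fin_sub BQ.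
have volEG : vol (E `\` G) <= e + eta^-1 * e.
  apply: (@le_trans _ _ (vol (E `\` V) + vol B)); last by rewrite lerD.
  have fEG : (mu (E `\` G) < +oo)%E by exact: mu_finD.
  rewrite -lee_fin EFinD -!volE//.
  apply: le_trans (measureU2 _ mEV mB); apply: le_measure; rewrite ?inE//.
  exact: measurableU.
have -> : (1 - eta) * vol E = vol E - (e + eta^-1 * e).
  have -> : e + eta^-1 * e = eta * vol E.
    by rewrite -[X in X + _]mul1r -mulrDl mulrC /e divfK ?gt_eqF.
  by rewrite mulrBl mul1r.
by rewrite (vol_split mE mG fE); lra.
Qed.

(** Interpolate between [c] and [q] in steps that multiply the volume by at most
[th / lam].  The density cannot fall from above [th] to below [lam] in one step, so
the first cube in which it is at most [th] lies in the window. *)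
Lemma density_window E c q (lam th : R) : measurable E -> 0 < lam -> lam < th ->
  0 < c.2 -> c.2 <= q.2 -> inside c q ->
  th * vol (cb c) < vol (E `&` cb c) -> vol (E `&` cb q) <= th * vol (cb q) ->
  exists d, [/\ 0 < d.2, inside c d, inside d q,
    lam * vol (cb d) < vol (E `&` cb d) & vol (E `&` cb d) <= th * vol (cb d)].
Proof.
move=> mE lam0 lth c0 cq incq hc hq.
have th0 : 0 < th by exact: lt_trans lth.
pose rho := (th / lam) `^ n%:R^-1.
have rhoX : rho ^+ n = th / lam by rewrite pow_rootK// divr_ge0// ltW.
have rho1 : 1 < rho.
  have r0 : 0 <= rho by exact: powR_ge0.
  by rewrite -(@expr_gt1 _ n)// rhoX ltr_pdivlMr// mul1r.
pose N := (Num.truncn ((q.2 - c.2) / ((rho - 1) * c.2))).+1.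
have N0 : 0 < N%:R :> R by rewrite ltr0n.
have stepN : (q.2 - c.2) / N%:R <= (rho - 1) * c.2.
  have rc : 0 < (rho - 1) * c.2 by rewrite mulr_gt0// subr_gt0.
  rewrite ler_pdivrMr// mulrC -ler_pdivrMr// ltW//.
  by apply: truncnS_gt; rewrite divr_ge0 ?subr_ge0// ltW.
pose t (j : nat) : R := j%:R / N%:R.
pose d (j : nat) : Rn R n * R :=
  ([tuple (1 - t j) * (tnth c.1 i : R) + t j * tnth q.1 i | i < n],
   (1 - t j) * c.2 + t j * q.2).
have d0 : d 0%N = c.
  rewrite /d /t mul0r subr0 !mul1r mul0r addr0 [RHS]surjective_pairing; congr pair.
  by apply: eq_from_tnth => i; rewrite tnth_mktuple mul1r mul0r addr0.
have dN : d N = q.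
  rewrite /d /t divff ?gt_eqF// subrr !mul0r mul1r add0r [RHS]surjective_pairing; congr pair.
  by apply: eq_from_tnth => i; rewrite tnth_mktuple mul0r mul1r add0r.
have ex_th : exists j, vol (E `&` cb (d j)) <= th * vol (cb (d j)) by exists N; rewrite dN.
have [j hj minj] := ex_minnP ex_th.
have jN : (j <= N)%N by apply: minj; rewrite dN.
have j0 : (0 < j)%N.
  by rewrite lt0n; apply/eqP => j0; move: hj; rewrite j0 d0 leNgt hc.
have t01 i : (i <= N)%N -> 0 <= t i <= 1.
  by move=> iN; rewrite divr_ge0//= ler_pdivrMr// mul1r ler_nat.
have mono i i' : (i <= i')%N -> (i' <= N)%N -> inside (d i) (d i').
  move=> ii' i'N p /=; rewrite !tnth_mktuple; have [h1 h2] := incq p.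
  have : 0 <= t i' - t i by rewrite -mulrBl divr_ge0// subr_ge0 ler_nat.
  move=> tt; have k1 : 0 <= (t i' - t i) * ((tnth c.1 p : R) - tnth q.1 p).
    by rewrite mulr_ge0// subr_ge0.
  have k2 : 0 <= (t i' - t i) * ((tnth q.1 p : R) + q.2 - ((tnth c.1 p : R) + c.2)).
    by rewrite mulr_ge0// subr_ge0.
  split.
  - rewrite -subr_ge0; apply: le_trans k1 _; rewrite le_eqVlt; apply/orP; left.
    by apply/eqP; ring.
  - rewrite -subr_ge0; apply: le_trans k2 _; rewrite le_eqVlt; apply/orP; left.
    by apply/eqP; ring.
have side_ge i : (i <= N)%N -> c.2 <= (d i).2.
  move=> /t01/andP[h1 h2] /=; rewrite -subr_ge0.
  have -> : (1 - t i) * c.2 + t i * q.2 - c.2 = t i * (q.2 - c.2) by ring.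
  by rewrite mulr_ge0// subr_ge0.
have jpN : (j.-1 <= N)%N by rewrite (leq_trans (leq_pred j)).
have side_j : 0 < (d j).2 by exact: lt_le_trans (side_ge _ jN).
have side_jp : 0 < (d j.-1).2 by exact: lt_le_trans (side_ge _ jpN).
exists (d j); split => //.
- by rewrite -[X in inside X]d0; exact: mono.
- by rewrite -[X in inside _ X]dN; exact: mono.
have hjp : th * vol (cb (d j.-1)) < vol (E `&` cb (d j.-1)).
  rewrite ltNge; apply/negP => /minj; by rewrite leqNgt prednK// leqnn.
have sub := inside_sub (mono _ _ (leq_pred j) jN).
have mEc p : measurable (E `&` cb p) by apply: measurableI => //; exact: measurable_cb.
apply: (@lt_le_trans _ _ (vol (E `&` cb (d j.-1)))); last first.
  apply: vol_le => //; first by move=> x [Ex /sub].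
  by apply: cb_fin_sub => // x [].
apply: le_lt_trans hjp.
rewrite !vol_cube ?(ltW side_j) ?(ltW side_jp)//.
have side_ratio : (d j).2 <= rho * (d j.-1).2.
  have -> : (d j).2 = (d j.-1).2 + (q.2 - c.2) / N%:R.
    rewrite /d /=; have -> : t j = t j.-1 + N%:R^-1.
      by rewrite /t -[in LHS](prednK j0) -natr1 mulrDl mul1r.
    by ring.
  apply: (@le_trans _ _ ((d j.-1).2 + (rho - 1) * (d j.-1).2)); last by rewrite mulrBl mul1r addrC subrK.
  by rewrite lerD2l (le_trans stepN)// ler_wpM2l ?side_ge// subr_ge0 ltW.
have : (d j).2 ^+ n <= (rho * (d j.-1).2) ^+ n.
  by rewrite lerXn2r ?nnegrE ?(ltW side_j)// mulr_ge0 ?(ltW side_jp)// powR_ge0.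
rewrite exprMn rhoX => h; apply: le_trans (ler_wpM2l (ltW lam0) h) _.
by rewrite mulrA mulrCA mulrV ?mulr1// unitfE gt_eqF.
Qed.

Definition density_grows (lam g : R) := forall E q, measurable E -> 0 < q.2 ->
  0 < vol (E `&` cb q) -> vol (E `&` cb q) <= lam * vol (cb q) ->
  exists s : seq (Rn R n * R),
   (forall c, c \in s -> [/\ 0 < c.2, inside c q & lam * vol (cb c) < vol (E `&` cb c)]) /\
   g * vol (E `&` cb q) <= vol (cubes_union s).

(** Enlarge cells in which [E] is dense until the density lies between [lam] and a
larger [th] below one.  The enlarged cubes still cover almost all of [E], and by
Vitali's covering argument a fixed proportion of their union lies outside [E]. *)
Lemma density_growth (lam : R) : 0 < lam < 1 ->
  exists2 g : R, 1 < g & density_grows lam g.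
Proof.
move=> /andP[lam0 lam1]; pose th := (1 + lam) / 2.
have lth : lam < th by rewrite /th; lra.
have th1 : th < 1 by rewrite /th; lra.
have th0 : 0 < th by exact: lt_trans lth.
(* The proportion of the union of the enlarged cubes that lies outside [E]. *)
pose g := (1 - th) / 3 ^+ n.
have p3 : 0 < 3 ^+ n :> R by rewrite exprn_gt0.
have g0 : 0 < g by rewrite divr_gt0// subr_gt0.
have g1 : g <= 1 - th.
  by rewrite ler_pdivrMr// ler_peMr ?subr_ge0 ?(ltW th1)// exprn_ege1// ler1n.
exists (1 + g / 2); first by rewrite ltrDl divr_gt0.
move=> E0 q mE0 q0 E0pos E0lam; set E := E0 `&` cb q in E0pos E0lam *.
have mE : measurable E by apply: measurableI => //; exact: measurable_cb.
have EQ : E `<=` cb q by move=> x [].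
have fE : (mu E < +oo)%E by exact: cb_fin_sub EQ.
have eta01 : 0 < g / 4 < 1 by apply/andP; split; lra.
have [s [hs Es]] := dense_cells q0 mE EQ E0pos eta01.
have EqE c : inside c q -> E0 `&` cb c = E `&` cb c.
  move=> /inside_sub cq; apply/seteqP; split => x [].
    by move=> Ex cx; split => //; split => //; exact: cq.
  by move=> [Ex _] cx; split.
have /choice[f hf] : forall c, exists d, c \in s ->
    [/\ 0 < d.2, inside c d, inside d q,
      lam * vol (cb d) < vol (E `&` cb d) & vol (E `&` cb d) <= th * vol (cb d)].
  move=> c; have [cs|_] := boolP (c \in s); last by exists c.
  have [c0 cq incq hc] := hs c cs.
  have [||d hd] := density_window mE lam0 lth c0 cq incq.
  - apply: lt_le_trans hc; rewrite ltr_pM2r; first by rewrite /th in g1 *; lra.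
    exact: vol_cb_gt0.
  - rewrite setIidl//; apply: le_trans E0lam _; rewrite ler_wpM2r ?vol_ge0//; exact: ltW.
  by exists d.
pose s' := [seq f c | c <- s].
have hs' d : d \in s' -> [/\ 0 < d.2, inside d q,
    lam * vol (cb d) < vol (E `&` cb d) & vol (E `&` cb d) <= th * vol (cb d)].
  by move=> /mapP[c cs ->]; have [? _ ? ? ?] := hf c cs.
exists s'; split.
  by move=> d ds; have [? dq ? _] := hs' d ds; rewrite EqE.
have [t [ut ts dt vt]] := vitali_cubes (fun d ds => let: And4 h _ _ _ := hs' d ds in h).
set W := cubes_union s' in vt *.
have mW : measurable W by exact: measurable_cubes_union.
have fW : (mu W < +oo)%E by exact: cubes_union_fin.
have EW : (1 - g / 4) * vol E <= vol (E `&` W).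
  apply: le_trans Es _; apply: vol_le.
  - by apply: measurableI => //; exact: measurable_cubes_union.
  - exact: measurableI.
  - move=> x [Ex [c cs cx]]; split => //; have [_ icd _ _ _] := hf c cs.
    by exists (f c); [apply/mapP; exists c|exact: inside_sub cx].
  - by apply: mu_fin_sub fE => //; exact: measurableI.
have WE : g * vol W <= vol (W `\` E).
  have mdE d : measurable (cb d `\` E) by apply: measurableD => //; exact: measurable_cb.
  have fdE d : (mu (cb d `\` E) < +oo)%E by apply: cb_fin_sub => // x [].
  have disj : vol [set x | exists2 d, d \in t & (cb d `\` E) x] = \sum_(d <- t) vol (cb d `\` E).
    have dd c d : c \in t -> d \in t -> (cb c `\` E) `&` (cb d `\` E) !=set0 -> c = d.
      by move=> ct dt' [x [[cx _] [dx _]]]; apply: dt => //; exists x.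
    have eU := measure_bigcup_seq mu ut (fun d _ => mdE d) dd.
    rewrite /vol -[RHS]/(fine (\sum_(d <- t) vol (cb d `\` E))%:E).
    congr fine; apply: etrans eU _; rewrite -sumEFin; apply: eq_bigr => d _.
    exact: (volE (fdE d)).
  apply: (@le_trans _ _ (vol [set x | exists2 d, d \in t & (cb d `\` E) x])); last first.
    apply: vol_le => //.
    - exact: measurable_bigcup_seq.
    - exact: measurableD.
    - by move=> x [d dt' [dx nEx]]; split => //; exists d => //; exact: ts.
    - by exact: mu_finD.
  rewrite disj; apply: (@le_trans _ _ ((1 - th) * \sum_(d <- t) vol (cb d))).
    by rewrite /g -mulrA ler_wpM2l ?subr_ge0 ?(ltW th1)// mulrC ler_pdivrMr// mulrC.
  rewrite mulr_sumr big_seq [leRHS]big_seq; apply: ler_sum => d /ts ds.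
  have [d0 _ _ h] := hs' d ds.
  have := vol_split (measurable_cb d) mE (cb_fin d); rewrite setIC; lra.
have := vol_split mW mE fW; rewrite setIC => vW.
have gW : g * ((1 - g / 4) * vol E) <= g * vol W.
  rewrite ler_wpM2l ?(ltW g0)//; apply: le_trans EW _; rewrite vW lerDl vol_ge0//.
have : (1 + g / 2) * vol E <= (1 - g / 4) * vol E + g * ((1 - g / 4) * vol E).
  rewrite -subr_ge0 (_ : _ - _ = g * (1 - g) / 4 * vol E); last by field.
  by rewrite mulr_ge0 ?vol_ge0// divr_ge0// mulr_ge0 ?(ltW g0)// subr_ge0; lra.
lra.
Qed.

End growth.

(** * Self-improvement of bounds for the median maximal operator *)

Section step_functions.
Context {T : Type} {R : realType} {I : eqType}.
Implicit Types (s : seq I) (x : I -> R) (E F : I -> set T).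

Definition step s x E (y : T) : R := \sum_(i <- s) x i * \1_(E i) y.

Definition disjoint_on s E :=
  forall i j y, i \in s -> j \in s -> E i y -> E j y -> i = j.

Lemma step_out s x E y : (forall i, i \in s -> ~ E i y) -> step s x E y = 0.
Proof.
move=> h; rewrite /step big_seq big1// => i /h nE.
by rewrite indicE memNset// mulr0.
Qed.

Lemma step_in s x E i y : uniq s -> disjoint_on s E -> i \in s -> E i y ->
  step s x E y = x i.
Proof.
move=> us dE si Ei; rewrite /step (bigD1_seq i)//= indicE mem_set// mulr1.
rewrite big_seq_cond big1 ?addr0// => j /andP[js ji].
rewrite indicE memNset ?mulr0// => Ej; move/eqP: ji; apply.
exact: (dE j i y).
Qed.

Lemma step_ge0 s x E y : (forall j, j \in s -> 0 <= x j) -> 0 <= step s x E y.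
Proof.
by move=> x0; rewrite /step big_seq sumr_ge0// => i si; rewrite mulr_ge0 ?indic_ge0// x0.
Qed.

End step_functions.

Section step_measurable.
Context d (T : measurableType d) {R : realType} {I : eqType}.

Lemma measurable_step (s : seq I) (x : I -> R) (E : I -> set T) :
  (forall i, i \in s -> measurable (E i)) -> measurable_fun setT (step s x E).
Proof.
move=> mE; rewrite /step; elim: s mE => [|i s IH] mE.
  by rewrite (_ : (fun y => _) = cst 0)//; apply/funext => y; rewrite big_nil.
rewrite (_ : (fun y => _) = fun y => x i * \1_(E i) y + \sum_(j <- s) x j * \1_(E j) y).
  apply: measurable_funD.
    by apply: measurable_funM => //; apply: measurable_indic; apply: mE; rewrite mem_head.
  by apply: IH => j js; apply: mE; rewrite in_cons js orbT.
by apply/funext => y; rewrite big_cons.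
Qed.

End step_measurable.

Lemma expr_unbounded {R : realType} (g M : R) : 1 < g -> exists k, M < g ^+ k.
Proof.
move=> g1; have bern k : 1 + k%:R * (g - 1) <= g ^+ k.
  elim: k => [|k IH]; first by rewrite mul0r addr0.
  have : 0 <= k%:R * (g - 1) ^+ 2 by rewrite mulr_ge0// sqr_ge0.
  have h : g * (1 + k%:R * (g - 1)) <= g ^+ k.+1 by rewrite exprS ler_wpM2l//; lra.
  by move=> h2; apply: le_trans h; rewrite (_ : g * _ = 1 + k.+1%:R * (g - 1) + k%:R * (g - 1) ^+ 2) ?lerDl// -natr1; ring.
have gp : 0 < g - 1 by rewrite subr_gt0.
exists (Num.truncn (`|M| / (g - 1))).+1; apply: lt_le_trans (bern _).
have : `|M| < (Num.truncn (`|M| / (g - 1))).+1%:R * (g - 1).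
  by rewrite -ltr_pdivrMr// truncnS_gt// divr_ge0// ltW.
by have := ler_norm M; lra.
Qed.

Definition spreads {R : realType} {n : nat} (kap : R)
    (Z : function_space (Rn R n) R) (K : R) :=
  forall (I : eqType) (s : seq I) (x : I -> R) (Q : I -> Rn R n * R)
    (E F : I -> set (Rn R n)),
  uniq s -> (forall i, i \in s -> 0 <= x i) -> (forall i, i \in s -> 0 < (Q i).2) ->
  (forall i, i \in s -> measurable (E i)) -> (forall i, i \in s -> measurable (F i)) ->
  (forall i, i \in s -> E i `<=` cb (Q i)) -> (forall i, i \in s -> F i `<=` E i) ->
  disjoint_on s E ->
  (forall i, i \in s -> kap * vol (cb (Q i)) <= vol (F i)) ->
  carrier Z (step s x F) ->
  carrier Z (step s x E) /\ norm Z (step s x E) <= K * norm Z (step s x F).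

(** Boundedness with a named constant, whose powers will be compared with the growth
factor of densities. *)
Definition median_bound {R : realType} {n : nat} (lam : R)
    (Z : function_space (Rn R n) R) (A : R) :=
  forall f : Rn R n -> R, carrier Z f -> exists h, [/\ carrier Z h,
    \forall x \ae (@lebesgue_Rn R n), (h x)%:E = median_maximal lam f x &
    norm Z h <= A * norm Z f].

Section expansion.
Context {R : realType} {n : nat}.
Local Notation mu := (@lebesgue_Rn R n).
Variable lam : R.
Hypothesis lam01 : 0 < lam < 1.
Implicit Types (f h : Rn R n -> R) (c : Rn R n * R).

Lemma measurable_superlevel f (al : R) : measurable_fun setT f ->
  measurable [set x | al <= `|f x|].
Proof.
by move=> mf; apply: measurable_set_le => //; exact: measurableT_comp.
Qed.

Lemma vol_ae_le (A B : set (Rn R n)) : measurable A -> measurable B ->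
  (mu B < +oo)%E -> (\forall x \ae mu, A x -> B x) -> vol A <= vol B.
Proof.
move=> mA mB fB [N [mN N0 sN]].
have mBN : measurable (B `|` N) by exact: measurableU.
have muBN : mu (B `|` N) = mu B.
  apply/eqP; rewrite eq_le; apply/andP; split.
    have : (mu (B `|` N) <= mu B + mu N)%E by exact: measureU2.
    by rewrite (N0 : mu N = 0%E) adde0.
  by apply: le_measure; rewrite ?inE//; exact: subsetUl.
have -> : vol B = vol (B `|` N) by rewrite /vol muBN.
apply: vol_le => //; last by rewrite muBN.
move=> x Ax; have [Bx|nBx] := pselect (B x); first by left.
by right; apply: sN => /= /(_ Ax).
Qed.

Lemma median_maximal_ge f c (al : R) x : measurable_fun setT f -> 0 < c.2 ->
  cb c x -> lam * vol (cb c) < vol (cb c `&` [set y | al <= `|f y|]) ->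
  (al%:E <= median_maximal lam f x)%E.
Proof.
move=> mf c0 cx hc.
apply: (@le_trans _ _ (rearrangement mu (f \* \1_(cb c)) (lam%:E * mu (cb c))%E)); last first.
  by apply: ereal_sup_ubound; exists (cb c) => //; split => //; exists c.1, c.2.
apply: le_ereal_inf_tmp => _ [b [b0 hb] <-]; rewrite lee_fin leNgt; apply/negP => ba.
have mA := measurable_superlevel al mf.
set D := cb c `&` [set y | al <= `|f y|] in hc.
have mD : measurable D by apply: measurableI => //; exact: measurable_cb.
have Dc : D `<=` cb c by move=> y [].
have fD := cb_fin_sub mD Dc.
have : (mu D <= lam%:E * mu (cb c))%E.
  apply: le_trans hb; apply: le_measure; rewrite ?inE//.
    apply: measurable_set_lt => //; apply: measurableT_comp => //.
    by apply: measurable_funM => //; apply: measurable_indic; exact: measurable_cb.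
  move=> y [cy /= ay]; rewrite indicE mem_set// mulr1; exact: lt_le_trans ba ay.
by rewrite (volE fD) (volE (cb_fin c)) -EFinM lee_fin leNgt hc.
Qed.

Variable g : R.
Hypothesis g1 : 1 < g.
Hypothesis growth : @density_grows R n lam g.

Variable Z : function_space (Rn R n) R.
Hypothesis HZ : is_Banach_function_space mu Z.
Variable A : R.
Hypothesis A0 : 0 < A.
Hypothesis mZ : median_bound lam Z A.

(** When the density of a level set in [c] is too small for the median maximal
operator, the cubes supplied by [density_grows] lie in the corresponding level set of
the first iterate, whose density in [c] is therefore larger by the factor [g]. *)
Lemma median_expansion k f : carrier Z f -> exists h,
  [/\ carrier Z h, norm Z h <= A ^+ k.+1 * norm Z f &
   forall c (al : R), 0 < c.2 -> 0 < al ->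
     lam * g ^- k * vol (cb c) < vol (cb c `&` [set x | al <= `|f x|]) ->
     \forall x \ae mu, cb c x -> al <= h x].
Proof.
have /andP[lam0 lam1] := lam01.
have g0 : 0 < g by exact: lt_trans g1.
elim: k f => [|k IH] f Zf; have [h1 [Zh1 eh1 Nh1]] := mZ Zf.
  exists h1; split => //.
  move=> c al c0 al0; rewrite expr0 invr1 mulr1 => hc.
  move: eh1; apply: filterS => x hx cx.
  by rewrite -lee_fin hx; exact: (median_maximal_ge (bfs_measurable HZ Zf) c0 cx hc).
have [h [Zh Nh Hh]] := IH _ Zh1; exists h; split; first exact: Zh.
  by apply: le_trans Nh _; rewrite [A ^+ k.+2]exprSr -mulrA ler_wpM2l// exprn_ge0// ltW.
move=> c al c0 al0 hc; apply: (Hh c al c0 al0).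
have mf := bfs_measurable HZ Zf; have mh1 := bfs_measurable HZ Zh1.
set E := [set x | al <= `|f x|] in hc.
have mE : measurable E by exact: measurable_superlevel.
set E1 := [set x | al <= `|h1 x|]; have mE1 : measurable E1 by exact: measurable_superlevel.
have mcE1 : measurable (cb c `&` E1) by apply: measurableI => //; exact: measurable_cb.
have fcE1 : (mu (cb c `&` E1) < +oo)%E by apply: cb_fin_sub => // x [].
have vc0 := vol_cb_gt0 c0.
have up d : 0 < d.2 -> lam * vol (cb d) < vol (cb d `&` E) ->
    \forall x \ae mu, cb d x -> E1 x.
  move=> d0 hd; move: eh1; apply: filterS => x hx dx.
  rewrite /E1/=; apply: le_trans (ler_norm _); rewrite -lee_fin hx.
  exact: (median_maximal_ge mf d0 dx hd).
have [dense|sparse] := ltP (lam * vol (cb c)) (vol (cb c `&` E)).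
  apply: (@lt_le_trans _ _ (vol (cb c))).
    rewrite -[ltRHS]mul1r ltr_pM2r//; apply: le_lt_trans lam1.
    by rewrite ler_piMr ?(ltW lam0)// invf_le1 ?exprn_gt0// exprn_ege1// ltW.
  apply: vol_ae_le => //; first exact: measurable_cb.
  by move: (up _ c0 dense); apply: filterS => x h' cx; split => //; exact: h'.
have vE0 : 0 < vol (cb c `&` E).
  by apply: le_lt_trans hc; rewrite mulr_ge0 ?vol_ge0// mulr_ge0 ?(ltW lam0)// invr_ge0 exprn_ge0// ltW.
have [s [hs gs]] : exists s : seq (Rn R n * R),
   (forall d, d \in s -> [/\ 0 < d.2, inside d c & lam * vol (cb d) < vol (E `&` cb d)]) /\
   g * vol (E `&` cb c) <= vol (cubes_union s).
  by apply: growth => //; rewrite setIC.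
apply: (@lt_le_trans _ _ (vol (cubes_union s))).
  apply: lt_le_trans gs; rewrite setIC -ltr_pdivrMl//.
  by rewrite mulrA (_ : g^-1 * _ = lam * g ^- k.+1)// exprS invfM; ring.
apply: vol_ae_le => //; first exact: measurable_cubes_union.
have : \forall x \ae mu, forall d, d \in s -> cb d x -> E1 x.
  elim: s hs {gs} => [|d s IHs] hs; first exact: aeW.
  have [d0 _ dd] := hs d (mem_head _ _).
  have hd := up d d0 _; rewrite setIC in hd.
  have h' := IHs (fun e es => hs e (@mem_behead _ (d :: s) e es)).
  by apply: filterS2 (hd dd) h' => x hx hx' e; rewrite in_cons => /predU1P[->//|]; exact: hx'.
apply: filterS => x hx [d ds dx]; split; last exact: (hx d ds dx).
by have [_ dc _] := hs d ds; exact: inside_sub dx.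
Qed.

Lemma threshold_exists (kap : R) : 0 < kap -> exists k, lam * g ^- k < kap.
Proof.
have /andP[lam0 lam1] := lam01; move=> kap0; have [k hk] := @expr_unbounded R g (lam / kap) g1.
exists k; rewrite ltr_pdivrMr ?exprn_gt0 ?(lt_trans _ g1)//.
by move: hk; rewrite ltr_pdivrMr// mulrC.
Qed.

(** Saturation gives the indicator of some part of the cube, and a sufficiently high
iterate of the median maximal operator is at least one on the whole cube. *)
Lemma indic_cube_carrier c : 0 < c.2 -> carrier Z \1_(cb c).
Proof.
move=> c0; have mc := measurable_cb c.
have [F [mF Fc F0 ZF]] := bfs_saturation HZ mc (lebesgue_cube_gt0 c.1 c0).
have vc0 := vol_cb_gt0 c0.
have fF := cb_fin_sub mF Fc.
have vF : 0 < vol F by rewrite -lte_fin -(volE fF); exact: F0.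
have [k hk] := threshold_exists (divr_gt0 vF vc0).
have [h [Zh _ Hh]] := median_expansion k ZF.
have /(_ _)/= hae := Hh c 1 c0 ltr01.
apply: (bfs_ideal HZ Zh _ _).1; first exact: measurable_indic.
have : \forall x \ae mu, cb c x -> 1 <= h x.
  apply: hae; rewrite (_ : cb c `&` _ = F); first by rewrite -ltr_pdivlMr.
  apply/seteqP; split => x.
    move=> [_ /=]; rewrite indicE; have [Fx//|nFx] := pselect (F x).
    by rewrite memNset// normr0 leNgt ltr01.
  by move=> Fx; split; [exact: Fc|rewrite /= indicE mem_set// normr1].
apply: filterS => x hx; rewrite indicE; have [cx|ncx] := pselect (cb c x).
  by rewrite mem_set// normr1 (le_trans (hx cx))// ler_norm.
by rewrite memNset// normr0.
Qed.

(** Each [F i] fills enough of its cube for an iterate of the median maximal operator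
to carry the value [x i] from [F i] to the whole cube. *)
Lemma step_spread (kap : R) : 0 < kap -> exists2 K : R, 0 < K & spreads kap Z K.
Proof.
move=> kap0; have [k hk] := threshold_exists kap0.
exists (A ^+ k.+1); first exact: exprn_gt0.
move=> I s x Q E F us x0 Q0 mE mF EQ FE dE hF ZF.
have [h [Zh Nh Hh]] := median_expansion k ZF.
have mstep : measurable_fun setT (step s x E) by exact: measurable_step.
have dF : disjoint_on s F.
  by move=> i j y si sj Fi Fj; apply: (dE i j y) => //; exact: FE.
have hi i : i \in s -> \forall y \ae mu, cb (Q i) y -> x i <= `|h y|.
  move=> si; have := x0 i si; rewrite le_eqVlt => /predU1P[<-|xi0].
    by apply: aeW => y _.
  have : \forall y \ae mu, cb (Q i) y -> x i <= h y.
    apply: Hh => //; first exact: Q0.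
    have vQ := vol_cb_gt0 (Q0 i si).
    apply: (@lt_le_trans _ _ (vol (F i))).
      by apply: lt_le_trans (hF i si); rewrite ltr_pM2r.
    have mI : measurable (cb (Q i) `&` [set y | x i <= `|step s x F y|]).
      apply: measurableI; first exact: measurable_cb.
      by apply: measurable_superlevel; exact: (bfs_measurable HZ ZF).
    apply: vol_le => //; [exact: mF| |by apply: cb_fin_sub => // y []].
    move=> y Fy; split; first by apply: EQ => //; exact: FE.
    by rewrite /= (step_in x us dF si Fy) ler_norm.
  by apply: filterS => y hy /hy /le_trans; apply; exact: ler_norm.
have hall : \forall y \ae mu, forall i, i \in s -> cb (Q i) y -> x i <= `|h y|.
  have : forall s' : seq I, {subset s' <= s} ->
      \forall y \ae mu, forall i, i \in s' -> cb (Q i) y -> x i <= `|h y|.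
    elim=> [|i s' IH] ss; first exact: aeW.
    have hs := IH (fun j js => ss j (@mem_behead _ (i :: s') j js)).
    apply: filterS2 (hi i (ss i (mem_head _ _))) hs => y h1 h2 j.
    by rewrite in_cons => /predU1P[->//|]; exact: h2.
  exact.
have le : \forall y \ae mu, `|step s x E y| <= `|h y|.
  move: hall; apply: filterS => y hy.
  have [[i si Ei]|no] := pselect (exists2 i, i \in s & E i y).
    rewrite (step_in x us dE si Ei) ger0_norm ?x0//; apply: hy => //.
    exact: EQ.
  by rewrite step_out ?normr0// => i si Ei; apply: no; exists i.
have [ZE NE] := bfs_ideal HZ Zh mstep le.
by split => //; exact: le_trans Nh.
Qed.

End expansion.

(** * The maximal operator and rational cubes *)

Section rational_cubes.
Context {R : realType} {n : nat}.
Hypothesis n_gt0 : (0 < n)%N.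
Local Notation mu := (@lebesgue_Rn R n).
Implicit Types (f : Rn R n -> R) (c : Rn R n * R).

Definition rational_cube (p : n.-tuple rat * rat) : Rn R n * R :=
  ([tuple (ratr (tnth p.1 i) : R) | i < n], ratr p.2).

Lemma rational_enlargement c (t : R) : 0 < c.2 -> 1 < t -> exists p,
  [/\ 0 < (rational_cube p).2, cb c `<=` cb (rational_cube p) &
      vol (cb (rational_cube p)) <= t * vol (cb c)].
Proof.
move=> c0 t1; pose rho := t `^ n%:R^-1.
have t0 : 0 <= t by lra.
have rhoX : rho ^+ n = t by rewrite pow_rootK.
have rho1 : 1 < rho by rewrite -(@expr_gt1 _ n) ?powR_ge0// rhoX.
pose del := (rho - 1) * c.2 / 2.
have del0 : 0 < del by rewrite divr_gt0// mulr_gt0// subr_gt0.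
have [l /=] : exists l : rat, ratr l \in `]c.2 + del, c.2 + 2 * del[.
  by apply: rat_in_itvoo; lra.
rewrite in_itv/= => /andP[l1 l2].
have /choice[b hb] : forall i : 'I_n, exists b : rat,
    (tnth c.1 i : R) - del < ratr b < (tnth c.1 i : R).
  move=> i; have [|b] := @rat_in_itvoo R ((tnth c.1 i : R) - del) (tnth c.1 i).
    by rewrite ltrBlDr ltrDl.
  by rewrite in_itv/= => h; exists b.
exists ([tuple b i | i < n], l); split => /=.
- by lra.
- move=> x /cubeP h; apply/cubeP => i; rewrite /= !tnth_mktuple.
  have /andP[x1 x2] := h i; have /andP[b1 b2] := hb i.
  by apply/andP; split; lra.
- rewrite !vol_cube/= ?(ltW c0)//; last by lra.
  rewrite -rhoX -exprMn lerXn2r ?nnegrE//; [lra|by rewrite mulr_ge0 ?powR_ge0// ltW|].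
  by apply: ltW; apply: lt_le_trans l2 _; rewrite /del; lra.
Qed.

Definition cube_integral f c : \bar R := (\int[mu]_(y in cb c) `|f y|%:E)%E.

Lemma cube_integral_ge0 f c : (0 <= cube_integral f c)%E.
Proof. by apply: integral_ge0 => x _; rewrite lee_fin. Qed.

Lemma cube_integral_sub f c d : measurable_fun setT f -> cb c `<=` cb d ->
  (cube_integral f c <= cube_integral f d)%E.
Proof.
move=> mf cd; apply: ge0_subset_integral => //; [exact: measurable_cube..|].
by apply/measurable_EFinP; apply: measurable_funTS; apply: measurableT_comp.
Qed.

Lemma maximal_ge f c x : 0 < c.2 -> cb c x ->
  (((vol (cb c))^-1)%:E * cube_integral f c <= maximal f x)%E.
Proof.
move=> c0 cx; apply: ereal_sup_ubound; exists (cb c).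
  by split => //; exists c.1, c.2.
have v0 : vol (cb c) != 0 by rewrite gt_eqF ?vol_cb_gt0.
by rewrite (volE (cb_fin c)) inver (negbTE v0).
Qed.

(** A slight enlargement of a cube to one with rational corner and side hardly changes
the average. *)
Lemma maximal_rational f x (y : R) : measurable_fun setT f -> 0 <= y ->
  (y%:E < maximal f x)%E -> exists p, [/\ 0 < (rational_cube p).2,
    cb (rational_cube p) x &
    ((y * vol (cb (rational_cube p)))%:E < cube_integral f (rational_cube p))%E].
Proof.
move=> mf y0 /ereal_sup_gt[_ [Q [Qx [a [l [l0 QE]]]] <-]].
pose c := (a, l); have QcE : Q = cb c by [].
have v_gt0 : 0 < vol (cb c) by exact: vol_cb_gt0.
rewrite QcE (volE (cb_fin c)) inver gt_eqF// -/(cube_integral f c).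
rewrite muleC lte_pdivlMr// -EFinM => ylt.
have [t t1 yt] : exists2 t, 1 < t & ((y * (t * vol (cb c)))%:E < cube_integral f c)%E.
  have := cube_integral_ge0 f c; case: (cube_integral f c) ylt => [r| |]//.
    rewrite lte_fin => yr _; exists (1 + (r - y * vol (cb c)) / (2 * (y * vol (cb c) + 1))).
      by rewrite ltrDl divr_gt0 ?subr_gt0// mulr_gt0// ltr_wpDl// mulr_ge0// ltW.
    rewrite lte_fin mulrCA mulrDl mul1r -ltrBrDl.
    set u := y * vol (cb c) in yr *.
    have u0 : 0 <= u by rewrite mulr_ge0// ltW.
    rewrite mulrAC ltr_pdivrMr ?mulr_gt0 ?ltr_wpDl// ltr_pM2l ?subr_gt0//; lra.
  by move=> _ _; exists 2; rewrite ?ltr1n// ltry.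
have [p [p0 cp vp]] := @rational_enlargement c t l0 t1.
exists p; split => //; first by apply: cp; rewrite -QcE.
apply: lt_le_trans (cube_integral_sub mf cp); apply: le_lt_trans yt.
by rewrite lee_fin ler_wpM2l.
Qed.

Definition average f c : R := fine (cube_integral f c) / vol (cb c).

Fixpoint max_average f (s : seq (Rn R n * R)) (x : Rn R n) : R :=
  if s is c :: s' then Num.max (average f c * \1_(cb c) x) (max_average f s' x)
  else 0.

Lemma cube_integral_average f c : (cube_integral f c < +oo)%E -> 0 < c.2 ->
  cube_integral f c = (average f c * vol (cb c))%:E.
Proof.
move=> fin c0; have v0 : vol (cb c) != 0 by rewrite gt_eqF ?vol_cb_gt0.
by rewrite /average divfK// fineK// ge0_fin_numE ?cube_integral_ge0.
Qed.

Lemma max_average_ge0 f s x : 0 <= max_average f s x.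
Proof. by elim: s => //= c s IH; rewrite le_max IH orbT. Qed.

Lemma max_average_ge f s x c : c \in s -> cb c x -> average f c <= max_average f s x.
Proof.
elim: s => //= d s IH; rewrite in_cons => /predU1P[<-|cs] cx.
  by rewrite le_max indicE mem_set// mulr1 lexx.
by rewrite le_max IH ?orbT.
Qed.

Lemma max_average_le f s x (B : R) : 0 <= B ->
  (forall c, c \in s -> cb c x -> average f c <= B) -> max_average f s x <= B.
Proof.
move=> B0; elim: s => //= c s IH h; rewrite ge_max; apply/andP; split.
  rewrite indicE; have [cx|ncx] := pselect (cb c x); last by rewrite memNset// mulr0.
  by rewrite mem_set// mulr1 h// mem_head.
by apply: IH => d ds; apply: h; rewrite in_cons ds orbT.
Qed.

Lemma measurable_max_average f s : measurable_fun setT (max_average f s).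
Proof.
elim: s => [|c s IH] /=; first exact: measurable_cst.
apply: measurable_maxr => //; apply: measurable_funM => //.
by apply: measurable_indic; exact: measurable_cb.
Qed.

Definition rational_cubes (m : nat) : seq (Rn R n * R) :=
  [seq c <- [seq rational_cube p | p <- pmap unpickle (iota 0 m)] | 0 < c.2].

Lemma rational_cubes_gt0 m c : c \in rational_cubes m -> 0 < c.2.
Proof. by rewrite mem_filter => /andP[]. Qed.

Lemma rational_cubesP m c : c \in rational_cubes m -> exists p, c = rational_cube p.
Proof. by rewrite mem_filter => /andP[_ /mapP[p _ ->]]; exists p. Qed.

Lemma rational_cubesS m c : c \in rational_cubes m -> c \in rational_cubes m.+1.
Proof.
rewrite !mem_filter => /andP[-> /mapP[p pm ->]]; apply/mapP; exists p => //.
by rewrite -[m.+1]addn1 iotaD pmap_cat mem_cat pm.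
Qed.

Lemma rational_cubes_mem p : 0 < (rational_cube p).2 ->
  exists m, rational_cube p \in rational_cubes m.
Proof.
move=> p0; exists (pickle p).+1; rewrite mem_filter p0 andTb; apply/mapP; exists p => //.
rewrite mem_pmap; apply/mapP; exists (pickle p); last by rewrite pickleK.
by rewrite mem_iota add0n ltnSn.
Qed.

(** The largest averages over the first [m] rational cubes increase to the maximal
function. *)
Lemma maximal_bounded (Z : function_space (Rn R n) R) (C : R) :
  is_Banach_function_space mu Z -> 0 < C ->
  (forall f c, carrier Z f -> 0 < c.2 -> (cube_integral f c < +oo)%E) ->
  (forall f m, carrier Z f -> carrier Z (max_average f (rational_cubes m)) /\
     norm Z (max_average f (rational_cubes m)) <= C * norm Z f) ->
  bounded_operator mu maximal Z.
Proof.
move=> HZ C0 fin bnd; exists C => // f Zf; have mf := bfs_measurable HZ Zf.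
pose G m := max_average f (rational_cubes m).
have hG m : carrier Z (G m) /\ norm Z (G m) <= C * norm Z f.
  exact: bnd.
have ndG m x : G m x <= G m.+1 x.
  apply: max_average_le; first exact: max_average_ge0.
  by move=> c cm cx; apply: max_average_ge => //; exact: rational_cubesS.
have [g [Zg Ng Gg]] := bfs_monotone_limit HZ (fun m => (hG m).1)
  (aeW _ (fun x m => introT andP (conj (max_average_ge0 _ _ _) (ndG m x)))) (fun m => (hG m).2).
exists g; split => //; move: Gg; apply: filterS => x Gg.
have nd : {homo (G ^~ x) : i j / (i <= j)%N >-> i <= j}.
  by apply/nondecreasing_seqP => m; exact: ndG.
have Gle m : G m x <= g x.
  by rewrite -(cvg_lim _ Gg)//; apply: nondecreasing_cvgn_le => //; apply/cvg_ex; exists (g x).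
have g0 : 0 <= g x by apply: le_trans (Gle 0%N); exact: max_average_ge0.
have avgE c : 0 < c.2 -> cube_integral f c = (average f c * vol (cb c))%:E.
  by move=> c0; rewrite -cube_integral_average ?fin.
apply/eqP; rewrite eq_le; apply/andP; split.
  suff h : forall m, ((G m x)%:E <= maximal f x)%E.
    have cg : (fun m => (G m x)%:E) @ \oo --> (g x)%:E.
      by apply: cvg_EFin => //; exact: nearW.
    rewrite -(cvg_lim _ cg)//; apply: lime_le; first by apply/cvg_ex; eexists; exact: cg.
    exact: nearW.
  move=> m; rewrite /G; have : forall c, c \in rational_cubes m -> 0 < c.2.
    by move=> c; exact: rational_cubes_gt0.
  have M0 : (0 <= maximal f x)%E.
    have c0 : cb (x, 1) x by apply/cubeP => i; rewrite lexx/= ltrDl.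
    apply: le_trans (maximal_ge f _ c0); last exact: ltr01.
    by apply: mule_ge0; rewrite ?lee_fin ?invr_ge0 ?vol_ge0// cube_integral_ge0.
  elim: (rational_cubes m) => [|c s IH] hs //=.
  rewrite EFin_max ge_max IH ?andbT; last by move=> d ds; apply: hs; rewrite in_cons ds orbT.
  rewrite indicE; have [cx|ncx] := pselect (cb c x); last by rewrite memNset// mulr0.
  have c0 := hs c (mem_head _ _); rewrite mem_set// mulr1.
  apply: le_trans (maximal_ge f c0 cx); rewrite avgE// -EFinM lee_fin mulrC mulfK//.
  by rewrite gt_eqF ?vol_cb_gt0.
rewrite leNgt; apply/negP => /(maximal_rational mf g0)[p [p0 px]].
rewrite avgE// lte_fin ltNge => /negP; apply.
rewrite ler_wpM2r ?vol_ge0//; have [m pm] := rational_cubes_mem p0.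
by apply: le_trans (Gle m); exact: max_average_ge.
Qed.

End rational_cubes.

(** * The maximal operator on power spaces *)

Section power_maximal.
Context {R : realType} {n : nat}.
Hypothesis n_gt0 : (0 < n)%N.
Local Notation mu := (@lebesgue_Rn R n).
Variables lam g A : R.
Hypothesis lam01 : 0 < lam < 1.
Hypothesis g1 : 1 < g.
Hypothesis growth : @density_grows R n lam g.
Variable Z : function_space (Rn R n) R.
Hypothesis HZ : is_Banach_function_space mu Z.
Hypothesis A0 : 0 < A.
Hypothesis mZ : median_bound lam Z A.
Implicit Types (f : Rn R n -> R) (c : Rn R n * R).

(** Where [f] exceeds [y k] but not [y k.+1], it is bounded by [y k.+1], and this
happens on a proportion of at most [g ^- k] of the cube; the points where [f] exceeds
all the [y k] form a null set. *)
Lemma layer_cake_le f c (y : nat -> R) (S : R) : measurable_fun setT f -> 0 < c.2 ->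
  (forall k, 0 <= y k) ->
  (forall k, vol (cb c `&` [set z | y k < `|f z|]) <= lam * g ^- k * vol (cb c)) ->
  (forall m, \sum_(k < m) g * g ^- k * y k <= S) ->
  (cube_integral f c <= (S * vol (cb c))%:E)%E.
Proof.
have /andP[lam0 lam1] := lam01; have g0 : 0 < g by exact: lt_trans g1.
move=> mf c0 y0 hy hS.
have mc := measurable_cb c.
have maf : measurable_fun setT (fun z => `|f z|) by exact: measurableT_comp.
pose D k := [set z | y k < `|f z|].
have mD k : measurable (D k) by exact: measurable_set_lt.
pose u (k : nat) (z : Rn R n) : R :=
  if k is k'.+1 then y k * \1_(D k') z else y 0%N.
have u0 k z : 0 <= u k z by case: k => //= k; rewrite mulr_ge0 ?indic_ge0.
have mu_ k : measurable_fun (cb c) (EFin \o u k).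
  apply/measurable_EFinP; case: k => /= [|k]; first exact: measurable_cst.
  by apply: measurable_funM => //; apply: measurable_indic.
have v0 := vol_ge0 (cb c).
have int_u k : (\int[mu]_(z in cb c) (u k z)%:E <= (g * g ^- k * y k * vol (cb c))%:E)%E.
  case: k => [|k] /=.
    rewrite integral_cst//= -/(mu (cb c)) (_ : (mu : set _ -> \bar R) (cb c) = (vol (cb c))%:E); last exact: (volE (cb_fin c)).
    rewrite -EFinM lee_fin expr0 invr1 mulr1 ler_wpM2r// ler_peMl//.
    exact: ltW.
  under eq_integral do rewrite EFinM.
  rewrite ge0_integralZl//; [|by apply/measurable_EFinP; apply: measurable_indic|by rewrite lee_fin].
  rewrite integral_indic// setIC.
  have mI : measurable (cb c `&` D k) by exact: measurableI.
  have Ic : cb c `&` D k `<=` cb c by move=> z [].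
  apply: (@le_trans _ _ ((y k.+1)%:E * (vol (cb c `&` D k))%:E)%E).
    by rewrite lee_wpmul2l ?lee_fin// -(volE (cb_fin_sub mI Ic)).
  rewrite -EFinM lee_fin mulrC mulrAC ler_wpM2r//.
  apply: le_trans (hy k) _; rewrite ler_wpM2r// exprS invfM mulrA mulfV ?gt_eqF// mul1r.
  by rewrite ler_piMl ?(ltW lam1)// invr_ge0 exprn_ge0// ltW.
have low_null : mu (cb c `&` \bigcap_k D k) = 0%E.
  have mB : measurable (cb c `&` \bigcap_k D k).
    by apply: measurableI => //; apply: bigcap_measurableType.
  have Bc : cb c `&` \bigcap_k D k `<=` cb c by move=> z [].
  rewrite (volE (cb_fin_sub mB Bc)); congr EFin.
  apply/eqP; rewrite eq_le vol_ge0 andbT leNgt; apply/negP => vB.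
  have [k hk] := @expr_unbounded R g (lam * vol (cb c) / vol (cb c `&` \bigcap_k D k)) g1.
  have le1 : vol (cb c `&` \bigcap_k D k) <= lam * g ^- k * vol (cb c).
    have mI : measurable (cb c `&` D k) by exact: measurableI.
    have Ic : cb c `&` D k `<=` cb c by move=> z [].
    apply: le_trans (hy k); apply: vol_le => //; last exact: (cb_fin_sub mI Ic).
    by move=> z [cz h]; split => //; exact: h.
  move: hk; rewrite ltr_pdivrMr// => hk; have := lt_le_trans hk (_ : _ <= lam * vol (cb c)).
  rewrite ltxx => h; suff : false by []; apply: h.
  rewrite -ler_pdivlMl ?exprn_gt0//; apply: le_trans le1 _.
  by rewrite mulrA [g ^- k * lam]mulrC.
pose U z : \bar R := (\sum_(k <oo) (u k z)%:E)%E.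
have U0 z : (0 <= U z)%E by apply: nneseries_ge0 => k _ _; rewrite lee_fin.
have mU : measurable_fun (cb c) U.
  by apply: ge0_emeasurable_sum => k *; [rewrite lee_fin u0|exact: mu_].
apply: (@le_trans _ _ (\int[mu]_(z in cb c) U z)%E).
  apply: ae_ge0_le_integral => //.
    by apply/measurable_EFinP; exact: measurable_funTS.
  exists (cb c `&` \bigcap_k D k); split => //.
    by apply: measurableI => //; apply: bigcap_measurableType.
  move=> z /= /not_implyP[cz hz]; split => // k _; rewrite /D/= ltNge; apply/negP => fk.
  apply: hz.
  have [j hj minj] := ex_minnP (ex_intro (fun k => `|f z| <= y k) k fk).
  apply: (@le_trans _ _ (u j z)%:E).
    rewrite lee_fin; case: j hj minj => //= j hj minj.
    have Dj : D j z by rewrite /D/= ltNge; apply/negP => /minj; rewrite ltnn.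
    by rewrite indicE mem_set// mulr1.
  have := @nneseries_lim_ge R (fun k => (u k z)%:E) xpredT 0%N j.+1 (fun k _ _ => _).
  rewrite /U => h; apply: le_trans (h _); last by move=> i; rewrite lee_fin.
  rewrite big_nat_recr//= leeDr// sume_ge0// => i _; by rewrite lee_fin.
rewrite integral_nneseries//; last by move=> k z _; rewrite lee_fin.
apply: lime_le.
  by apply: is_cvg_nneseries => k _ _; apply: integral_ge0 => z _; rewrite lee_fin.
apply: nearW => m; rewrite big_mkord.
apply: (@le_trans _ _ (\sum_(k < m) (g * g ^- k * y k * vol (cb c))%:E)%E).
  by apply: lee_sum => k _; exact: int_u.
by rewrite sumEFin lee_fin -mulr_suml ler_wpM2r.
Qed.

Variable N : nat.
Hypothesis N0 : (0 < N)%N.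
Hypothesis AgN : A < g ^+ N.
Local Notation Y := (power_space N Z).

(** The iterates of the median maximal operator on [|f| ^ N], brought back by the
[N]-th root, bound [f] off sets of proportion [g ^- k].  Their norms grow like powers
of the [N]-th root of [A], which is smaller than [g], so the weighted sum required by
[layer_cake_le] converges in [Y]. *)
Lemma power_geometric : exists2 C : R, 0 < C & forall f, carrier Y f ->
  exists S, [/\ carrier Y S, norm Y S <= C * norm Y f, \forall x \ae mu, 0 <= S x &
    \forall x \ae mu, forall p, 0 < (rational_cube p).2 :> R -> cb (rational_cube p) x ->
      (cube_integral f (rational_cube p) <= (S x * vol (cb (rational_cube p)))%:E)%E].
Proof.
have g0 : 0 < g by exact: lt_trans g1.
have HY : is_Banach_function_space mu Y := power_space_bfs HZ N0.
pose B := A `^ N%:R^-1.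
have B0 : 0 < B by exact: powR_gt0.
have BN : B ^+ N = A by rewrite /B (pow_rootK N0)// ltW.
have Bg : B < g by rewrite -(@ltr_pXn2r _ N) ?nnegrE ?BN ?(ltW B0) ?(ltW g0).
pose th := B / g.
have th0 : 0 <= th by rewrite divr_ge0// ltW.
have th1 : th < 1 by rewrite ltr_pdivrMr// mul1r.
pose C := g * B / (1 - th).
have C0 : 0 < C by rewrite divr_gt0 ?mulr_gt0// subr_gt0.
exists C => // f Yf; have [mf Zf] := Yf.
pose F x : R := `|f x| ^+ N.
have /choice[h_ hh] := fun k => median_expansion lam01 g1 growth HZ A0 mZ k Zf.
pose G k x := `|h_ k x| `^ N%:R^-1.
have G0 k x : 0 <= G k x by exact: powR_ge0.
have GN k : (fun x => `|G k x| ^+ N) = (fun x => `|h_ k x|).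
  by apply/funext => x; rewrite ger0_norm// /G (pow_rootK N0).
have mG k : measurable_fun setT (G k).
  have [Zh _ _] := hh k; apply: (measurableT_comp (measurable_powR _)).
  by apply: measurableT_comp => //; exact: (bfs_measurable HZ Zh).
have YG k : carrier Y (G k).
  by have [Zh _ _] := hh k; split => //; rewrite GN; exact: (bfs_abs HZ Zh).
have NG k : norm Y (G k) <= B ^+ k.+1 * norm Y f.
  have [Zh Nh _] := hh k.
  apply: (power_space_norm_le HZ N0 (YG k)).
    by rewrite mulr_ge0 ?exprn_ge0 ?(ltW B0)// (bfs_norm_ge0 HY).
  rewrite GN (bfs_norm_abs HZ Zh) exprMn exprAC BN.
  by rewrite (power_space_norm_pow HZ N0 Yf).
pose S_ m x := \sum_(k < m) g * g ^- k * G k x.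
have gk0 k : 0 <= g * g ^- k by rewrite mulr_ge0 ?(ltW g0)// invr_ge0 exprn_ge0// ltW.
have YS m : carrier Y (S_ m) /\ norm Y (S_ m) <= C * norm Y f.
  have YgG k : carrier Y (fun x => g * g ^- k * G k x) by exact: (bfs_scale HY).
  have [Ys Ns] := bfs_sum HY (s := index_enum 'I_m) (F := fun (k : 'I_m) x => g * g ^- k * G k x)
    (fun k _ => YgG k).
  split; first exact: Ys.
  apply: le_trans Ns _.
  apply: (@le_trans _ _ (\sum_(k < m) (g * B * norm Y f) * th ^+ k)).
    apply: ler_sum => k _; rewrite (bfs_normZ HY)// ger0_norm//.
    apply: le_trans (ler_wpM2l (gk0 k) (NG k)) _.
    rewrite le_eqVlt; apply/orP; left; apply/eqP.
    by rewrite /th exprMn exprVn exprS; ring.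
  rewrite -mulr_sumr /C [leRHS]mulrAC.
  have NY0 := bfs_norm_ge0 HY Yf.
  have geo : \sum_(k < m) th ^+ k <= (1 - th)^-1.
    rewrite -[leRHS]mul1r ler_pdivlMr ?subr_gt0// mulrC -opprB mulNr -subrX1 opprB.
    by rewrite gerBl exprn_ge0.
  by rewrite ler_wpM2l// mulr_ge0// mulr_ge0 ?(ltW g0) ?(ltW B0).
have ndS x m : 0 <= S_ m x <= S_ m.+1 x.
  rewrite /S_ big_ord_recr/= lerDl; apply/andP; split.
    by apply: sumr_ge0 => k _; exact: (mulr_ge0 (gk0 k) (G0 k x)).
  exact: (mulr_ge0 (gk0 m) (G0 m x)).
have [S [YSS NS cvgS]] := bfs_monotone_limit HY (fun m => (YS m).1)
  (aeW _ ndS) (fun m => (YS m).2).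
have S_le : \forall x \ae mu, forall m, S_ m x <= S x.
  move: cvgS; apply: filterS => x hx m; rewrite -(cvg_lim _ hx)//.
  apply: nondecreasing_cvgn_le; last by apply/cvg_ex; exists (S x).
  by apply/nondecreasing_seqP => i; have /andP[] := ndS x i.
exists S; split => //.
  by move: S_le; apply: filterS => x /(_ 0%N); rewrite /S_ big_ord0.
(* Rational cubes and levels are countable in number, hence so are the exceptional
   null sets. *)
have rat_ae : \forall x \ae mu, forall p k (a : rat), 0 < (rational_cube p).2 :> R -> 0 < (ratr a : R) ->
    lam * g ^- k * vol (cb (rational_cube p)) <
      vol (cb (rational_cube p) `&` [set z | ratr a <= `|f z|]) ->
    cb (rational_cube p) x -> ratr a <= G k x.
  have : \forall x \ae mu, forall j : nat,
      if unpickle j is Some (p, k, a) then 0 < (rational_cube p).2 :> R -> 0 < (ratr a : R) ->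
        lam * g ^- k * vol (cb (rational_cube p)) <
          vol (cb (rational_cube p) `&` [set z | ratr a <= `|f z|]) ->
        cb (rational_cube p) x -> ratr a <= G k x else True.
    apply/ae_foralln => j; case: (unpickle j) => [[[p k] a]|]; last exact: aeW.
    have [p0|p0] := boolP (0 < (rational_cube p).2 :> R); last by apply: aeW.
    have [a0|a0] := boolP (0 < (ratr a : R)); last by apply: aeW.
    have [dens|ndens] := boolP (lam * g ^- k * vol (cb (rational_cube p)) <
      vol (cb (rational_cube p) `&` [set z | ratr a <= `|f z|])); last by apply: aeW.
    have [Zh _ Hh] := hh k.
    have aN0 : 0 < (ratr a : R) ^+ N by exact: exprn_gt0.
    have := Hh _ _ p0 aN0; rewrite (_ : [set z | _] = [set z | ratr a <= `|f z|]).
      move=> /(_ dens); apply: filterS => x hx _ _ _ /hx ha.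
      rewrite -[leLHS](root_powK N0) ?(ltW a0)// /G.
      rewrite ge0_ler_powR ?nnegrE ?invr_ge0// ?exprn_ge0 ?(ltW a0)//.
      by rewrite (le_trans ha)// ler_norm.
    by apply/seteqP; split => z /=; rewrite (ger0_norm (exprn_ge0 N (normr_ge0 _))) ler_pXn2r ?nnegrE ?(ltW a0)//.
  apply: filterS => x hx p k a; have := hx (pickle (p, k, a)).
  by rewrite pickleK.
apply: filterS2 S_le rat_ae => x Sx ratx p p0 px.
apply: (@layer_cake_le f (rational_cube p) (fun k => G k x) (S x)) => //.
move=> k; rewrite leNgt; apply/negP => hk.
set y := G k x in hk; set c := rational_cube p in p0 px hk *.
have mc := measurable_cb c.
pose D j := cb c `&` [set z | y + j.+1%:R^-1 <= `|f z|].
have mD j : measurable (D j) by apply: measurableI => //; exact: measurable_superlevel.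
have DE : cb c `&` [set z | y < `|f z|] = \bigcup_j D j.
  apply/seteqP; split => z.
    move=> [cz /= fz]; have d0 : 0 < `|f z| - y by rewrite subr_gt0.
    exists (Num.truncn (`|f z| - y)^-1) => //; split => //=.
    rewrite -lerBrDl -[leRHS]invrK lef_pV2 ?posrE ?invr_gt0// ltW//.
    by apply: truncnS_gt; rewrite invr_ge0 ltW.
  by move=> [j _ [cz /= h]]; split => //=; apply: lt_le_trans h; rewrite ltrDl invr_gt0.
have [j hj] : exists j, lam * g ^- k * vol (cb c) < vol (D j).
  have mU : measurable (\bigcup_j D j) by exact: bigcupT_measurable.
  have Uc : \bigcup_j D j `<=` cb c by move=> z [j _ []].
  have cD : (mu \o D) j @[j --> \oo] --> mu (\bigcup_j D j).
    apply: nondecreasing_cvg_mu => // i j ij; apply/subsetPset => z [cz /= h]; split => //=.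
    apply: le_trans h; rewrite lerD2l lef_pV2 ?posrE// ler_nat ltnS//.
  apply: contrapT => /forallNP no.
  have : (limn (mu \o D) <= (lam * g ^- k * vol (cb c))%:E)%E.
    apply: lime_le; first by apply/cvg_ex; eexists; exact: cD.
    apply: nearW => j.
    have Dc : D j `<=` cb c by move=> z [].
    have -> : (mu \o D) j = (vol (D j))%:E by exact: (volE (cb_fin_sub (mD j) Dc)).
    by rewrite lee_fin leNgt; exact/negP/no.
  rewrite (cvg_lim _ cD)// (_ : (mu : set _ -> \bar R) (\bigcup_j D j) = (vol (\bigcup_j D j))%:E).
    by rewrite lee_fin -DE leNgt hk.
  exact: (volE (cb_fin_sub mU Uc)).
have [|a /=] := @rat_in_itvoo R y (y + j.+1%:R^-1); first by rewrite ltrDl invr_gt0.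
rewrite in_itv/= => /andP[ya aj].
have a0 : 0 < (ratr a : R) by apply: le_lt_trans ya; exact: G0.
have := ratx p k a p0 a0 _ px; rewrite leNgt ya => h; suff : false by [].
apply: h; apply: lt_le_trans hj _.
apply: vol_le => //.
- by apply: measurableI => //; exact: measurable_superlevel.
- by move=> z [cz /= h]; split => //=; apply: le_trans h; exact: ltW.
- apply: (cb_fin_sub (c := c)); last by move=> z [].
  by apply: measurableI => //; exact: measurable_superlevel.
Qed.

(** The geometric series of [power_geometric] dominates all averages over rational
cubes at once. *)
Lemma maximal_power_space : bounded_operator mu maximal Y.
Proof.
have HY : is_Banach_function_space mu Y := power_space_bfs HZ N0.
have [C C0 hC] := power_geometric.
have avg_le f S x c : 0 < c.2 -> (cube_integral f c <= (S x * vol (cb c))%:E)%E ->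
    average f c <= S x :> R.
  move=> c0 h; have v0 := vol_cb_gt0 c0.
  rewrite /average ler_pdivrMr// -lee_fin fineK//.
  by rewrite ge0_fin_numE ?cube_integral_ge0// (le_lt_trans h)// ltry.
have fin p f : carrier Y f -> 0 < (rational_cube p).2 :> R ->
    (cube_integral f (rational_cube p) < +oo)%E.
  move=> Yf p0; have [S [_ _ _ hS]] := hC f Yf.
  have [x [px hx]] : exists x, cb (rational_cube p) x /\
      (cube_integral f (rational_cube p) <= (S x * vol (cb (rational_cube p)))%:E)%E.
    move: hS => [M [mM M0 sM]]; apply: contrapT => /forallNP h.
    have : (mu (cb (rational_cube p)) <= mu M)%E.
      apply: le_measure; rewrite ?inE//; first exact: measurable_cb.
      by move=> x px; apply: sM => /= /(_ p p0 px) hx; apply: (h x).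
    rewrite (M0 : mu M = 0%E) leNgt => /negP; apply; exact: lebesgue_cube_gt0.
  by apply: le_lt_trans hx _; rewrite ltry.
have fin' f c : carrier Y f -> 0 < c.2 -> (cube_integral f c < +oo)%E.
  move=> Yf c0; have [p [p0 cp _]] := rational_enlargement n_gt0 c0 (ltr1n R 2 : 1 < 2).
  by apply: le_lt_trans (fin p f Yf p0); apply: cube_integral_sub => //; exact: Yf.1.
apply: (maximal_bounded n_gt0 HY C0 fin') => f m Yf.
have [S [YS NS S0 hS]] := hC f Yf.
have le : \forall x \ae mu, `|max_average f (rational_cubes m) x| <= `|S x|.
  apply: filterS2 S0 hS => x Sx0 Sx; rewrite !ger0_norm ?max_average_ge0//.
  apply: max_average_le => // c cm cx; have c0 := rational_cubes_gt0 cm.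
  have [p cE] := rational_cubesP cm; apply: avg_le => //.
  by rewrite cE in c0 cx *; exact: Sx.
have [YG NG] := bfs_ideal HY YS (measurable_max_average _ _) le.
by split => //; exact: le_trans NS.
Qed.

End power_maximal.

(** * Spreading values over overlapping cubes *)

Section step_integrals.
Context {R : realType} {n : nat}.
Local Notation mu := (@lebesgue_Rn R n).
Implicit Types (f g : Rn R n -> R).

Lemma integral_mul_indic g (F : set (Rn R n)) :
  (\int[mu]_x (g x * \1_F x)%:E = \int[mu]_(x in F) (g x)%:E)%E.
Proof.
rewrite [RHS]integral_mkcond; apply: eq_integral => x _.
rewrite patchE indicE; case: ifPn => _ /=; by rewrite ?mulr1 ?mulr0.
Qed.

Lemma integral_mul_step (I : eqType) (s : seq I) (b : I -> R)
    (F : I -> set (Rn R n)) g : measurable_fun setT g -> (forall x, 0 <= g x) ->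
  (forall i, i \in s -> 0 <= b i) -> (forall i, i \in s -> measurable (F i)) ->
  (\int[mu]_x (g x * step s b F x)%:E =
   \sum_(i <- s) (b i)%:E * \int[mu]_(x in F i) (g x)%:E)%E.
Proof.
move=> mg g0; elim: s => [|i s IH] b0 mF.
  rewrite big_nil; under eq_integral do rewrite /step big_nil mulr0.
  exact: integral0.
have bi : 0 <= b i by apply: b0; rewrite mem_head.
have mFi : measurable (F i) by apply: mF; rewrite mem_head.
have b0s j : j \in s -> 0 <= b j by move=> js; apply: b0; rewrite in_cons js orbT.
have mFs j : j \in s -> measurable (F j) by move=> js; apply: mF; rewrite in_cons js orbT.
rewrite big_cons -IH// -integral_mul_indic -ge0_integralZl//; last 2 first.
- by apply/measurable_EFinP; apply: measurable_funM => //; exact: measurable_indic.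
- by move=> x _; rewrite lee_fin mulr_ge0 ?indic_ge0.
rewrite -ge0_integralD//; last 4 first.
- by move=> x _; rewrite mule_ge0 ?lee_fin ?mulr_ge0 ?indic_ge0.
- apply: emeasurable_funM => //; apply/measurable_EFinP; apply: measurable_funM => //.
- by move=> x _; rewrite lee_fin mulr_ge0 ?step_ge0.
- by apply/measurable_EFinP; apply: measurable_funM => //; exact: measurable_step.
apply: eq_integral => x _; rewrite /step big_cons -EFinM -EFinD; congr EFin; ring.
Qed.

Lemma step_carrier (Z : function_space (Rn R n) R) (I : eqType) (s : seq I)
    (b : I -> R) (Q : I -> Rn R n * R) (F : I -> set (Rn R n)) :
  is_Banach_function_space mu Z ->
  (forall c : Rn R n * R, 0 < c.2 -> carrier Z \1_(cb c)) ->
  (forall i, i \in s -> 0 < (Q i).2) -> (forall i, i \in s -> measurable (F i)) ->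
  (forall i, i \in s -> F i `<=` cb (Q i)) -> carrier Z (step s b F).
Proof.
move=> HZ ZQ Q0 mF FQ.
apply: (bfs_sum HZ (F := fun i x => b i * \1_(F i) x) _).1 => i si.
apply: (bfs_scale HZ); apply: (bfs_dom HZ (ZQ _ (Q0 i si))).
  by apply: measurable_indic; exact: mF.
by move=> x; apply: indic_sub; exact: FQ.
Qed.

End step_integrals.

Lemma sum_pow_le {R : realType} (I : eqType) (s : seq I) (y : I -> R) (N : nat) :
  (0 < N)%N -> (forall i, i \in s -> 0 <= y i) ->
  \sum_(i <- s) y i ^+ N <= (\sum_(i <- s) y i) ^+ N.
Proof.
case: N => // N _; elim: s => [|i s IH] y0; first by rewrite !big_nil expr0n.
rewrite !big_cons.
have yi : 0 <= y i by apply: y0; rewrite mem_head.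
have ys j : j \in s -> 0 <= y j by move=> js; apply: y0; rewrite in_cons js orbT.
have Y0 : 0 <= \sum_(j <- s) y j by rewrite big_seq sumr_ge0.
apply: le_trans (lerD (lexx _) (IH ys)) _; move: Y0; set Y := \sum_(_ <- _) _ => Y0.
rewrite !exprS mulrDl lerD// ler_wpM2l// lerXn2r ?nnegrE ?addr_ge0//.
- by rewrite lerDl.
- by rewrite lerDr.
Qed.

Definition fills_cubes {R : realType} {n : nat} (kap : R)
    (Z : function_space (Rn R n) R) (K : R) :=
  forall (I : eqType) (s : seq I) (b : I -> R) (Q : I -> Rn R n * R)
    (E : I -> set (Rn R n)),
  uniq s -> (forall i, i \in s -> 0 <= b i) -> (forall i, i \in s -> 0 < (Q i).2) ->
  (forall i, i \in s -> measurable (E i)) ->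
  (forall i, i \in s -> E i `<=` cb (Q i)) -> disjoint_on s E ->
  (forall i, i \in s -> kap * vol (cb (Q i)) <= vol (E i)) ->
  norm Z (step s b (fun i => cb (Q i))) <= K * norm Z (step s b E).

Section step_duality.
Context {R : realType} {n : nat}.
Local Notation mu := (@lebesgue_Rn R n).
Variable Z : function_space (Rn R n) R.
Hypothesis HZ : is_Banach_function_space mu Z.
Hypothesis ZQ : forall c : Rn R n * R, 0 < c.2 -> carrier Z \1_(cb c).
Variable N : nat.
Hypothesis N0 : (0 < N)%N.
Local Notation Y := (power_space N Z).
Hypothesis MY' : bounded_operator mu maximal (associate mu Y).

(** The average of [g] over a cube is at most its maximal function at every point of
[E i].  Integration compares the pairing of [g] with the step function on the whole
cubes to the pairing of the maximal function of [g] with the step function on the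
sets [E i]; by duality in [Y] this bounds norms in [Y], and powers lead back to [Z]. *)
Lemma step_dual (kap : R) : 0 < kap -> exists2 K : R, 0 < K & fills_cubes kap Z K.
Proof.
move=> kap0; have [C C0 hC] := MY'.
have HY : is_Banach_function_space mu Y := power_space_bfs HZ N0.
exists ((kap^-1 * C) ^+ N); first by rewrite exprn_gt0// mulr_gt0// invr_gt0.
move=> I s b Q E us b0 Q0 mE EQ dE hE.
have mQ i : measurable (cb (Q i)) by exact: measurable_cb.
pose be i := b i `^ N%:R^-1.
have be0 i : 0 <= be i by exact: powR_ge0.
have beN i : i \in s -> be i ^+ N = b i by move=> si; rewrite /be (pow_rootK N0)// b0.
pose k := step s be (fun i => cb (Q i)).
pose e := step s be E.
have k0 x : 0 <= k x by apply: step_ge0.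
have e0 x : 0 <= e x by apply: step_ge0.
have mk : measurable_fun setT k by apply: measurable_step.
have me : measurable_fun setT e by apply: measurable_step.
have Zb : carrier Z (step s b (fun i => cb (Q i))).
  exact: (step_carrier b HZ ZQ Q0 (fun i _ => mQ i) (fun i _ => @subset_refl _ _)).
have ZE : carrier Z (step s b E) := step_carrier b HZ ZQ Q0 mE EQ.
have eN : (fun x => `|e x| ^+ N) = step s b E.
  apply/funext => x; rewrite ger0_norm//.
  have [[i si Ei]|no] := pselect (exists2 i, i \in s & E i x).
    by rewrite /e !(step_in _ us dE si Ei) beN.
  have nE i : i \in s -> ~ E i x by move=> si Ei; apply: no; exists i.
  by rewrite /e !step_out// expr0n gtn_eqF.
have Yk : carrier Y k.
  apply: (bfs_sum HY (F := fun i x => be i * \1_(cb (Q i)) x) _).1 => i si.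
  apply: (bfs_scale HY); split; first exact: measurable_indic.
  rewrite (_ : (fun x => _) = \1_(cb (Q i))); first by apply: ZQ; exact: Q0.
  apply/funext => x; rewrite indicE; case: (_ \in _).
    by rewrite normr1 expr1n.
  by rewrite normr0 expr0n gtn_eqF.
have Ye : carrier Y e by split => //; rewrite eN.
have Ne : norm Y e ^+ N = norm Z (step s b E) by rewrite (power_space_norm_pow HZ N0 Ye) eN.
have Ne0 : 0 <= norm Y e by exact: (bfs_norm_ge0 HY).
have kb x : step s b (fun i => cb (Q i)) x <= k x ^+ N.
  apply: le_trans (sum_pow_le N0 _); last first.
    by move=> i _; rewrite mulr_ge0 ?indic_ge0.
  rewrite /step big_seq [leRHS]big_seq; apply: ler_sum => i si.
  rewrite exprMn beN// ler_wpM2l ?b0// indicE; case: (_ \in _) => /=.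
    by rewrite expr1n.
  by rewrite exprn_ge0.
have Nk : norm Y k <= kap^-1 * C * norm Y e.
  pose Om := cubes_union [seq Q i | i <- s].
  have mOm : measurable Om by exact: measurable_cubes_union.
  have Omfin : (mu Om < +oo)%E by exact: cubes_union_fin.
  apply: (bfs_norm_le_dual HY (c := \sum_(i <- s) be i) mOm Omfin Yk).
  - move=> x; rewrite k0/=; have [Ox|nOx] := pselect (Om x).
      rewrite indicE mem_set// mulr1; apply: ler_sum => i _.
      by rewrite ler_piMr// indicE; case: (_ \in _).
    rewrite indicE memNset// mulr0 /k step_out// => i si cx; apply: nOx.
    by exists (Q i) => //; apply/mapP; exists i.
  - by rewrite mulr_ge0// mulr_ge0 ?invr_ge0 ?ltW.
  move=> g g0 Yg Ng; have [mg _] := Yg.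
  have [h [Yh hM Nh]] := hC g Yg.
  have mh : measurable_fun setT (fun x => `|h x|).
    by apply: measurableT_comp => //; exact: Yh.1.
  rewrite integral_mul_step//.
  apply: (@le_trans _ _ (\sum_(i <- s) (kap^-1)%:E * ((be i)%:E * \int[mu]_(x in E i) `|h x|%:E))%E).
    rewrite big_seq [leRHS]big_seq; apply: lee_sum => i si.
    rewrite muleCA lee_wpmul2l ?lee_fin//.
    have vQ := vol_cb_gt0 (Q0 i si).
    have fE := cb_fin_sub (mE i si) (EQ i si).
    have -> : (\int[mu]_(x in cb (Q i)) (g x)%:E = cube_integral g (Q i))%E.
      by apply: eq_integral => x _; rewrite ger0_norm.
    have avg : \forall x \ae mu, cb (Q i) x ->
        (((vol (cb (Q i)))^-1)%:E * cube_integral g (Q i) <= `|h x|%:E)%E.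
      move: hM; apply: filterS => x hx cx.
      apply: le_trans (maximal_ge g (Q0 i si) cx) _.
      by rewrite -hx lee_fin ler_norm.
    have -> : cube_integral g (Q i) = ((vol (cb (Q i)))%:E *
        (((vol (cb (Q i)))^-1)%:E * cube_integral g (Q i)))%E.
      by rewrite muleA -EFinM mulfV ?mul1e// gt_eqF.
    set a : \bar R := (_ * cube_integral g (Q i))%E in avg *.
    have a0 : (0 <= a)%E by rewrite mule_ge0 ?lee_fin ?invr_ge0 ?vol_ge0// cube_integral_ge0.
    have aE : (a * (vol (E i))%:E <= \int[mu]_(x in E i) `|h x|%:E)%E.
      rewrite -(volE fE) -(integral_cst _ (mE i si)).
      apply: ae_ge0_le_integral => //; [exact: mE|by apply/measurable_EFinP; exact: measurable_funTS|].
      by move: avg; apply: filterS => x hx /(EQ i si); exact: hx.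
    apply: le_trans (lee_wpmul2l _ aE); last by rewrite lee_fin invr_ge0 ltW.
    rewrite [leRHS]muleCA [leLHS]muleC lee_wpmul2l// -EFinM lee_fin.
    by rewrite mulrC ler_pdivlMr// mulrC hE.
  rewrite -ge0_sume_distrr; last first.
    by move=> i _; rewrite mule_ge0 ?lee_fin// integral_ge0// => x _; rewrite lee_fin.
  rewrite -integral_mul_step//.
  rewrite -mulrA EFinM lee_wpmul2l ?lee_fin ?invr_ge0 ?(ltW kap0)//.
  have := bfs_associate_hoelder HY Ye Yh.
  under eq_integral do rewrite normrM (ger0_norm (e0 _)).
  move=> /le_trans; apply; rewrite lee_fin ler_wpM2r// (le_trans Nh)//.
  by rewrite ler_piMr// ltW.
have Nk0 : 0 <= norm Y k by exact: (bfs_norm_ge0 HY).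
apply: (@le_trans _ _ (norm Y k ^+ N)).
  rewrite (power_space_norm_pow HZ N0 Yk); apply: (bfs_norm_le HZ) => //.
  - exact: Yk.2.
  - by apply: measurable_step.
  - apply: aeW => x; rewrite ger0_norm; last by apply: step_ge0 => i; exact: b0.
    by rewrite (ger0_norm (exprn_ge0 N (normr_ge0 _))) (ger0_norm (k0 x)).
have kC : 0 <= kap^-1 * C by rewrite mulr_ge0 ?invr_ge0 ?(ltW kap0) ?(ltW C0).
by rewrite -Ne -exprMn lerXn2r ?nnegrE// mulr_ge0.
Qed.

End step_duality.

(** * Selection of cubes *)

Section selection.
Context {R : realType} {n : nat}.
Local Notation mu := (@lebesgue_Rn R n).

(** Processing cubes by decreasing values, a cube is kept when little of it is
covered by the cubes kept before; it then retains a large part of its own.  A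
rejected cube is largely covered by kept cubes, which carry larger values. *)
Lemma select_cubes (lam : R) (I : eqType) (s : seq I) (x : I -> R)
    (Q : I -> Rn R n * R) : 0 < lam < 1 -> uniq s ->
  pairwise (fun i j => x j <= x i) s ->
  (forall i, i \in s -> 0 <= x i) -> (forall i, i \in s -> 0 < (Q i).2) ->
  exists (t : seq I) (E : I -> set (Rn R n)),
  [/\ uniq t /\ {subset t <= s},
    forall i, i \in t -> measurable (E i) /\ E i `<=` cb (Q i),
    disjoint_on t E,
    forall i, i \in t -> (1 - lam) * vol (cb (Q i)) <= vol (E i) &
    forall i, i \in s ->
      lam * vol (cb (Q i)) < vol (cb (Q i) `&` [set y | x i <= step t x E y])].
Proof.
move=> /andP[lam0 lam1]; elim/last_ind: s => [|s i IH] us sx x0 Q0.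
  by exists [::], (fun=> set0); split.
move: us sx; rewrite rcons_uniq pairwise_rcons => /andP[nis us] /andP[xi sx].
have sub j : j \in s -> j \in rcons s i by rewrite mem_rcons in_cons => ->; rewrite orbT.
have [t [E [[ut ts] hE dE vE cov]]] := IH us sx (fun j js => x0 j (sub j js)) (fun j js => Q0 j (sub j js)).
have si : i \in rcons s i by rewrite mem_rcons mem_head.
have nit : i \notin t by apply/negP => /ts; apply/negP.
pose U := [set y | exists2 j, j \in t & E j y].
have mU : measurable U by apply: measurable_bigcup_seq => j /hE[].
have mQ j : measurable (cb (Q j)) by exact: measurable_cb.
have xt0 j : j \in t -> 0 <= x j by move=> /ts/sub/x0.
have Ux y : U y -> x i <= step t x E y.
  move=> [j jt Ej]; rewrite (step_in x ut dE jt Ej).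
  by move/allP : xi; apply; exact: ts.
have mlev j t' (E' : I -> set (Rn R n)) : (forall i, i \in t' -> measurable (E' i)) ->
    measurable (cb (Q j) `&` [set y | x j <= step t' x E' y]).
  move=> mE'; apply: measurableI => //; apply: measurable_set_le => //.
  exact: measurable_step.
have flev j t' (E' : I -> set (Rn R n)) : (forall i, i \in t' -> measurable (E' i)) ->
    (mu (cb (Q j) `&` [set y | x j <= step t' x E' y]%R) < +oo)%E.
  by move=> mE'; apply: (cb_fin_sub (c := Q j) (mlev j t' E' mE')) => y [].
have mEt j : j \in t -> measurable (E j) by move=> /hE[].
have [dense|sparse] := ltP (lam * vol (cb (Q i))) (vol (cb (Q i) `&` U)).
  exists t, E; split => //.
    by split => // j /ts/sub.
  move=> j; rewrite mem_rcons in_cons => /predU1P[->|]; last exact: cov.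
  apply: lt_le_trans dense _; have mQU : measurable (cb (Q i) `&` U) by exact: measurableI.
  apply: (vol_le mQU (mlev i t E mEt) _ (flev i t E mEt)).
  by move=> y [Qy Uy]; split => //=; exact: Ux.
pose E' j := if j == i then cb (Q i) `\` U else E j.
have E'E j : j \in t -> E' j = E j.
  by move=> jt; rewrite /E'; case: eqP => // ji; rewrite ji (negbTE nit) in jt.
have E'i : E' i = cb (Q i) `\` U by rewrite /E' eqxx.
have mE' j : j \in i :: t -> measurable (E' j).
  rewrite in_cons => /predU1P[->|jt]; first by rewrite E'i; exact: measurableD.
  by rewrite E'E//; exact: mEt.
have step' y : step (i :: t) x E' y = x i * \1_(cb (Q i) `\` U) y + step t x E y.
  rewrite /step big_cons E'i; congr (_ + _); rewrite big_seq [RHS]big_seq.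
  by apply: eq_bigr => j jt; rewrite E'E.
have step_le y : step t x E y <= step (i :: t) x E' y.
  by rewrite step' lerDr mulr_ge0 ?indic_ge0// x0.
exists (i :: t), E'; split.
- split; first by rewrite /= nit.
  by move=> j; rewrite in_cons => /predU1P[->//|/ts/sub].
- move=> j jt; split; first exact: mE'.
  move: jt; rewrite in_cons => /predU1P[->|jt]; first by rewrite E'i => y [].
  by rewrite E'E//; have [] := hE j jt.
- move=> j k y; rewrite !in_cons => /predU1P[->|jt] /predU1P[->|kt]//.
  + by rewrite E'i E'E// => -[_ nU] Ek; exfalso; apply: nU; exists k.
  + by rewrite E'i E'E// => Ej -[_ nU]; exfalso; apply: nU; exists j.
  + by rewrite !E'E//; exact: dE.
- move=> j; rewrite in_cons => /predU1P[->|jt]; last by rewrite E'E//; exact: vE.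
  rewrite E'i; have := vol_split (mQ i) mU (cb_fin (Q i)); lra.
- move=> j; rewrite mem_rcons in_cons => /predU1P[->|js].
    have -> : cb (Q i) `&` [set y | x i <= step (i :: t) x E' y] = cb (Q i).
      apply/seteqP; split => y; first by case.
      move=> Qy; split => //=; have [Uy|nUy] := pselect (U y).
        exact: le_trans (Ux y Uy) (step_le y).
      rewrite step' indicE mem_set// mulr1 lerDl step_ge0//.
    by rewrite gtr_pMl// vol_cb_gt0 ?Q0.
  apply: lt_le_trans (cov j js) _; apply: (vol_le (mlev j t E mEt) (mlev j _ _ mE') _ (flev j _ _ mE')).
  by move=> y [Qy /= h]; split => //=; exact: le_trans h (step_le y).
Qed.

End selection.

(** * Medians *)

Section medians.
Context {R : realType} {n : nat}.
Local Notation mu := (@lebesgue_Rn R n).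

Lemma vol_bigcup_le (A : nat -> set (Rn R n)) (v : R) :
  (forall j, measurable (A j)) -> {homo A : i j / (i <= j)%N >-> i `<=` j} ->
  (mu (\bigcup_j A j) < +oo)%E -> (forall j, vol (A j) <= v) -> vol (\bigcup_j A j) <= v.
Proof.
move=> mA ndA fA hA; have mU : measurable (\bigcup_j A j) by exact: bigcupT_measurable.
have cA : (mu \o A) j @[j --> \oo] --> mu (\bigcup_j A j).
  by apply: nondecreasing_cvg_mu => // i j ij; apply/subsetPset; exact: ndA.
suff : (mu (\bigcup_j A j) <= v%:E)%E by rewrite (volE fA) lee_fin.
have : (limn (mu \o A) <= v%:E)%E.
  apply: lime_le; first by apply/cvg_ex; eexists; exact: cA.
  apply: nearW => j; have fj : (mu (A j) < +oo)%E.
    by apply: mu_fin_sub fA => //; exact: bigcup_sup.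
  by have -> : (mu \o A) j = (vol (A j))%:E := volE fj; rewrite lee_fin.
by rewrite (cvg_lim _ cA).
Qed.

(** The median is the infimum of the levels below which [h] lies on half of [E];
continuity of the measure from below gives both estimates at the infimum. *)
Lemma median_exists (h : Rn R n -> R) (E : set (Rn R n)) : measurable_fun setT h ->
  (forall x, 0 <= h x) -> measurable E -> (mu E < +oo)%E -> 0 < vol E ->
  exists m : R, [/\ 0 <= m, vol E / 2 <= vol (E `&` [set x | h x <= m]) &
    vol E / 2 <= vol (E `&` [set x | m <= h x])].
Proof.
move=> mh h0 mE fE vE.
have mlow a : measurable (E `&` [set x | h x <= a]).
  by apply: measurableI => //; exact: measurable_set_le.
have mupp a : measurable (E `&` [set x | a <= h x]).
  by apply: measurableI => //; exact: measurable_set_le.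
have mstr a : measurable (E `&` [set x | a < h x]).
  by apply: measurableI => //; exact: measurable_set_lt.
have mstl a : measurable (E `&` [set x | h x < a]).
  by apply: measurableI => //; exact: measurable_set_lt.
have sub (A B : set (Rn R n)) : measurable (E `&` A) -> measurable (E `&` B) ->
    A `<=` B -> vol (E `&` A) <= vol (E `&` B).
  move=> mA mB AB; apply: vol_le => //; first by move=> x [Ex /AB].
  by apply: mu_fin_sub fE => // x [].
have compl_low a : vol E = vol (E `&` [set x | h x <= a]) + vol (E `&` [set x | a < h x]).
  have -> : E `&` [set x | a < h x] = E `\` (E `&` [set x | h x <= a]).
    apply/seteqP; split => x; first by move=> [Ex /= ax]; split => // -[_ /=]; rewrite leNgt ax.
    by move=> [Ex nh]; split => //=; rewrite ltNge; apply/negP => ha; apply: nh.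
  by rewrite (vol_split mE (mlow a) fE) setIA setIid.
have compl_upp a : vol E = vol (E `&` [set x | a <= h x]) + vol (E `&` [set x | h x < a]).
  have -> : E `&` [set x | h x < a] = E `\` (E `&` [set x | a <= h x]).
    apply/seteqP; split => x; first by move=> [Ex /= ax]; split => // -[_ /=]; rewrite leNgt ax.
    by move=> [Ex nh]; split => //=; rewrite ltNge; apply/negP => ha; apply: nh.
  by rewrite (vol_split mE (mupp a) fE) setIA setIid.
pose S := [set a : R | 0 <= a /\ vol E / 2 <= vol (E `&` [set x | h x <= a])].
have S_lb : has_lbound S by exists 0 => a [].
have S0 : S !=set0.
  apply: contrapT => nS.
  have small j : vol (E `&` [set x | h x <= j%:R]) <= vol E / 2.
    rewrite leNgt; apply/negP => hj; apply: nS; exists j%:R; split => //; exact: ltW.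
  have := @vol_bigcup_le (fun j => E `&` [set x | h x <= j%:R]) (vol E / 2) (fun j => mlow _).
  have -> : \bigcup_j (E `&` [set x | h x <= j%:R]) = E.
    apply/seteqP; split => x; first by move=> [j _ []].
    move=> Ex; exists (Num.truncn (h x)).+1 => //; split => //=.
    by rewrite ltW// truncnS_gt.
  move=> /(_ _ fE small); suff : {homo (fun j => E `&` [set x | h x <= j%:R]) : i j / (i <= j)%N >-> i `<=` j}.
    by move=> nd /(_ nd); lra.
  by move=> i j ij x [Ex /= hx]; split => //=; rewrite (le_trans hx)// ler_nat.
pose m := inf S.
have m0 : 0 <= m by apply: lb_le_inf => // a [].
exists m; split => //.
- suff : vol (E `&` [set x | m < h x]) <= vol E / 2 by have := compl_low m; lra.
  have -> : E `&` [set x | m < h x] = \bigcup_j (E `&` [set x | m + j.+1%:R^-1 < h x]).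
    apply/seteqP; split => x.
      move=> [Ex /= mx]; have d0 : 0 < h x - m by rewrite subr_gt0.
      exists (Num.truncn (h x - m)^-1) => //; split => //=.
      rewrite -ltrBrDl -[ltRHS]invrK ltf_pV2 ?posrE ?invr_gt0//.
      by apply: truncnS_gt; rewrite invr_ge0 ltW.
    by move=> [j _ [Ex /= hx]]; split => //=; apply: lt_trans hx; rewrite ltrDl invr_gt0.
  apply: vol_bigcup_le => //.
  + move=> i j ij x [Ex /= hx]; split => //=; apply: le_lt_trans hx.
    by rewrite lerD2l lef_pV2 ?posrE// ler_nat ltnS.
  + apply: mu_fin_sub fE => //; first exact: bigcupT_measurable.
    by move=> x [j _ []].
  move=> j; have j0 : 0 < j.+1%:R^-1 :> R by rewrite invr_gt0.
  have [a [a0 Sa] am] := inf_adherent j0 (conj S0 S_lb).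
  have := compl_low a; suff : vol (E `&` [set x | m + j.+1%:R^-1 < h x]) <= vol (E `&` [set x | a < h x]) by lra.
  by apply: sub => // x /=; apply: lt_trans.
- suff : vol (E `&` [set x | h x < m]) <= vol E / 2 by have := compl_upp m; lra.
  have -> : E `&` [set x | h x < m] = \bigcup_j (E `&` [set x | h x <= m - j.+1%:R^-1]).
    apply/seteqP; split => x.
      move=> [Ex /= mx]; have d0 : 0 < m - h x by rewrite subr_gt0.
      exists (Num.truncn (m - h x)^-1) => //; split => //=.
      rewrite lerBrDr -lerBrDl -[leRHS]invrK lef_pV2 ?posrE ?invr_gt0// ltW//.
      by apply: truncnS_gt; rewrite invr_ge0 ltW.
    by move=> [j _ [Ex /= hx]]; split => //=; apply: le_lt_trans hx _; rewrite ltrBlDr ltrDl invr_gt0.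
  apply: vol_bigcup_le => //.
  + move=> i j ij x [Ex /= hx]; split => //=; apply: le_trans hx _.
    by rewrite lerD2l lerN2 lef_pV2 ?posrE// ler_nat ltnS.
  + apply: mu_fin_sub fE => //; first exact: bigcupT_measurable.
    by move=> x [j _ []].
  move=> j; set a := m - _.
  have am : a < m by rewrite /a ltrBlDr ltrDl invr_gt0.
  rewrite leNgt; apply/negP => ha.
  have [a0|a0] := leP 0 a.
    have : m <= a by apply: ge_inf => //; split => //; exact: ltW.
    by rewrite leNgt am.
  move: ha; rewrite (_ : E `&` _ = set0).
    by rewrite /vol measure0/= ltNge divr_ge0// vol_ge0.
  by apply/seteqP; split => // x [_ /= hx]; have := le_lt_trans hx a0; rewrite ltNge h0.
Qed.

End medians.

(** * Averages over selected cubes *)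

Section averages_of_selected_cubes.
Context {R : realType} {n : nat}.
Local Notation mu := (@lebesgue_Rn R n).
Variable X : function_space (Rn R n) R.
Hypothesis HX : is_Banach_function_space mu X.
Local Notation X' := (associate mu X).
Hypothesis XQ : forall c : Rn R n * R, 0 < c.2 -> carrier X \1_(cb c).
Hypothesis X'Q : forall c : Rn R n * R, 0 < c.2 -> carrier X' \1_(cb c).
Implicit Types (f : Rn R n -> R).
Local Notation I := (fun f => \int[mu]_x f x).

Lemma cube_integral_fin f c : carrier X f -> 0 < c.2 ->
  (cube_integral f c < +oo)%E.
Proof.
move=> Xf c0; have h := bfs_associate_hoelder HX Xf (X'Q c0).
apply: (le_lt_trans _ (ltry (norm X' \1_(cb c) * norm X f))).
apply: le_trans h; rewrite /cube_integral -integral_mul_indic.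
rewrite le_eqVlt; apply/orP; left; apply/eqP; apply: eq_integral => x _.
by rewrite normrM (ger0_norm (indic_ge0 _ _)) mulrC.
Qed.

Lemma seq_pos_min (J : eqType) (t : seq J) (v : J -> R) :
  (forall i, i \in t -> 0 < v i) -> exists2 d : R, 0 < d & forall i, i \in t -> d <= v i.
Proof.
elim: t => [|i t IH] v0; first by exists 1.
have [d d0 hd] := IH (fun j jt => v0 j (@mem_behead _ (i :: t) j jt)).
exists (Num.min (v i) d); first by rewrite lt_min d0 v0// mem_head.
move=> j; rewrite in_cons => /predU1P[->|/hd h]; first by rewrite ge_min lexx.
by rewrite ge_min h orbT.
Qed.

Variables kap K1 K2 K3 : R.
Hypothesis kap0 : 0 < kap.
Hypotheses (K1_gt0 : 0 < K1) (K2_gt0 : 0 < K2) (K3_gt0 : 0 < K3).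
Hypothesis spreadX : spreads (kap / 8) X K1.
Hypothesis spreadX' : spreads (kap / 2) X' K2.
Hypothesis fillX' : fills_cubes kap X' K3.

(** A convex set of functions below the step function of the averages, keeping half
of its mass on each [E i], either approaches a ball of [X] or is separated from it.
In the first case [step_spread] bounds the step function.  In the second case the
separating [g] is tested where it lies below its medians on the sets [E i]; the step
function of the medians is then still bounded by [g] in norm, it can be spread over
the whole cubes, and there it meets the averages of [f]. *)
Lemma norm_step_average_le (J : eqType) (t : seq J) (Q : J -> Rn R n * R)
    (E : J -> set (Rn R n)) f :
  carrier X f -> uniq t -> (forall i, i \in t -> 0 < (Q i).2) ->
  (forall i, i \in t -> measurable (E i)) ->
  (forall i, i \in t -> E i `<=` cb (Q i)) -> disjoint_on t E ->
  (forall i, i \in t -> kap * vol (cb (Q i)) <= vol (E i)) ->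
  (forall i, i \in t -> 0 < average f (Q i)) ->
  norm X (step t (fun i => average f (Q i)) E) <= 8 * K1 * K2 * K3 * norm X f.
Proof.
move=> Xf ut Q0 mE EQ dE vE avg0; rewrite leNgt; apply/negP => big.
have mf := bfs_measurable HX Xf.
have HX' := associate_bfs HX.
set nf := norm X f in big; set nF := norm X _ in big.
have nf0 : 0 <= nf by exact: (bfs_norm_ge0 HX).
(* Normalization: [F] below has norm larger than [8 * K1], whereas the pairing of
   [tau^-1 * f] with a function of norm [K2 * K3] is less than one. *)
pose tau := (K2 * K3 * nf + nF / (8 * K1)) / 2.
have K81 : 0 < 8 * K1 by rewrite mulr_gt0.
have gap : K2 * K3 * nf < nF / (8 * K1).
  rewrite ltr_pdivlMr//; apply: le_lt_trans big.
  by rewrite le_eqVlt; apply/orP; left; apply/eqP; ring.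
have tau_lo : K2 * K3 * nf < tau := (midf_lt gap).1.
have tau_hi : tau < nF / (8 * K1) := (midf_lt gap).2.
have tau0 : 0 < tau by apply: le_lt_trans tau_lo; rewrite !mulr_ge0// ltW.
pose x i := tau^-1 * average f (Q i).
have x0 i : i \in t -> 0 < x i by move=> it; rewrite mulr_gt0 ?invr_gt0 ?avg0.
have x0' i : i \in t -> 0 <= x i by move=> /x0/ltW.
pose F := step t x E.
have FE : F = fun y => tau^-1 * step t (fun i => average f (Q i)) E y.
  apply/funext => y; rewrite /F /step mulr_sumr; apply: eq_bigr => i _.
  by rewrite /x -mulrA.
have Xavg : carrier X (step t (fun i => average f (Q i)) E).
  exact: (step_carrier _ HX XQ Q0 mE EQ).
have XF : carrier X F by rewrite FE; exact: (bfs_scale HX).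
have NF : 8 * K1 < norm X F.
  rewrite FE (bfs_normZ HX)// gtr0_norm ?invr_gt0// -/nF.
  by rewrite [_^-1 * _]mulrC ltr_pdivlMr// mulrC -ltr_pdivlMr.
have F0 y : 0 <= F y by exact: step_ge0.
have mF : measurable_fun setT F by exact: (bfs_measurable HX XF).
pose Om := cubes_union [seq Q i | i <- t].
have mOm : measurable Om by exact: measurable_cubes_union.
have Omfin : (mu Om < +oo)%E by exact: cubes_union_fin.
have EOm i : i \in t -> E i `<=` Om.
  by move=> it y Ey; exists (Q i); [apply/mapP; exists i|exact: EQ].
pose c := \sum_(i <- t) x i.
have Fc y : F y <= c * \1_Om y.
  have [[i it Ei]|no] := pselect (exists2 i, i \in t & E i y); last first.
    rewrite /F step_out; last by move=> i it Ei; apply: no; exists i.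
    by rewrite mulr_ge0 ?indic_ge0// /c big_seq sumr_ge0// => i /x0'.
  rewrite indicE mem_set ?mulr1; last exact: (EOm i).
  rewrite /F /step /c big_seq [leRHS]big_seq; apply: ler_sum => j jt.
  by rewrite ler_piMr ?x0'// indicE; case: (_ \in _).
have bF : bounded_on Om F by apply: bounded_on_le mF (_ : forall y, `|F y| <= c * \1_Om y) => y; rewrite ger0_norm.
have bsub (A : set (Rn R n)) : measurable A -> A `<=` Om -> bounded_on Om (\1_A : Rn R n -> R).
  move=> mA AO; apply: (bounded_on_dom _ (bounded_on_indic mOm)); first exact: measurable_indic.
  by move=> y; exact: indic_sub.
have bE i : i \in t -> bounded_on Om (\1_(E i) : Rn R n -> R).
  by move=> it; apply: bsub; [exact: mE|exact: EOm].
have Iind A : measurable A -> I \1_A = vol A.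
  by move=> mA; rewrite /Rintegral integral_indic// setIT.
have vE0 i : i \in t -> 0 < vol (E i).
  by move=> it; apply: lt_le_trans (vE i it); rewrite mulr_gt0// vol_cb_gt0 ?Q0.
have fE i : i \in t -> (mu (E i) < +oo)%E.
  by move=> it; exact: cb_fin_sub (mE i it) (EQ i it).
have stepE (A : J -> set (Rn R n)) i y : (forall j, j \in t -> A j `<=` E j) -> i \in t ->
    step t x A y * \1_(E i) y = x i * \1_(A i) y.
  move=> AE it; have dA : disjoint_on t A.
    by move=> j k z jt kt Aj Ak; apply: (dE j k z) => //; exact: AE.
  have [Ei|nEi] := pselect (E i y); last first.
    by rewrite !indicE (memNset nEi) memNset ?mulr0// => /(AE i it).
  rewrite [\1_(E i) y]indicE mem_set// mulr1.
  have [Ai|nAi] := pselect (A i y); first by rewrite (step_in x ut dA it Ai) indicE mem_set// mulr1.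
  rewrite indicE memNset// mulr0 step_out// => j jt Aj.
  by have ji := dE j i y jt it (AE j jt y Aj) Ei; apply: nAi; rewrite -ji.
(* Half of the mass of [F] remains on the part of [E i] where a function lies below its
   median, so this part is allowed as the support of an element of [K]. *)
pose K := [set k : Rn R n -> R | [/\ measurable_fun setT k, forall y, 0 <= k y <= F y &
   forall i, i \in t -> x i * vol (E i) / 2 <= I (fun y => k y * \1_(E i) y)]].
have bK k : K k -> bounded_on Om k.
  move=> [mk kF _]; apply: (bounded_on_dom mk bF) => y.
  by have /andP[k0 kF'] := kF y; rewrite !ger0_norm.
have [] := @convex_separation _ _ _ mu X HX Om mOm Omfin K c.
- move=> k [mk kF _]; split => // y; have /andP[k0 kF'] := kF y.
  by rewrite k0 (le_trans kF').
- exists F; split => // [y|i it]; first by rewrite F0 lexx.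
  have -> : (fun y => F y * \1_(E i) y) = (fun y => x i * \1_(E i) y).
    by apply/funext => y; exact: (stepE E i y (fun j _ => @subset_refl _ (E j)) it).
  rewrite (bdd_intZ mOm Omfin); last exact: bE.
  rewrite Iind; last exact: mE.
  by rewrite ler_pdivrMr// ler_peMr ?ler1n// mulr_ge0 ?x0'// ltW// vE0.
- move=> k l s Kk Kl /andP[s0 s1]; have [mk kF kI] := Kk; have [ml lF lI] := Kl.
  have bk := bK _ Kk; have bl := bK _ Kl.
  split.
  + by apply: measurable_funD; exact: measurable_funM.
  + move=> y; have /andP[k0 kF'] := kF y; have /andP[l0 lF'] := lF y.
    have s1' : 0 <= 1 - s by rewrite subr_ge0.
    rewrite addr_ge0 ?mulr_ge0//=.
    have -> : F y = (1 - s) * F y + s * F y by ring.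
    by rewrite lerD// ler_wpM2l.
  + move=> i it.
    have -> : (fun y => ((1 - s) * k y + s * l y) * \1_(E i) y) =
        (fun y => (1 - s) * (k y * \1_(E i) y) + s * (l y * \1_(E i) y)).
      by apply/funext => y; ring.
    have bkE := bounded_onM bk (bE i it); have blE := bounded_onM bl (bE i it).
    rewrite (bdd_intD mOm Omfin); [|exact: bounded_onZ|exact: bounded_onZ].
    rewrite !(bdd_intZ mOm Omfin)//.
    have s1' : 0 <= 1 - s by rewrite subr_ge0.
    have h1 := ler_wpM2l s1' (kI i it); have h2 := ler_wpM2l s0 (lI i it).
    have -> : x i * vol (E i) / 2 = (1 - s) * (x i * vol (E i) / 2) + s * (x i * vol (E i) / 2).
      by field.
    exact: lerD.
- move=> [g [bg g0 g1 gK]].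
  have mg := bg.1.
  have X'g : carrier X' g by split => //; apply: le_lt_trans g1 _; rewrite ltry.
  have Ng : norm X' g <= 1 by rewrite -lee_fin -(associate_fin HX).
  have /choice[m hm] : forall i, exists m : R, i \in t -> [/\ 0 <= m,
      vol (E i) / 2 <= vol (E i `&` [set y | g y <= m]) &
      vol (E i) / 2 <= vol (E i `&` [set y | m <= g y])].
    move=> i; have [it|_] := boolP (i \in t); last by exists 0.
    by have [m hm] := median_exists mg g0 (mE i it) (fE i it) (vE0 i it); exists m.
  have m0 i : i \in t -> 0 <= m i by move=> /hm[].
  pose low i := E i `&` [set y | g y <= m i].
  pose upp i := E i `&` [set y | m i <= g y].
  have lowE i : i \in t -> low i `<=` E i by move=> _ y [].
  have uppE i : i \in t -> upp i `<=` E i by move=> _ y [].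
  have mlow i : i \in t -> measurable (low i).
    by move=> it; apply: measurableI; [exact: mE|exact: measurable_set_le].
  have mupp i : i \in t -> measurable (upp i).
    by move=> it; apply: measurableI; [exact: mE|exact: measurable_set_le].
  pose k := step t x low.
  have k0 y : 0 <= k y by exact: step_ge0.
  have mk : measurable_fun setT k by exact: measurable_step.
  have Kk : K k.
    split => // [y|i it].
      rewrite k0 /k /F /step big_seq [leRHS]big_seq; apply: ler_sum => i it.
      rewrite ler_wpM2l ?x0'//; have := indic_sub (R := R) y (lowE i it).
      by rewrite !ger0_norm ?indic_ge0.
    have -> : (fun y => k y * \1_(E i) y) = (fun y => x i * \1_(low i) y).
      by apply/funext => y; exact: (stepE low i y lowE it).
    rewrite (bdd_intZ mOm Omfin); last first.
      by apply: bsub; [exact: mlow|move=> y [/(EOm i it)]].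
    rewrite Iind; last exact: mlow.
    by rewrite -mulrA ler_wpM2l ?x0'//; have [_ h _] := hm i it.
  have sum_ge1 : 1 <= \sum_(i <- t) x i * (m i * vol (E i)).
    apply: le_trans (gK k Kk) _; rewrite -lee_fin.
    rewrite (bdd_intE mOm Omfin); last by apply: bounded_onM => //; exact: bK.
    rewrite integral_mul_step// -sumEFin big_seq [leRHS]big_seq; apply: lee_sum => i it.
    rewrite [leRHS]EFinM lee_wpmul2l ?lee_fin ?x0'//.
    apply: (@le_trans _ _ (\int[mu]_(y in low i) (m i)%:E)%E).
      apply: ge0_le_integral => //; [exact: mlow|by move=> y _; rewrite lee_fin| |].
      - by apply/measurable_EFinP; exact: measurable_funTS.
      - by move=> y [_ /= gm]; rewrite lee_fin.
    have mli := mlow i it.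
    rewrite (integral_cst _ mli) [leRHS]EFinM lee_wpmul2l ?lee_fin ?m0// -(volE (fE i it)).
    by apply: le_measure; rewrite ?inE//; [exact: mE|exact: lowE].
  have Xupp : carrier X' (step t m upp).
    exact: (step_carrier m HX' X'Q Q0 mupp (fun i it => subset_trans (uppE i it) (EQ i it))).
  have Nupp : norm X' (step t m upp) <= 1.
    apply: le_trans Ng; apply: (bfs_norm_le HX' X'g); first exact: Xupp.1.
    apply: aeW => y; rewrite (ger0_norm (g0 y)) ger0_norm ?step_ge0//.
    have dupp : disjoint_on t upp.
      by move=> i j z it jt [Ei _] [Ej _]; exact: (dE i j z).
    have [[i it ui]|no] := pselect (exists2 i, i \in t & upp i y).
      by rewrite (step_in m ut dupp it ui); exact: ui.2.
    by rewrite step_out// => i it ui; apply: no; exists i.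
  have vupp i : i \in t -> kap / 2 * vol (cb (Q i)) <= vol (upp i).
    move=> it; have [_ _ h] := hm i it; apply: le_trans h.
    by rewrite mulrAC ler_pM2r ?invr_gt0// vE.
  have [XmE NmE] := spreadX' ut m0 Q0 mE mupp EQ uppE dE vupp Xupp.
  have NmE2 : norm X' (step t m E) <= K2 by apply: le_trans NmE _; rewrite ler_piMr// ltW.
  have NmQ := fillX' ut m0 Q0 mE EQ dE vE.
  have NmQ2 : norm X' (step t m (fun i => cb (Q i))) <= K3 * K2.
    by apply: le_trans NmQ _; rewrite ler_wpM2l// ltW.
  have XmQ : carrier X' (step t m (fun i => cb (Q i))).
    exact: (step_carrier m HX' X'Q Q0 (fun i _ => measurable_cb (Q i)) (fun i _ => @subset_refl _ _)).
  have maf : measurable_fun setT (fun y => `|f y|) by exact: measurableT_comp.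
  have := bfs_associate_hoelder HX Xf XmQ.
  have -> : (\int[mu]_y `|step t m (fun i => cb (Q i)) y * f y|%:E =
     \int[mu]_y (`|f y| * step t m (fun i => cb (Q i)) y)%:E)%E.
    apply: eq_integral => y _; rewrite normrM mulrC; congr (_ * _)%:E.
    by rewrite ger0_norm// step_ge0.
  rewrite integral_mul_step//; last by move=> i _; exact: measurable_cb.
  rewrite (eq_big_seq (fun i => (m i * (average f (Q i) * vol (cb (Q i))))%:E)); last first.
    by move=> i it; rewrite EFinM -cube_integral_average ?cube_integral_fin ?Q0.
  rewrite sumEFin lee_fin => hoelder_bound.
  have : \sum_(i <- t) x i * (m i * vol (E i)) <=
      tau^-1 * \sum_(i <- t) m i * (average f (Q i) * vol (cb (Q i))).
    rewrite mulr_sumr big_seq [leRHS]big_seq; apply: ler_sum => i it.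
    have -> : tau^-1 * (m i * (average f (Q i) * vol (cb (Q i)))) = x i * (m i * vol (cb (Q i))).
      by rewrite /x; ring.
    rewrite ler_wpM2l ?x0'// ler_wpM2l ?m0//.
    by apply: vol_le; [exact: mE|exact: measurable_cb|exact: EQ|exact: cb_fin].
  move=> /(le_trans sum_ge1).
  have bound : \sum_(i <- t) m i * (average f (Q i) * vol (cb (Q i))) <= K2 * K3 * nf.
    by apply: le_trans hoelder_bound _; rewrite [K2 * K3]mulrC ler_wpM2r.
  rewrite mulrC ler_pdivlMr// mul1r => /le_trans/(_ bound).
  by rewrite leNgt tau_lo.
move=> [k_ [b_ [Kk hb bk _ cvg0]]].
(* Were [b_ j] at least [x i / 8] on an eighth of every [E i], spreading would bound the
   norm of [F] by [8 * K1].  On some [E i] it is thus smaller on part of the set where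
   [k_ j] exceeds [x i / 4], which keeps [k_ j] and [b_ j] apart in L2. *)
pose del i := (x i / 8) ^+ 2 * (vol (E i) / 8).
have [d0 d0_gt0 hd0] : exists2 d : R, 0 < d & forall i, i \in t -> d <= del i.
  apply: seq_pos_min => i it; rewrite mulr_gt0// ?exprn_gt0// divr_gt0//.
  - exact: x0.
  - exact: vE0.
suff low_bound j : d0 <= I (fun y => (k_ j y - b_ j y) ^+ 2).
  have : d0 <= 0.
    rewrite -(cvg_lim _ cvg0)//; apply: limr_ge; first by apply/cvg_ex; eexists; exact: cvg0.
    exact: nearW.
  by rewrite leNgt d0_gt0.
have [mk kF kI] := Kk j; have [Xb Nb] := hb j; have mb := bfs_measurable HX Xb.
set k := k_ j in mk kF kI *; set b := b_ j in Xb Nb mb *.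
have b0k y : 0 <= b y <= k y by exact: bk.
have bk' := bK _ (Kk j); rewrite -/k in bk'.
pose G i := E i `&` [set y | x i / 8 <= b y].
have mG i : i \in t -> measurable (G i).
  by move=> it; apply: measurableI; [exact: mE|exact: measurable_set_le].
have GE i : i \in t -> G i `<=` E i by move=> _ y [].
have [i it Gsmall] : exists2 i, i \in t & vol (G i) < vol (E i) / 8.
  apply: contrapT => no.
  have Gbig i : i \in t -> vol (E i) / 8 <= vol (G i).
    by move=> it; rewrite leNgt; apply/negP => h; apply: no; exists i.
  have XG : carrier X (step t x G).
    exact: (step_carrier x HX XQ Q0 mG (fun i it => subset_trans (GE i it) (EQ i it))).
  have vG i : i \in t -> kap / 8 * vol (cb (Q i)) <= vol (G i).
    by move=> it; apply: le_trans (Gbig i it); rewrite mulrAC ler_pM2r ?invr_gt0// vE.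
  have [_ NFG] := spreadX ut x0' Q0 mE mG EQ GE dE vG XG.
  have Xb8 := bfs_scale HX 8 Xb.
  have NG : norm X (step t x G) <= 8.
    apply: (@le_trans _ _ (norm X (fun y => 8 * b y))).
      apply: (bfs_norm_le HX Xb8); first exact: (bfs_measurable HX XG).
      apply: aeW => y; have /andP[b0 _] := b0k y.
      rewrite !ger0_norm ?step_ge0 ?mulr_ge0//.
      have dG : disjoint_on t G.
        by move=> i' j' z it' jt' [Ei _] [Ej _]; exact: (dE i' j' z).
      have [[i it Gi]|no'] := pselect (exists2 i, i \in t & G i y).
        by rewrite (step_in x ut dG it Gi) -ler_pdivrMl// mulrC; exact: Gi.2.
      rewrite step_out ?mulr_ge0// => i it Gi; apply: no'; by exists i.
    by rewrite (bfs_normZ HX)// ger0_norm// ler_piMr.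
  have : norm X F <= K1 * 8 by apply: le_trans NFG _; rewrite ler_wpM2l// ltW.
  by rewrite leNgt mulrC NF.
apply: le_trans (hd0 i it) _.
pose A := E i `&` [set y | x i / 4 < k y].
have mA : measurable A by apply: measurableI; [exact: mE|exact: measurable_set_lt].
have AE : A `<=` E i by move=> y [].
have AO : A `<=` Om by move=> y /AE; exact: EOm.
have fA : (mu A < +oo)%E by apply: mu_fin_sub (fE i it) => //; exact: mE.
have bA := bsub A mA AO.
have xi0 := x0 i it.
have FEi y : E i y -> F y = x i by move=> Ei; exact: (step_in x ut dE it Ei).
have vA : vol (E i) / 4 <= vol A.
  have : I (fun y => k y * \1_(E i) y) <= I (fun y => x i / 4 * \1_(E i) y + x i * \1_A y).
    apply: (bdd_int_le mOm Omfin); [exact: bounded_onM bk' (bE i it)| |].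
      by apply: bounded_onD; apply: bounded_onZ => //; exact: bE.
    move=> y; rewrite !indicE; have [Ei|nEi] := pselect (E i y); last first.
      by rewrite (memNset nEi) memNset ?mulr0 ?addr0// => /AE.
    rewrite (mem_set Ei) !mulr1; have /andP[k0 kF'] := kF y; rewrite FEi// in kF'.
    have [Ay|nAy] := pselect (A y).
      rewrite mem_set// mulr1; apply: le_trans kF' _; rewrite lerDr divr_ge0// ltW//.
    rewrite memNset// mulr0 addr0 leNgt; apply/negP => h; apply: nAy; by split.
  rewrite (bdd_intD mOm Omfin); [|by apply: bounded_onZ; exact: bE|exact: bounded_onZ].
  rewrite !(bdd_intZ mOm Omfin)//; last exact: bE.
  rewrite !Iind//; last exact: mE.
  move=> /(le_trans (kI i it)) h.
  rewrite -(ler_pM2l xi0); move: h; lra.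
pose W := A `\` G i.
have mW : measurable W by apply: measurableD => //; exact: mG.
have WO : W `<=` Om by move=> y [/AO].
have vW : vol (E i) / 8 <= vol W.
  have mGi := mG i it.
  have vAG : vol (A `&` G i) <= vol (G i).
    apply: vol_le => //; [exact: measurableI|].
    by apply: mu_fin_sub (fE i it) => //; [exact: mE|exact: GE].
  have := vol_split mA mGi fA; rewrite -/W; lra.
apply: (@le_trans _ _ ((x i / 8) ^+ 2 * vol W)).
  by rewrite /del ler_wpM2l// sqr_ge0.
rewrite -(Iind W mW) -(bdd_intZ mOm Omfin); last exact: bsub.
have bb : bounded_on Om b.
  apply: (bounded_on_dom mb bk') => y; have /andP[b0 bky] := b0k y.
  by rewrite !ger0_norm// (le_trans b0).
have bkb : bounded_on Om (fun y => k y - b y) by exact: bounded_onB.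
apply: (bdd_int_le mOm Omfin).
- by apply: bounded_onZ; exact: bsub.
- by under eq_fun do rewrite expr2; exact: bounded_onM.
move=> y; rewrite indicE; have [Wy|nWy] := pselect (W y); last first.
  by rewrite memNset// mulr0 sqr_ge0.
rewrite mem_set// mulr1; have [[Ei /= ky] nG] := Wy.
have bx : b y < x i / 8 by rewrite ltNge; apply/negP => h; apply: nG; split.
rewrite lerXn2r ?nnegrE ?divr_ge0 ?(ltW xi0)//; last by lra.
by have /andP[_ ?] := b0k y; rewrite subr_ge0.
Qed.

End averages_of_selected_cubes.

(** * Finite families of cubes *)

Section finite_families.
Context {R : realType} {n : nat}.
Local Notation mu := (@lebesgue_Rn R n).
Variable X : function_space (Rn R n) R.
Hypothesis HX : is_Banach_function_space mu X.
Variables lam A D : R.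
Hypothesis lam01 : 0 < lam < 1.
Hypothesis A0 : 0 < A.
Hypothesis mX : median_bound lam X A.
Hypothesis XQ : forall c : Rn R n * R, 0 < c.2 -> carrier X \1_(cb c).
Hypothesis averages : forall (J : eqType) (t : seq J) (Q : J -> Rn R n * R)
    (E : J -> set (Rn R n)) (f : Rn R n -> R),
  carrier X f -> uniq t -> (forall i, i \in t -> 0 < (Q i).2) ->
  (forall i, i \in t -> measurable (E i)) ->
  (forall i, i \in t -> E i `<=` cb (Q i)) -> disjoint_on t E ->
  (forall i, i \in t -> (1 - lam) * vol (cb (Q i)) <= vol (E i)) ->
  (forall i, i \in t -> 0 < average f (Q i)) ->
  norm X (step t (fun i => average f (Q i)) E) <= D * norm X f.

(** The maximal function over finitely many cubes is dominated by the median maximal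
function of the step function of the averages over selected cubes. *)
Lemma norm_max_average_le (f : Rn R n -> R) (s : seq (Rn R n * R)) :
  carrier X f -> (forall c, c \in s -> 0 < c.2) ->
  carrier X (max_average f s) /\ norm X (max_average f s) <= A * D * norm X f.
Proof.
move=> Xf spos; pose r (c d : Rn R n * R) := average f d <= average f c.
pose s' := sort r (undup [seq c <- s | 0 < average f c]).
have s'E c : (c \in s') = (0 < average f c) && (c \in s).
  by rewrite mem_sort mem_undup mem_filter.
have us' : uniq s' by rewrite sort_uniq undup_uniq.
have rtrans : transitive r by move=> c d e h1 h2; exact: le_trans h2 h1.
have ps' : pairwise r s'.
  by rewrite -sorted_pairwise//; apply: sort_sorted => c d; exact: le_total.
have a0 c : c \in s' -> 0 <= average f c by rewrite s'E => /andP[/ltW].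
have pos' c : c \in s' -> 0 < c.2 by rewrite s'E => /andP[_ /spos].
have [t [E [[ut ts] hE dE vE cov]]] := select_cubes (Q := id) lam01 us' ps' a0 pos'.
pose F := step t (average f) E.
have mE c : c \in t -> measurable (E c) by move=> /hE[].
have EQ c : c \in t -> E c `<=` cb c by move=> /hE[].
have Q0 c : c \in t -> 0 < c.2 by move=> /ts/pos'.
have avg0 c : c \in t -> 0 < average f c by move=> /ts; rewrite s'E => /andP[].
have NF : norm X F <= D * norm X f := averages Xf ut Q0 mE EQ dE vE avg0.
have XF : carrier X F := step_carrier (average f) HX XQ Q0 mE EQ.
have [h [Xh hM Nh]] := mX XF.
have le : \forall y \ae mu, `|max_average f s y| <= `|h y|.
  move: hM; apply: filterS => y hy; rewrite ger0_norm ?max_average_ge0//.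
  apply: max_average_le => // c cs cy.
  have [c_pos|c_neg] := ltP 0 (average f c); last exact: le_trans c_neg _.
  apply: le_trans (ler_norm _); rewrite -lee_fin hy.
  have cs' : c \in s' by rewrite s'E c_pos.
  apply: (median_maximal_ge (bfs_measurable HX XF) (spos c cs) cy).
  apply: lt_le_trans (cov c cs') _.
  have mF := bfs_measurable HX XF.
  have mlev : measurable (cb c `&` [set z | average f c <= F z]).
    by apply: measurableI; [exact: measurable_cb|exact: measurable_set_le].
  have mlev' : measurable (cb c `&` [set z | average f c <= `|F z|]).
    by apply: measurableI; [exact: measurable_cb|exact: measurable_superlevel].
  apply: vol_le => //; last by apply: (cb_fin_sub (c := c)) => // z [].
  by move=> z [cz /= fz]; split => //=; exact: le_trans fz (ler_norm _).
have [XG NG] := bfs_ideal HX Xh (measurable_max_average _ _) le.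
split => //; apply: le_trans NG _; apply: le_trans Nh _.
by rewrite -mulrA ler_wpM2l// ltW.
Qed.

End finite_families.

Theorem corollary1p5 (R : realType) (n : nat) (n_gt0 : (0 < n)%N)
  (conjecture : forall s : R, 1 < s ->
     forall Y : function_space (Rn R n) R,
       is_Banach_function_space (lebesgue_Rn n) Y -> q_concave s Y ->
       bounded_operator (lebesgue_Rn n) maximal Y ->
       bounded_operator (lebesgue_Rn n) maximal (associate (lebesgue_Rn n) Y))
  (r : R) (r_gt1 : 1 < r)
  (X : function_space (Rn R n) R)
  (X_bfs : is_Banach_function_space (lebesgue_Rn n) X)
  (X_convex : p_convex r X)
  (lambda : R) (lambda01 : 0 < lambda < 1)
  (mX : bounded_operator (lebesgue_Rn n) (median_maximal lambda) X)
  (mX' : bounded_operator (lebesgue_Rn n) (median_maximal lambda)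
           (associate (lebesgue_Rn n) X)) :
  bounded_operator (lebesgue_Rn n) maximal X.
Proof.
have [A A0 mA] := mX; have [A' A'0 mA'] := mX'.
pose X' := associate (lebesgue_Rn n) X.
have X'_bfs : is_Banach_function_space (lebesgue_Rn n) X' := associate_bfs X_bfs.
have [g g1 growth] := density_growth n_gt0 lambda01.
have XQ c : 0 < c.2 -> carrier X \1_(cb c).
  exact: (indic_cube_carrier lambda01 g1 growth X_bfs A0 mA).
have X'Q c : 0 < c.2 -> carrier X' \1_(cb c).
  exact: (indic_cube_carrier lambda01 g1 growth X'_bfs A'0 mA').
(* The exponent conjugate to [r]. *)
pose s := r / (r - 1).
have r10 : 0 < r - 1 by rewrite subr_gt0.
have s1 : 1 < s by rewrite ltr_pdivlMr// mul1r ltrBlDr ltrDl.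
have rs : r^-1 + s^-1 = 1.
  by rewrite invf_div; field; lra.
have X'_concave : q_concave s X' := associate_q_concave X_bfs r_gt1 s1 rs X_convex.
(* The power is chosen so large that the growth of densities outweighs the norm of the
   median maximal operator on the associate space. *)
have [k gk] := @expr_unbounded R g A' g1.
pose N := k.+1.
have AgN : A' < g ^+ N.
  by apply: lt_le_trans gk _; rewrite exprS ler_peMl ?exprn_ge0 ?(ltW g1)// ltW// (lt_trans _ g1).
pose Y := power_space N X'.
have Y_bfs : is_Banach_function_space (lebesgue_Rn n) Y := power_space_bfs X'_bfs (ltn0Sn k).
have s0 : 0 < s by exact: lt_trans s1.
have Y_concave : q_concave (N%:R * s) Y := power_space_q_concave (ltn0Sn k) s0 X'_concave.
have Ns1 : 1 < N%:R * s.
  by apply: lt_le_trans s1 _; rewrite ler_peMl ?(ltW s0)// ler1n.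
have MY : bounded_operator (lebesgue_Rn n) maximal Y.
  exact: (maximal_power_space n_gt0 lambda01 g1 growth X'_bfs A'0 mA' (ltn0Sn k) AgN).
have MY' := conjecture _ Ns1 Y Y_bfs Y_concave MY.
have kap0 : 0 < 1 - lambda by have /andP[_ h] := lambda01; rewrite subr_gt0.
have [K3 K3_gt0 fillX'] := step_dual X'_bfs X'Q (ltn0Sn k) MY' kap0.
have [K1 K1_gt0 spreadX] := step_spread lambda01 g1 growth X_bfs A0 mA
  (divr_gt0 kap0 (ltr0n R 8 : 0 < 8)).
have [K2 K2_gt0 spreadX'] := step_spread lambda01 g1 growth X'_bfs A'0 mA'
  (divr_gt0 kap0 (ltr0n R 2 : 0 < 2)).
pose D := 8 * K1 * K2 * K3.
have D0 : 0 < D by rewrite !mulr_gt0.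
have avg := norm_step_average_le X_bfs XQ X'Q kap0 K1_gt0 K2_gt0 K3_gt0 spreadX spreadX' fillX'.
apply: (maximal_bounded n_gt0 X_bfs (mulr_gt0 A0 D0)).
  by move=> f c; exact: (cube_integral_fin X_bfs X'Q).
move=> f m Xf; apply: (norm_max_average_le X_bfs lambda01 A0 mA XQ avg Xf) => c.
exact: rational_cubes_gt0.
Qed.
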